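(* For every integer $N \ge 3$ with $N \ne 4$, there is, up to similarity, exactly one right triangle that tiles the regular $N$-gon $R_N$.
   Context: A triangle $T$ is said to tile a polygon $A$ if $A$ can be dissected into finitely many nonoverlapping triangles (that is, $A$ is the union of finitely many triangles with pairwise disjoint interiors), each of which is similar to $T$. The tiles may have different sizes, may be reflected (similarity includes orientation-reversing similarities), and the dissection need not be edge-to-edge. $R_N$ denotes the regular $N$-gon in the Euclidean plane. Whether $T$ tiles $A$ depends only on the similarity class of $T$, so right triangles are counted up to similarity. *)

(* Defs.v *)
From mathcomp Require Import all_boot all_order all_algebra.
From mathcomp Require Import all_classical all_reals all_analysis.

Set Implicit Arguments.
Unset Strict Implicit.
Unset Printing Implicit Defensive.

Import Order.TTheory GRing.Theory Num.Theory.
Import numFieldNormedType.Exports.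

Local Open Scope classical_set_scope.
Local Open Scope ring_scope.

(* The library norm on R * R is the sup norm: its topology is the Euclidean
   one (so the library's interior is the right one), but its distance is not. *)
Notation plane R := (R * R)%type (only parsing).

Definition dot (R : realType) (p q : plane R) : R := p.1 * q.1 + p.2 * q.2.

Definition cross (R : realType) (p q : plane R) : R := p.1 * q.2 - p.2 * q.1.

Definition euclid_dist (R : realType) (p q : plane R) : R :=
  Num.sqrt (dot (p - q) (p - q)).

Definition convex_hull (R : realType) (S : set (plane R)) : set (plane R) :=
  smallest (@convex_set R (plane R)) S.

Record triangle (R : realType) := Triangle {
  vA : plane R;
  vB : plane R;
  vC : plane R;
  _ : cross (vB - vA) (vC - vA) != 0 }.

Definition region (R : realType) (T : triangle R) : set (plane R) :=
  convex_hull [set vA T; vB T; vC T].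

Definition right_triangle (R : realType) (T : triangle R) : Prop :=
  [\/ dot (vB T - vA T) (vC T - vA T) = 0,
      dot (vA T - vB T) (vC T - vB T) = 0
    | dot (vA T - vC T) (vB T - vC T) = 0].

(* Orientation-reversing similarities are included. *)
Definition similarity (R : realType) (f : plane R -> plane R) : Prop :=
  exists2 k : R, 0 < k & forall p q, euclid_dist (f p) (f q) = k * euclid_dist p q.

Definition similar_triangle (R : realType) (T T' : triangle R) : Prop :=
  exists2 f : plane R -> plane R,
    similarity f & f @` region T = region T'.

Definition tiles (R : realType) (T : triangle R) (A : set (plane R)) : Prop :=
  exists (n : nat) (t : 'I_n -> triangle R),
    [/\ forall i, similar_triangle T (t i),
        \bigcup_i region (t i) = A
      & trivIset setT (fun i => (region (t i))°)].

(* The regular N-gon, normalized to be inscribed in the unit circle. *)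
Definition regular_polygon (R : realType) (N : nat) : set (plane R) :=
  convex_hull [set (cos (2 * pi * k%:R / N%:R), sin (2 * pi * k%:R / N%:R))
              | k in `I_N].

Arguments regular_polygon R N : clear implicits.

(* Main.v *)
Require Import Defs.
From mathcomp Require Import all_boot all_order all_algebra.
From mathcomp Require Import all_classical all_reals all_analysis.
From mathcomp Require Import all_field complex.
From mathcomp Require Import ring lra zify.

(** The lines from the centre of the regular [N]-gon to its vertices and to the
    midpoints of its sides cut it into [2 N] congruent right triangles with an
    angle [pi / N]. These are the tiles of the theorem ([std_tiles_polygon]).

    Now let a right triangle with an acute angle [al] tile the polygon. Attach a
    number to each pair of a point and a line direction, and let the weight of a
    triangle be the sum, over its oriented sides, of the difference of the numbers
    at both ends. Sides that overlap in opposite directions cancel, and the total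
    weight of a family of triangles depends only on how often each point is
    covered, whatever the numbers are ([weight_sum]). For a suitable choice of the
    numbers the weight of a triangle is the angle under which it is seen from a
    point [O]: it is [0] if [O] is outside, the angle of the triangle if [O] is a
    vertex, and at least [pi] otherwise ([view_cases]). Taking for [O] a vertex of
    the polygon one finds natural numbers [a], [b], [r] with

      [a al + b (pi / 2 - al) + r pi / 2 = pi - 2 pi / N]

    ([plain_vertex_angles]). For [N <> 4] this implies [a <> b], and then [al] is a
    rational multiple of [pi], say [A pi / M] with [M = 2 N L].

    One equation does not determine [al]; its Galois conjugates do. For [k] prime
    to [2 M] there is an automorphism of the field generated by [cos (pi / M)]
    that multiplies the angles [j pi / M] by [k] ([cos_conj_pair]). It extends to
    an injective semilinear map on a space of real numbers that contains the
    coordinates of all vertices of the dissection ([semilinear_map]). Applied to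
    both coordinates, this gives a map [Phi] of the plane that sends segments of
    direction [j pi / M] to segments of direction [k j pi / M]. It sends a right
    triangle with such sides to a right triangle whose acute angles are multiplied
    by [k] ([item_image]). The map is not continuous and the images of the tiles
    are no dissection, but the view of the images from [Phi O] is the weight of
    the original triangles for a certain choice of numbers, so that [weight_sum]
    still applies. The polygon has become a star polygon, and one obtains

      [a al' + b (pi / 2 - al') + r pi / 2 = pi - 2 pi k' / N]

    where [al'] is congruent to [k al] modulo [pi], [k'] is the residue of [k] modulo
    [N], supposed to be less than [N / 2], and [a], [b], [r] count the angles of
    the same tiles for all [k] ([conj_vertex_angles]). In particular [k al] has a
    representative between [0] and [pi / 2].

    The rest is arithmetic ([vertex_equation]). Units [k] congruent to [1] modulo
    [N] do not change the equation and therefore fix [al], which bounds the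
    denominator of [al / pi]. When [k'] is as near to [N / 2] as possible, the right
    hand side is so small that only [pi / N] and its complement are left. *)

Set Implicit Arguments.
Unset Strict Implicit.
Unset Printing Implicit Defensive.

Import Order.TTheory GRing.Theory Num.Theory.
Import numFieldNormedType.Exports.

Local Open Scope classical_set_scope.
Local Open Scope ring_scope.

(** * Cross and dot products in the plane *)

Section Plane.
Variable R : realType.
Local Notation plane := (plane R).
Implicit Types (u v p q a b c d : plane) (x y z e : R).

Lemma crossC u v : cross u v = - cross v u.
Proof. by rewrite /cross; ring. Qed.
Lemma crossDl u v p : cross (u + v) p = cross u p + cross v p.
Proof. by rewrite /cross /=; ring. Qed.
Lemma crossNl u p : cross (- u) p = - cross u p.
Proof. by rewrite /cross /=; ring. Qed.
Lemma crossZl x u p : cross (x *: u) p = x * cross u p.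
Proof. by rewrite /cross /= /GRing.scale /=; ring. Qed.
Lemma crossDr u v p : cross p (u + v) = cross p u + cross p v.
Proof. by rewrite /cross /=; ring. Qed.
Lemma crossNr u p : cross p (- u) = - cross p u.
Proof. by rewrite /cross /=; ring. Qed.
Lemma crossZr x u p : cross p (x *: u) = x * cross p u.
Proof. by rewrite /cross /= /GRing.scale /=; ring. Qed.
Lemma crossvv u : cross u u = 0.
Proof. by rewrite /cross; ring. Qed.
Lemma dotC u v : dot u v = dot v u.
Proof. by rewrite /dot; ring. Qed.
Lemma dotDl u v p : dot (u + v) p = dot u p + dot v p.
Proof. by rewrite /dot /=; ring. Qed.
Lemma dotNl u p : dot (- u) p = - dot u p.
Proof. by rewrite /dot /=; ring. Qed.
Lemma dotZl x u p : dot (x *: u) p = x * dot u p.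
Proof. by rewrite /dot /= /GRing.scale /=; ring. Qed.
Lemma dotDr u v p : dot p (u + v) = dot p u + dot p v.
Proof. by rewrite /dot /=; ring. Qed.
Lemma dotNr u p : dot p (- u) = - dot p u.
Proof. by rewrite /dot /=; ring. Qed.
Lemma dotZr x u p : dot p (x *: u) = x * dot p u.
Proof. by rewrite /dot /= /GRing.scale /=; ring. Qed.

Definition vecE := (crossDl, crossNl, crossZl, crossDr, crossNr, crossZr,
                    dotDl, dotNl, dotZl, dotDr, dotNr, dotZr).

Lemma dot_ge0 u : 0 <= dot u u.
Proof. by rewrite /dot -!expr2 addr_ge0 ?sqr_ge0. Qed.

Lemma dot_eq0 u : (dot u u == 0) = (u == 0).
Proof.
case: u => u1 u2; rewrite /dot /= -!expr2 paddr_eq0 ?sqr_ge0 // !sqrf_eq0.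
by rewrite -pair_eqE.
Qed.

Lemma dot_gt0 u : (0 < dot u u) = (u != 0).
Proof. by rewrite lt_def dot_ge0 dot_eq0 andbT. Qed.

Lemma cross2_dot2 u v : cross u v ^+ 2 + dot u v ^+ 2 = dot u u * dot v v.
Proof. by rewrite /cross /dot; ring. Qed.

Lemma cross_dot_eq0 u d : d != 0 -> cross u d = 0 -> dot u d = 0 -> u = 0.
Proof.
move=> d0 c0 e0; have := cross2_dot2 u d; rewrite c0 e0 expr0n addr0 => /esym/eqP.
by rewrite mulf_eq0 !dot_eq0 (negPf d0) orbF => /eqP.
Qed.

Lemma parallelP u d : d != 0 -> cross u d = 0 -> u = (dot u d / dot d d) *: d.
Proof.
move=> d0 c0; have dd : dot d d != 0 by rewrite dot_eq0.
apply/eqP; rewrite -subr_eq0; apply/eqP; apply: (@cross_dot_eq0 _ d) => //.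
  by rewrite !vecE c0 crossvv; ring.
by rewrite !vecE; field.
Qed.

Lemma cross_trans u v d : d != 0 -> cross u d = 0 -> cross v d = 0 -> cross u v = 0.
Proof.
move=> d0 /(parallelP d0) -> /(parallelP d0) ->.
by rewrite !vecE crossvv; ring.
Qed.

Definition perp d : plane := (- d.2, d.1).

Lemma cross_perp u d : cross u (perp d) = dot u d.
Proof. by rewrite /cross /dot /=; ring. Qed.

Lemma plane_eq u v : u.1 = v.1 -> u.2 = v.2 -> u = v.
Proof. by case: u v => [? ?] [? ?] /= -> ->. Qed.

Lemma cross_decomp u v d : cross u v *: d = cross d v *: u + cross u d *: v.
Proof. by apply: plane_eq; rewrite /= /GRing.scale /= /cross; ring. Qed.

(** * Weights of triangles depend on the covered set only *)

(** Positivity of [x + e y + e^2 z] for infinitely small positive [e]. *)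
Definition lexpos x y z :=
  (0 < x) || (x == 0) && ((0 < y) || (y == 0) && (0 < z)).

Lemma near0_posE (P : R -> Prop) (k : R) : 0 < k ->
  (forall e, 0 < e -> e < k -> P e) -> \forall e \near 0^'+, P e.
Proof.
by move=> k0 H; near=> e; apply: H; near: e; [exact: nbhs_right_gt|exact: nbhs_right_lt].
Unshelve. all: by end_near. Qed.

Lemma near_sgr x y z : x != 0 ->
  \forall e \near 0^'+, Num.sg (x + e * y + e ^+ 2 * z) = Num.sg x.
Proof.
move=> x0; have K0 : 0 < `|y| + `|z| + 1 by rewrite ltr_wpDl ?addr_ge0.
apply: (@near0_posE _ (Num.min 1 (`|x| / (`|y| + `|z| + 1)))).
  by rewrite lt_min ltr01 divr_gt0 ?normr_gt0.
move=> e e0; rewrite lt_min => /andP[e1]; rewrite ltr_pdivlMr // => ex.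
have H : `|e * y + e ^+ 2 * z| < `|x|.
  apply: le_lt_trans ex; apply: (le_trans (ler_normD _ _)).
  rewrite (normrM e y) (normrM (e ^+ 2) z) (gtr0_norm e0) (ger0_norm (sqr_ge0 e)).
  rewrite !mulrDr -addrA lerD2l ler_wpDr ?mulr_ge0 ?(ltW e0) //.
  by rewrite expr2 -mulrA ler_wpM2l ?(ltW e0) // ler_piMl ?(ltW e1).
move: H; rewrite -addrA ltr_norml => /andP[].
set w := e * y + _ => H1 H2.
have [xp|xn] : 0 < x \/ x < 0.
  by case: (ltrgtP x 0) x0 => //; [right|left].
  by rewrite !gtr0_sg // -(subrr x); move: H1 H2; rewrite gtr0_norm //; lra.
by rewrite !ltr0_sg //; move: H1 H2; rewrite ltr0_norm //; lra.
Qed.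

Lemma near_lex x y z : [|| x != 0, y != 0 | z != 0] ->
  \forall e \near 0^'+,
    (x + e * y + e ^+ 2 * z != 0) /\ (0 <= x + e * y + e ^+ 2 * z) = lexpos x y z.
Proof.
have sgP (s t : R) : s != 0 -> Num.sg t = Num.sg s -> (t != 0) /\ (0 <= t) = (0 < s).
  move=> s0 st; have t0 : t != 0 by rewrite -sgr_eq0 st sgr_eq0.
  by split=> //; rewrite le0r (negPf t0) /= -sgr_gt0 st sgr_gt0.
rewrite /lexpos; case: (eqVneq x 0) => [-> |x0] /=; last first.
  move=> _; rewrite orbF; near=> e; apply: sgP => //; near: e; exact: near_sgr.
rewrite ltxx /=; case: (eqVneq y 0) => [-> /=|y0 _] /=.
  move=> z0; rewrite ltxx /=; near=> e.
  have e0 : 0 < e by near: e; exact: nbhs_right_gt.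
  apply: sgP => //; rewrite mulr0 !add0r sgrM gtr0_sg ?mul1r //.
  by rewrite exprn_gt0.
rewrite orbF; near=> e.
have e0 : 0 < e by near: e; exact: nbhs_right_gt.
apply: sgP => //.
have -> : 0 + e * y + e ^+ 2 * z = e * (y + e * z + e ^+ 2 * 0) by ring.
rewrite sgrM (gtr0_sg e0) mul1r; near: e; exact: near_sgr.
Unshelve. all: by end_near. Qed.

Definition triple := (plane * plane * plane)%type.

Definition edges (t : triple) : seq (plane * plane) :=
  let: (a, b, c) := t in [:: (a, b); (b, c); (c, a)].

Definition side (g : plane * plane) p := cross (g.2 - g.1) (p - g.1).

Definition inside (t : triple) p := all (fun g => 0 <= side g p) (edges t).
Definition generic (t : triple) p := all (fun g => side g p != 0) (edges t).
Definition ccw (t : triple) := let: (a, b, c) := t in 0 < cross (b - a) (c - a).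

(** For fixed direction this is additive when a segment is subdivided, and the two
    orientations of a segment have opposite weights. *)
Definition edge_weight (w : plane -> plane -> R) (g : plane * plane) :=
  w g.2 (g.2 - g.1) - w g.1 (g.2 - g.1).
Definition weight w (t : triple) := \sum_(g <- edges t) edge_weight w g.

(** [w p d] sees [d] only as the direction of a line. As a function of [p] it may
    be wildly discontinuous, as are the maps of the plane from which weights are
    built below. *)
Definition homogeneous (w : plane -> plane -> R) :=
  forall p d d', d != 0 -> d' != 0 -> cross d d' = 0 -> w p d = w p d'.

(** A normal form of [d] up to a factor: flags are compared by equality. *)
Definition canon d : plane := if d.1 == 0 then (0, 1) else (1, d.2 / d.1).

Lemma canon_neq0 d : canon d != 0.
Proof.
by rewrite /canon; case: ifP => _; rewrite -pair_eqE /= oner_eq0 ?andbF.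
Qed.

Lemma canonE d d' : d != 0 -> d' != 0 -> (canon d == canon d') = (cross d d' == 0).
Proof.
have pE (x1 x2 y1 y2 : R) : ((x1, x2) == (y1, y2) :> plane) = (x1 == y1) && (x2 == y2).
  by [].
case: d d' => [d1 d2] [e1 e2]; rewrite /canon /cross /= !pE !negb_and.
have [->|d0] := eqVneq d1 0; have [->|e0] := eqVneq e1 0 => //=.
- by rewrite pE !eqxx mul0r mulr0 subrr eqxx.
- move=> d20 _; rewrite pE /= mul0r sub0r oppr_eq0 mulf_eq0 (negPf d20) (negPf e0).
  by rewrite eq_sym oner_eq0.
- by move=> _ d20; rewrite pE /= mulr0 subr0 mulf_eq0 (negPf d20) (negPf d0) oner_eq0.
move=> _ _; rewrite pE /= eqxx /=.
by rewrite eqr_div // eq_sym -subr_eq0 [e2 * _]mulrC [d1 * _]mulrC.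
Qed.

Lemma canon_cross d : d != 0 -> cross d (canon d) = 0.
Proof.
case: d => d1 d2 d0; rewrite /canon /cross /=; case: eqP => [->|/eqP d10] /=.
  by ring.
by field.
Qed.

(** Four points near [p], one on each side of each of the two rays of direction
    [d] and [- d]. The second displacement is of smaller order than the first
    one, so that the points are off every line through [p] when [e] is small. *)
Definition probe p d (s t : bool) (e : R) : plane :=
  p + ((-1) ^+ s * e) *: d + ((-1) ^+ t * e ^+ 2) *: perp d.

Definition lexside p d (s t : bool) (g : plane * plane) :=
  lexpos (side g p) ((-1) ^+ s * cross (g.2 - g.1) d) ((-1) ^+ t * dot (g.2 - g.1) d).

Lemma near_side p d (s t : bool) g : d != 0 -> g.1 != g.2 ->
  \forall e \near 0^'+, (side g (probe p d s t e) != 0) /\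
     (0 <= side g (probe p d s t e)) = lexside p d s t g.
Proof.
move=> d0 g0; rewrite /lexside.
have := @near_lex (side g p) ((-1) ^+ s * cross (g.2 - g.1) d)
   ((-1) ^+ t * dot (g.2 - g.1) d).
rewrite !mulf_eq0 !signr_eq0 /= => H.
have : [|| side g p != 0, cross (g.2 - g.1) d != 0 | dot (g.2 - g.1) d != 0].
  rewrite -!negb_and; apply/negP => /and3P[_ /eqP c0 /eqP e0].
  have /eqP := cross_dot_eq0 d0 c0 e0.
  by rewrite subr_eq0 eq_sym (negPf g0).
move=> /H; apply: filter_app; near=> e => -[].
have -> : side g (probe p d s t e) = side g p + e * ((-1) ^+ s * cross (g.2 - g.1) d)
    + e ^+ 2 * ((-1) ^+ t * dot (g.2 - g.1) d).
  by rewrite /side /probe !vecE !cross_perp; ring.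
by split.
Unshelve. all: by end_near. Qed.

Lemma lexpos_gt x y z : 0 < x -> lexpos x y z.
Proof. by rewrite /lexpos => ->. Qed.

Lemma lexpos_lt x y z : x < 0 -> lexpos x y z = false.
Proof. by move=> x0; rewrite /lexpos ltNge (ltW x0) /= lt_eqF. Qed.

Lemma lexpos0 y z : lexpos 0 y z = (0 < y) || (y == 0) && (0 < z).
Proof. by rewrite /lexpos ltxx eqxx. Qed.

(** The jump of a function across the ray from [p] of direction [d] minus its
    jump across the opposite ray. A side that passes through [p] contributes
    to both jumps and cancels; only sides that end at [p] remain. *)
Definition flag_sum (q : bool -> bool -> bool) : R :=
  (q false false)%:R - (q false true)%:R + (q true true)%:R - (q true false)%:R.

Lemma flag_sum_vertex y z y' z' : 0 < y' * z - z' * y ->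
  flag_sum (fun s (t : bool) => lexpos 0 ((-1) ^+ s * y) ((-1) ^+ t * z) &&
                       lexpos 0 ((-1) ^+ s * y') ((-1) ^+ t * z'))
  = (y == 0)%:R - (y' == 0)%:R.
Proof.
rewrite /flag_sum !lexpos0 !expr0 !expr1 !mul1r !mulN1r !oppr_gt0 !oppr_eq0.
case: (ltrgtP y 0) => y0; case: (ltrgtP y' 0) => y'0 //=; rewrite ?andbF ?andbT /=;
  try by move=> _; ring.
- rewrite y'0 mul0r sub0r => H; have zz : 0 < z' by nra.
  by rewrite zz ltNge (ltW zz) /=; ring.
- rewrite y'0 mul0r sub0r => H; have zz : z' < 0 by nra.
  by rewrite zz ltNge (ltW zz) /=; ring.
- rewrite y0 mulr0 subr0 => H; have zz : z < 0 by nra.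
  by rewrite zz ltNge (ltW zz) /=; ring.
- rewrite y0 mulr0 subr0 => H; have zz : 0 < z by nra.
  by rewrite zz ltNge (ltW zz) /=; ring.
Qed.

Lemma flag_sum_edge y z :
  flag_sum (fun s (t : bool) => lexpos 0 ((-1) ^+ s * y) ((-1) ^+ t * z)) = 0.
Proof.
rewrite /flag_sum !lexpos0 !expr0 !expr1 !mul1r !mulN1r !oppr_gt0 !oppr_eq0.
by case: (ltrgtP y 0) => y0 //=; rewrite ?andbF ?andbT /=; ring.
Qed.

Lemma flag_sum_const (q : bool -> bool -> bool) (b : bool) : (forall s t, q s t = b) -> flag_sum q = 0.
Proof. by move=> H; rewrite /flag_sum !H; ring. Qed.

Lemma eq_flag_sum (q q' : bool -> bool -> bool) : (forall s t, q s t = q' s t) -> flag_sum q = flag_sum q'.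
Proof. by move=> H; rewrite /flag_sum !H. Qed.

(** The values of the three sides at the point are [e1], [e2], [e3]. Only at a
    vertex, where two of them vanish and the third one is positive, is the sum
    not [0]. *)
Lemma flag_sum_triple e1 e2 e3 y1 z1 y2 z2 y3 z3 : 0 < e1 + e2 + e3 ->
  0 < y3 * z1 - z3 * y1 -> 0 < y1 * z2 - z1 * y2 -> 0 < y2 * z3 - z2 * y3 ->
  flag_sum (fun s (t : bool) =>
    [&& lexpos e1 ((-1) ^+ s * y1) ((-1) ^+ t * z1),
        lexpos e2 ((-1) ^+ s * y2) ((-1) ^+ t * z2)
      & lexpos e3 ((-1) ^+ s * y3) ((-1) ^+ t * z3)]) =
  [&& e1 == 0, 0 < e2 & e3 == 0]%:R * ((y1 == 0)%:R - (y3 == 0)%:R)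
  + [&& e1 == 0, e2 == 0 & 0 < e3]%:R * ((y2 == 0)%:R - (y1 == 0)%:R)
  + [&& 0 < e1, e2 == 0 & e3 == 0]%:R * ((y3 == 0)%:R - (y2 == 0)%:R).
Proof.
move=> E T31 T12 T23.
have [n1|p1|z10] := ltrgtP e1 0.
- by rewrite (@flag_sum_const _ false) /= ?mul0r ?addr0 // => s t; rewrite lexpos_lt.
- have [n2|p2|z20] := ltrgtP e2 0.
  + rewrite (@flag_sum_const _ false) /= ?mul0r ?addr0 // => s t.
    by rewrite (lexpos_lt _ _ n2) andbF.
  + have [n3|p3|z30] := ltrgtP e3 0 => /=.
    * rewrite (@flag_sum_const _ false) /= ?mul0r ?addr0 // => s t.
      by rewrite (lexpos_lt _ _ n3) !andbF.
    * rewrite (@flag_sum_const _ true) /= ?mul0r ?addr0 // => s t.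
      by rewrite !lexpos_gt.
    * rewrite !mul0r !addr0 -(flag_sum_edge y3 z3); apply: eq_flag_sum => s t.
      by rewrite !(lexpos_gt _ _ p1, lexpos_gt _ _ p2) z30.
  + have [n3|p3|z30] := ltrgtP e3 0 => /=.
    * rewrite (@flag_sum_const _ false) /= ?mul0r ?addr0 // => s t.
      by rewrite (lexpos_lt _ _ n3) !andbF.
    * rewrite !mul0r !addr0 -(flag_sum_edge y2 z2); apply: eq_flag_sum => s t.
      by rewrite !(lexpos_gt _ _ p1, lexpos_gt _ _ p3) z20 andbT.
    * rewrite !mul0r !add0r mul1r -(flag_sum_vertex T23); apply: eq_flag_sum => s t.
      by rewrite (lexpos_gt _ _ p1) z20 z30 /= andbC.
- rewrite z10 !add0r in E *; have [n2|p2|z20] := ltrgtP e2 0.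
  + rewrite (@flag_sum_const _ false) /= ?mul0r ?addr0 // => s t.
    by rewrite (lexpos_lt _ _ n2) andbF.
  + have [n3|p3|z30] := ltrgtP e3 0 => /=.
    * rewrite (@flag_sum_const _ false) /= ?mul0r ?addr0 // => s t.
      by rewrite (lexpos_lt _ _ n3) !andbF.
    * rewrite !mul0r !addr0; apply: etrans (flag_sum_edge y1 z1); apply: eq_flag_sum => s t.
      by rewrite !(lexpos_gt _ _ p2, lexpos_gt _ _ p3) !andbT.
    * rewrite !mul0r !addr0 mul1r -(flag_sum_vertex T31); apply: eq_flag_sum => s t.
      by rewrite (lexpos_gt _ _ p2) z30.
  + rewrite z20 add0r in E *; rewrite E (gt_eqF E) /= !mul0r !addr0 !add0r mul1r.
    rewrite -(flag_sum_vertex T12); apply: eq_flag_sum => s t.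
    by rewrite (lexpos_gt _ _ E) andbT andbC.
Qed.

Lemma vertexE a b c p : ccw (a, b, c) ->
  [&& side (a, b) p == 0, 0 < side (b, c) p & side (c, a) p == 0] = (a == p).
Proof.
rewrite /side /= => T; apply/and3P/eqP => [[/eqP H1 _ /eqP H2]|<-]; last first.
  by rewrite subrr !crossvv !eqxx; split=> //; move: T; rewrite /cross /=; lra.
have H3 : cross (p - a) (c - a) = 0 by move: H2; rewrite /cross /=; lra.
have := cross_decomp (b - a) (c - a) (p - a).
rewrite H1 H3 !scale0r addr0 => /eqP; rewrite scaler_eq0 gt_eqF //= subr_eq0.
by move/eqP.
Qed.

(** How often, with sign, [weight] uses the value of [w] at [p] in direction [d];
    the total weight is a combination of these numbers, up to sign. *)
Definition flag_coef (t : triple) p d : R :=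
  \sum_(g <- edges t)
    ((g.1 == p)%:R - (g.2 == p)%:R) * (cross (g.2 - g.1) d == 0)%:R.

Lemma flag_sum_coef (t : triple) p d : ccw t -> d != 0 ->
  flag_sum (fun s t' => all (lexside p d s t') (edges t)) = flag_coef t p d.
Proof.
case: t => [[a b] c] /= T d0.
have dd : 0 < dot d d by rewrite dot_gt0.
have turn u v : 0 < cross v u ->
    0 < cross v d * dot u d - dot v d * cross u d.
  move=> vu; have -> : cross v d * dot u d - dot v d * cross u d = cross v u * dot d d.
    by rewrite /cross /dot; ring.
  by rewrite mulr_gt0.
under eq_flag_sum do rewrite andbT /lexside /=.
rewrite flag_sum_triple; first last.
- by apply: turn; move: T; rewrite /cross /=; lra.
- by apply: turn; move: T; rewrite /cross /=; lra.
- by apply: turn; move: T; rewrite /cross /=; lra.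
- by move: T; rewrite /side /cross /=; lra.
have T2 : ccw (b, c, a) by move: T; rewrite /= /cross /=; lra.
have T3 : ccw (c, a, b) by move: T; rewrite /= /cross /=; lra.
have V2 : [&& side (a, b) p == 0, side (b, c) p == 0 & 0 < side (c, a) p] = (b == p).
  rewrite -(vertexE p T2); case: (side (a, b) p == 0); case: (side (b, c) p == 0);
    by rewrite /= ?andbT ?andbF.
have V3 : [&& 0 < side (a, b) p, side (b, c) p == 0 & side (c, a) p == 0] = (c == p).
  rewrite -(vertexE p T3); case: (side (b, c) p == 0); case: (side (c, a) p == 0);
    by rewrite /= ?andbT ?andbF.
rewrite (vertexE p T) V2 V3 /flag_coef !big_cons big_nil /=; ring.
Qed.

Lemma near_all (A : eqType) (l : seq A) (P : A -> R -> Prop) :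
  (forall i, i \in l -> \forall e \near 0^'+, P i e) ->
  \forall e \near 0^'+, forall i, i \in l -> P i e.
Proof.
elim: l => [|i l IH] H; first by near=> e.
have Hl : \forall e \near 0^'+, forall i, i \in l -> P i e.
  by apply: IH => j jl; apply: H; rewrite inE jl orbT.
have Hi := H i (mem_head _ _).
by apply: filterS2 Hi Hl => e Hi Hl j; rewrite inE => /predU1P[->//|]; exact: Hl.
Unshelve. all: by end_near. Qed.

Lemma ccw_edges (t : triple) g : ccw t -> g \in edges t -> g.1 != g.2.
Proof.
case: t => [[a b] c] /= T; rewrite !inE => /or3P[] /eqP -> /=;
  apply: contraTneq T => ->; rewrite -leNgt le_eqVlt; apply/orP; left; apply/eqP;
  by rewrite /cross /=; ring.
Qed.

Lemma probe_sum p d (T : seq triple) : d != 0 -> all ccw T ->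
  \forall e \near 0^'+, forall s t' : bool,
    all (fun t => generic t (probe p d s t' e)) T /\
    count (fun t => inside t (probe p d s t' e)) T =
    count (fun t => all (lexside p d s t') (edges t)) T.
Proof.
move=> d0 /allP T0.
have H : \forall e \near 0^'+, forall k : bool * bool, k \in [:: (false, false);
    (false, true); (true, false); (true, true)] -> forall t, t \in T ->
    forall g, g \in edges t -> (side g (probe p d k.1 k.2 e) != 0) /\
     (0 <= side g (probe p d k.1 k.2 e)) = lexside p d k.1 k.2 g.
  apply: near_all => k _; apply: near_all => t tT; apply: near_all => g gt.
  by apply: near_side => //; apply: ccw_edges gt; apply: T0.
apply: filter_app H; near=> e => H s t'.
have {}H : forall t, t \in T ->
    forall g, g \in edges t -> (side g (probe p d s t' e) != 0) /\
     (0 <= side g (probe p d s t' e)) = lexside p d s t' g.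
  by apply: (H (s, t')); case: s; case: t'; rewrite !inE.
split; first by apply/allP => t tT; apply/allP => g gt; have [] := H t tT g gt.
apply: eq_in_count => t tT; apply: eq_in_all => g gt; by have [] := H t tT g gt.
Unshelve. all: by end_near. Qed.

Lemma flag_coef_sum (T T' : seq triple) p d : all ccw T -> all ccw T' ->
  (forall y : plane, all (fun t => generic t y) (T ++ T') ->
     count (fun t => inside t y) T = count (fun t => inside t y) T') ->
  d != 0 -> \sum_(t <- T) flag_coef t p d = \sum_(t <- T') flag_coef t p d.
Proof.
move=> cT cT' H d0.
have [e He] : exists e : R, forall s t' : bool,
    all (fun t => generic t (probe p d s t' e)) (T ++ T') /\
    count (fun t => inside t (probe p d s t' e)) T =
    count (fun t => all (lexside p d s t') (edges t)) T /\
    count (fun t => inside t (probe p d s t' e)) T' =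
    count (fun t => all (lexside p d s t') (edges t)) T'.
  have := probe_sum p d0 cT; have := probe_sum p d0 cT'.
  move=> H1 H2; have H3 := @filterI _ _ (at_right_proper_filter 0) _ _ H1 H2.
  have [e [h1 h2]] := @filter_ex _ _ (at_right_proper_filter 0) _ H3.
  exists e => s t'; have [g1 k1] := h1 s t'; have [g2 k2] := h2 s t'.
  by rewrite all_cat g1 g2.
have C s t' : count (fun t => all (lexside p d s t') (edges t)) T =
              count (fun t => all (lexside p d s t') (edges t)) T'.
  by have [g [<- <-]] := He s t'; apply: H.
have S (U : seq triple) : all ccw U -> \sum_(t <- U) flag_coef t p d =
   (count (fun t => all (lexside p d false false) (edges t)) U)%:R
   - (count (fun t => all (lexside p d false true) (edges t)) U)%:R
   + (count (fun t => all (lexside p d true true) (edges t)) U)%:R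
   - (count (fun t => all (lexside p d true false) (edges t)) U)%:R.
  elim: U => [_|t U IH]; first by rewrite big_nil /=; ring.
  move=> /andP[ct cU]; rewrite big_cons (IH cU) -(flag_sum_coef p ct d0) /= !natrD.
  by rewrite /flag_sum; ring.
by rewrite !S // !C.
Qed.

(** The weight of a triangle is a combination of its flag coefficients, which
    are read off from the covering multiplicity at probe points. These avoid the
    lines that carry the sides, where the coverings may differ. *)
Lemma weight_sum (T T' : seq triple) w : homogeneous w -> all ccw T -> all ccw T' ->
  (forall y : plane, all (fun t => generic t y) (T ++ T') ->
     count (fun t => inside t y) T = count (fun t => inside t y) T') ->
  \sum_(t <- T) weight w t = \sum_(t <- T') weight w t.
Proof.
move=> hw cT cT' H.
pose flags (t : triple) : seq (plane * plane) :=
  [seq (g.1, canon (g.2 - g.1)) | g <- edges t] ++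
  [seq (g.2, canon (g.2 - g.1)) | g <- edges t].
pose F := undup (flatten (map flags (T ++ T'))).
have W (U : seq triple) : all ccw U -> {subset U <= T ++ T'} ->
    \sum_(t <- U) weight w t =
    - \sum_(f <- F) w f.1 f.2 * \sum_(t <- U) flag_coef t f.1 f.2.
  move=> /allP cU sU; under [in RHS]eq_bigr do rewrite mulr_sumr.
  rewrite exchange_big -sumrN; apply: eq_big_seq => t tU /=.
  under eq_bigr do rewrite mulr_sumr.
  rewrite exchange_big -sumrN; apply: eq_big_seq => g gt /=.
  have g0 := ccw_edges (cU _ tU) gt.
  have gd : g.2 - g.1 != 0 by rewrite subr_eq0 eq_sym.
  have inF f : f \in flags t -> f \in F.
    move=> ft; rewrite mem_undup; apply/flattenP; exists (flags t) => //.
    by apply: map_f; apply: sU.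
  have pick v : (v, canon (g.2 - g.1)) \in F ->
     \sum_(f <- F) w f.1 f.2 * ((v == f.1)%:R * (cross (g.2 - g.1) f.2 == 0)%:R)
     = w v (g.2 - g.1).
    move=> vF; rewrite (bigD1_seq _ vF) ?undup_uniq //= eqxx canon_cross // eqxx !mulr1.
    rewrite big1_seq ?addr0 => [|f /andP[fv fF]].
      by apply: hw => //; [exact: canon_neq0 | rewrite crossC canon_cross ?oppr0].
    have [E1|] := eqVneq v f.1; last by rewrite mul0r mulr0.
    have [E2|] := eqVneq (cross (g.2 - g.1) f.2) 0; last by rewrite !mulr0.
    suff E3 : canon (g.2 - g.1) = f.2.
      by move: fv; rewrite E1 E3 -surjective_pairing eqxx.
    move: E2 fF; rewrite mem_undup => E2 /flattenP[l /mapP[t' t'T ->]] ff.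
    have [d' [d'0 f2]] : exists d', d' != 0 /\ f.2 = canon d'.
      have ct' : ccw t'.
        by move: t'T; rewrite mem_cat => /orP[] h; [apply: (allP cT)|apply: (allP cT')].
      by move: ff; rewrite mem_cat => /orP[] /mapP[g' g't ->] /=;
        exists (g'.2 - g'.1); rewrite subr_eq0 eq_sym (ccw_edges ct').
    move: E2; rewrite f2 => /eqP; rewrite -canonE ?canon_neq0 // => /eqP ->.
    by apply/eqP; rewrite canonE ?canon_neq0 // crossC canon_cross ?oppr0.
  rewrite /flag_coef; under eq_bigr do rewrite mulrBl mulrBr.
  rewrite sumrB !pick ?opprB //; apply: inF; rewrite mem_cat.
    by rewrite (map_f (fun g : plane * plane => (g.2, canon (g.2 - g.1))) gt) orbT.
  by rewrite (map_f (fun g : plane * plane => (g.1, canon (g.2 - g.1))) gt).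
rewrite !W //; try by move=> t tT; rewrite mem_cat tT ?orbT.
congr (- _); apply: eq_big_seq => f.
rewrite mem_undup => /flattenP[l /mapP[t' t'T ->]] ff.
congr (_ * _); apply: flag_coef_sum => //.
by move: ff; rewrite mem_cat => /orP[] /mapP[g' g't ->] /=; exact: canon_neq0.
Qed.

End Plane.

(** * The angle under which a triangle is seen *)

Section View.
Variable R : realType.
Local Notation plane := (plane R).
Implicit Types (P Q X Y Z O a b c d : plane) (x y z e : R).

Lemma sin_eq0_small x : - pi < x < pi -> sin x = 0 -> x = 0.
Proof.
move=> /andP[x1 x2] s0; have [xn|xp|//] := ltrgtP x 0.
  have : 0 < sin (- x) by apply: sin_gt0_pi; apply/andP; split; lra.
  by rewrite sinN s0 oppr0 ltxx.
by have := @sin_gt0_pi R x; rewrite xp x2 s0 ltxx => /(_ isT).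
Qed.

Lemma atanP x : [/\ - (pi / 2) < atan x, atan x < pi / 2, 0 < cos (atan x) &
  sin (atan x) = x * cos (atan x)].
Proof.
have c0 : 0 < cos (atan x) by apply: cos_gt0_pihalf; rewrite atan_gtNpi2 atan_ltpi2.
split=> //; [exact: atan_gtNpi2|exact: atan_ltpi2|].
by rewrite -{2}(atanK x) /tan divfK // gt_eqF.
Qed.

(** The oriented angle from [P] to [Q], between [- pi] and [pi]. Because the
    division by [0] is [0], it is [0] when [P] and [Q] are parallel. *)
Definition vang P Q := Num.sg (cross P Q) * (pi / 2) - atan (dot P Q / cross P Q).

Lemma vangC P Q : vang Q P = - vang P Q.
Proof.
rewrite /vang crossC dotC sgrN invrN mulrN atanN; ring.
Qed.

Lemma vang_eq0 P Q : cross P Q = 0 -> vang P Q = 0.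
Proof. by rewrite /vang => ->; rewrite sgr0 invr0 mulr0 mul0r atan0 subr0. Qed.

Lemma vangZ x P Q : 0 < x -> vang (x *: P) Q = vang P Q.
Proof.
move=> x0; rewrite /vang !vecE sgrM gtr0_sg // mul1r; congr (_ - atan _).
by rewrite -mulf_div divff ?mul1r // gt_eqF.
Qed.

Lemma vangP P Q : 0 < cross P Q -> [/\ 0 < vang P Q, vang P Q < pi &
  exists2 r, 0 < r & dot P Q = r * cos (vang P Q) /\ cross P Q = r * sin (vang P Q)].
Proof.
move=> h0; rewrite /vang gtr0_sg // mul1r; set x := dot P Q / _.
have [a1 a2 a3 a4] := atanP x.
have -> : cos (pi / 2 - atan x) = sin (atan x) by rewrite cosB cos_pihalf sin_pihalf; ring.
have -> : sin (pi / 2 - atan x) = cos (atan x) by rewrite sinB cos_pihalf sin_pihalf; ring.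
split; [lra|lra|exists (cross P Q / cos (atan x)); first by rewrite divr_gt0].
by rewrite a4 /x; split; field; rewrite ?gt_eqF.
Qed.

Lemma vang_add X Y Z : 0 <= cross X Y -> 0 <= cross Y Z -> 0 < cross X Z -> Y != 0 ->
  vang X Y + vang Y Z = vang X Z.
Proof.
move=> h1 h2 h3 Y0.
have [e1|n1] := eqVneq (cross X Y) 0.
  rewrite (vang_eq0 e1) add0r; have XE := parallelP Y0 e1.
  move: h3 h2; rewrite XE !vecE => h3 h2; rewrite vangZ //; nra.
have [e2|n2] := eqVneq (cross Y Z) 0.
  rewrite crossC in e2; move/eqP: e2; rewrite oppr_eq0 => /eqP e2.
  rewrite [vang Y Z]vang_eq0 ?addr0; last by rewrite crossC e2 oppr0.
  have ZE := parallelP Y0 e2; move: h3; rewrite ZE !vecE => h3.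
  by rewrite [RHS]vangC vangZ -?vangC //; nra.
have {}h1 : 0 < cross X Y by rewrite lt_def n1.
have {}h2 : 0 < cross Y Z by rewrite lt_def n2.
have [a0 a1 [r r0 [rc rs]]] := vangP h1.
have [b0 b1 [s s0 [sc ss]]] := vangP h2.
have [c0 c1 [t t0 [tc ts]]] := vangP h3.
move: (vang X Y) (vang Y Z) (vang X Z) a0 a1 b0 b1 c0 c1 rc rs sc ss tc ts => a b c a0 a1 b0 b1 c0 c1 rc rs sc ss tc ts.
have YY : 0 < dot Y Y by rewrite dot_gt0.
have E1 : dot Y Y * (t * sin c) = r * s * sin (a + b).
  transitivity (cross X Y * dot Y Z + dot X Y * cross Y Z).
    by rewrite -ts /cross /dot; ring.
  by rewrite rs sc rc ss sinD; ring.
have E2 : dot Y Y * (t * cos c) = r * s * cos (a + b).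
  transitivity (dot X Y * dot Y Z - cross X Y * cross Y Z).
    by rewrite -tc /cross /dot; ring.
  by rewrite rs sc rc ss cosD; ring.
have rsp : 0 < r * s by rewrite mulr_gt0.
have sc0 : 0 < sin c by apply: sin_gt0_pi; apply/andP.
have sab : 0 < sin (a + b) by rewrite -(pmulr_rgt0 _ rsp) -E1 !mulr_gt0.
have ab : a + b < pi.
  rewrite ltNge; apply/negP => ab.
  have : 0 <= sin (a + b - pi) by apply: sin_ge0_pi; apply/andP; split; lra.
  by rewrite sinB cospi sinpi; lra.
apply/eqP; rewrite -subr_eq0; apply/eqP; apply: sin_eq0_small; first by apply/andP; split; lra.
rewrite sinB; apply/eqP; rewrite -(mulrI_eq0 _ (mulfI (lt0r_neq0 rsp))).
rewrite mulrBr !mulrA -E1 -E2; apply/eqP; ring.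
Qed.

Lemma vang_ge_pi X Y Z : 0 < cross X Y -> 0 < cross Y Z -> cross X Z <= 0 ->
  pi <= vang X Y + vang Y Z.
Proof.
move=> h1 h2 h3.
have [a0 a1 [r r0 [rc rs]]] := vangP h1.
have [b0 b1 [s s0 [sc ss]]] := vangP h2.
rewrite leNgt; apply/negP => ab.
have : 0 < sin (vang X Y + vang Y Z) by apply: sin_gt0_pi; rewrite addr_gt0.
have rsp : 0 < r * s by rewrite mulr_gt0.
rewrite -(pmulr_rgt0 _ rsp) sinD.
have -> : r * s * (sin (vang X Y) * cos (vang Y Z) + cos (vang X Y) * sin (vang Y Z)) =
   cross X Y * dot Y Z + dot X Y * cross Y Z by rewrite rs sc rc ss; ring.
have -> : cross X Y * dot Y Z + dot X Y * cross Y Z = dot Y Y * cross X Z.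
  by rewrite /cross /dot; ring.
by have := dot_ge0 Y; nra.
Qed.

(** [cot_angle P d] is a primitive of the angle form along a line of
    direction [d]; it vanishes on lines through the origin because the
    division by [0] is [0]. *)
Definition cot_angle P d := atan (dot P d / cross P d).

Lemma cot_angleZ P x d : x != 0 -> cot_angle P (x *: d) = cot_angle P d.
Proof. by move=> x0; rewrite /cot_angle !vecE -mulf_div divff ?mul1r. Qed.

Lemma cot_angleN P d : cot_angle P (- d) = cot_angle P d.
Proof. by rewrite -scaleN1r cot_angleZ // oppr_eq0 oner_eq0. Qed.

(** The sine of the difference of both sides vanishes, and the difference is less
    than [pi] in absolute value. *)
Lemma cot_angle_edge P Q :
  cot_angle Q (Q - P) - cot_angle P (Q - P) = vang P Q.
Proof.
wlog h : P Q / 0 <= cross P Q => [H|].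
  have [h|/ltW h] := leP 0 (cross P Q); first exact: H.
  rewrite -[RHS]opprK -vangC -H; last by rewrite crossC oppr_ge0.
  by rewrite -(opprB Q P) !cot_angleN; ring.
rewrite /cot_angle.
have -> : cross Q (Q - P) = cross P Q by rewrite /cross /=; ring.
have -> : cross P (Q - P) = cross P Q by rewrite /cross /=; ring.
move: h; rewrite le_eqVlt => /predU1P[/esym h0|h].
  by rewrite vang_eq0 // h0 invr0 !mulr0 subrr.
rewrite /vang gtr0_sg // mul1r.
set x1 := dot Q _ / _; set x2 := dot P (Q - P) / _; set x3 := dot P Q / _.
have [a1 a2 a3 a4] := atanP x1; have [b1 b2 b3 b4] := atanP x2.
have [c1 c2 c3 c4] := atanP x3.
have x12 : x2 < x1.
  rewrite ltr_pM2r ?invr_gt0 // -subr_gt0.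
  have -> : dot Q (Q - P) - dot P (Q - P) = dot (Q - P) (Q - P).
    by rewrite /dot /=; ring.
  rewrite dot_gt0 subr_eq0; apply: contraTneq h => ->.
  by rewrite crossvv ltxx.
have a12 : atan x2 < atan x1 by apply: lt_atan.
apply/eqP; rewrite -subr_eq0; apply/eqP; apply: sin_eq0_small.
  by apply/andP; split; lra.
rewrite !(sinB, cosB) a4 b4 c4 cos_pihalf sin_pihalf.
set p := cos (atan x1); set q := cos (atan x2); set r := cos (atan x3).
have -> : (x1 * p * q - p * (x2 * q)) * (0 * r + 1 * (x3 * r)) -
  (p * q + x1 * p * (x2 * q)) * (1 * r - 0 * (x3 * r)) =
  p * q * r * ((x1 - x2) * x3 - (1 + x1 * x2)) by ring.
have -> : (x1 - x2) * x3 - (1 + x1 * x2) = 0; last by rewrite mulr0.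
apply: (@mulfI _ (cross P Q ^+ 2)); first by rewrite expf_eq0 gt_eqF.
rewrite mulr0 /x1 /x2 /x3.
transitivity ((dot Q (Q - P) - dot P (Q - P)) * dot P Q -
  (cross P Q ^+ 2 + dot Q (Q - P) * dot P (Q - P))).
  by field; rewrite gt_eqF.
by rewrite /dot /cross /=; ring.
Qed.

(** Along each line this is a primitive of the angular form at [O], so that the
    weight of a triangle is its winding angle around [O]. *)
Definition view_weight O p d := cot_angle (p - O) d.
Definition view O (t : triple R) := weight (view_weight O) t.

Lemma view_weight_homogeneous O : homogeneous (view_weight O).
Proof.
move=> p d d' d0 d'0 c0; rewrite /view_weight (parallelP d'0 c0) cot_angleZ //.
by apply: contraNneq d0 => e; rewrite (parallelP d'0 c0) e scale0r.
Qed.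

Lemma viewE O a b c : view O (a, b, c) =
  vang (a - O) (b - O) + vang (b - O) (c - O) + vang (c - O) (a - O).
Proof.
have E p q : edge_weight (view_weight O) (p, q) = vang (p - O) (q - O).
  by rewrite -cot_angle_edge /edge_weight /view_weight /= opprB addrA subrK.
by rewrite /view /weight /= !big_cons big_nil !E addr0 addrA.
Qed.

Lemma vang_ge0 P Q : 0 <= cross P Q -> 0 <= vang P Q.
Proof.
rewrite le_eqVlt => /predU1P[/esym/vang_eq0 -> //|/vangP[/ltW]//].
Qed.

(** If the origin is outside, the angles cancel. If it is on a side, that side
    counts for [0] and the other two together for at least [pi]; inside, already
    two of the three angles add up to at least [pi]. *)
Lemma vang_cycle X Y Z : 0 < cross X Y + cross Y Z + cross Z X ->
  let v := vang X Y + vang Y Z + vang Z X in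
  [\/ v = 0, pi <= v | [\/ X = 0, Y = 0 | Z = 0]].
Proof.
have out A B C : 0 <= cross A B -> 0 <= cross B C -> cross C A < 0 ->
    0 < cross A B + cross B C + cross C A -> vang A B + vang B C + vang C A = 0.
  move=> h1 h2 h3 h; rewrite [vang C A]vangC vang_add ?subrr //.
    by rewrite crossC oppr_gt0.
  apply: contraTneq h => ->; rewrite -leNgt; move: h3; rewrite /cross /=; lra.
have out2 A B C : cross A B < 0 -> cross B C < 0 -> 
    0 < cross A B + cross B C + cross C A -> vang A B + vang B C + vang C A = 0.
  move=> h1 h2 h; rewrite [vang A B]vangC [vang B C]vangC -(@vang_add C B A); try lra.
  - by rewrite crossC oppr_ge0 ltW.
  - by rewrite crossC oppr_ge0 ltW.
  by apply: contraTneq h1 => ->; rewrite -leNgt /cross /=; lra.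
have inn A B C : 0 < cross A B -> 0 < cross B C -> 0 <= cross C A ->
    pi <= vang A B + vang B C + vang C A.
  move=> h1 h2 h3; rewrite -[pi]addr0 lerD ?vang_ge0 // vang_ge_pi //.
  by rewrite crossC oppr_le0.
have ver (A B C : plane) : cross A B = 0 -> cross C A = 0 -> 0 < cross B C -> A = 0.
  move=> h1 h2 h3; have := cross_decomp B C A.
  rewrite [cross A C]crossC h2 [cross B A]crossC h1 oppr0 !scale0r addr0 => /eqP.
  by rewrite scaler_eq0 gt_eqF //= => /eqP.
move=> h v.
have rot1 : v = vang Y Z + vang Z X + vang X Y by rewrite /v; ring.
have rot2 : v = vang Z X + vang X Y + vang Y Z by rewrite /v; ring.
have h' : 0 < cross Y Z + cross Z X + cross X Y by lra.
have h'' : 0 < cross Z X + cross X Y + cross Y Z by lra.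
have [s1|s1] := ltP (cross X Y) 0.
  have [s2|s2] := ltP (cross Y Z) 0; first by constructor 1; apply: out2.
  constructor 1; have [s3|s3] := ltP (cross Z X) 0; first by rewrite rot2 out2.
  by rewrite rot1 out.
have [s2|s2] := ltP (cross Y Z) 0.
  constructor 1; have [s3|s3] := ltP (cross Z X) 0; first by rewrite rot1 out2.
  by rewrite rot2 out.
have [s3|s3] := ltP (cross Z X) 0; first by constructor 1; apply: out.
have [z1|z1] := eqVneq (cross X Y) 0; last first.
  have {}s1 : 0 < cross X Y by rewrite lt_def z1.
  have [z2|z2] := eqVneq (cross Y Z) 0; last first.
    by constructor 2; apply: inn => //; rewrite lt_def z2.
  have [z3|z3] := eqVneq (cross Z X) 0; last first.
    by constructor 2; rewrite rot2 inn // lt_def z3.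
  by constructor 3; constructor 3; apply: (ver Z X Y).
have [z2|z2] := eqVneq (cross Y Z) 0.
  by constructor 3; constructor 2; apply: (ver Y Z X) => //; lra.
have [z3|z3] := eqVneq (cross Z X) 0; last first.
  by constructor 2; rewrite rot1 inn // lt_def ?z2 ?z3.
by constructor 3; constructor 1; apply: (ver X Y Z) => //; lra.
Qed.

Lemma vang0l P : vang 0 P = 0.
Proof. by apply: vang_eq0; rewrite /cross /=; ring. Qed.

Lemma vang0r P : vang P 0 = 0.
Proof. by apply: vang_eq0; rewrite /cross /=; ring. Qed.

Lemma view_cases O a b c : ccw (a, b, c) ->
  [\/ view O (a, b, c) = 0, pi <= view O (a, b, c) |
    [\/ O = a /\ view O (a, b, c) = vang (b - a) (c - a),
        O = b /\ view O (a, b, c) = vang (c - b) (a - b) |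
        O = c /\ view O (a, b, c) = vang (a - c) (b - c)]].
Proof.
rewrite viewE => T.
have /vang_cycle/= : 0 < cross (a - O) (b - O) + cross (b - O) (c - O) + cross (c - O) (a - O).
  by move: T; rewrite /ccw /cross /=; lra.
case=> [h|h|]; [by constructor 1|by constructor 2|].
case=> /eqP; rewrite subr_eq0 => /eqP E; constructor 3; [constructor 1|constructor 2|constructor 3];
  by split=> //; rewrite E subrr vang0l vang0r ?addr0 ?add0r.
Qed.

Lemma view_ge0 O a b c : ccw (a, b, c) -> 0 <= view O (a, b, c).
Proof.
move=> T.
case: (view_cases O T) => [->//|h|[] [_ ->]]; first exact: le_trans (pi_ge0 R) h.
all: by apply: vang_ge0; rewrite ltW //; move: T; rewrite /ccw /cross /=; lra.
Qed.
End View.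

(** * Conjugate cosines *)

Section Conjugate.

Notation pQ F := (map_poly (ratr : rat -> F)).

(** The cyclotomic polynomial is the minimal polynomial of a primitive root of
    unity among the algebraic numbers. The irreducibility read off there is a fact
    about rational polynomials and serves for roots of unity in any field. *)
Lemma Cyclotomic_rat_irreducible n (q : {poly rat}) : (0 < n)%N ->
  coprimep (map_poly intr 'Phi_n) q \/ (map_poly intr 'Phi_n %| q).
Proof.
move=> n0; have [w prim_w] := C_prim_root_exists n0.
have [p [Dp mp min_p]] := minCpolyP w.
have -> : map_poly intr 'Phi_n = p.
  apply: (map_inj_poly (@fmorph_inj _ _ (ratr : rat -> algC)) (rmorph0 _)).
  rewrite -[RHS]Dp (minCpoly_cyclotomic prim_w) -(Cintr_Cyclotomic prim_w).
  by rewrite -map_poly_comp; apply: eq_map_poly => x /=; rewrite ratr_int.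
have [h|h] := boolP (coprimep p q); [by left|right].
have p0 : p != 0 by rewrite monic_neq0.
have := dvdp_gcdl p q => /dvdpP [h' Dh].
have : root (map_poly ratr (h' * gcdp p q)) w by rewrite -Dh min_p.
rewrite rmorphM /= rootM !min_p => /orP[ph|pg].
  case/negP: h; rewrite coprimep_def.
  have gh0 : h' * gcdp p q != 0 by rewrite -Dh.
  move: gh0; rewrite mulf_eq0 negb_or => /andP[h0 g0].
  have := dvdp_leq h0 ph; rewrite {1}Dh size_mul // => hh.
  have : (0 < size (gcdp p q))%N by rewrite size_poly_gt0.
  by move: hh; case: (size (gcdp p q)) => // m; rewrite addnS /= -{2}[size h']addn0 leq_add2l leqn0 => /eqP->.
by apply: dvdp_trans (dvdp_gcdr p q).
Qed.

Variable F : numFieldType.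

Lemma root_prodE (s : seq nat) (f : nat -> {poly F}) (z : F) :
  root (\prod_(d <- s) f d) z = has (fun d => root (f d) z) s.
Proof.
elim: s => [|d s IH]; first by rewrite big_nil (negPf (root1 _)).
by rewrite big_cons rootM IH.
Qed.

Lemma root_Cyclotomic_prim n (z : F) : n.-primitive_root z ->
  root (pQ F (map_poly intr 'Phi_n)) z.
Proof.
move=> pz; have n0 := prim_order_gt0 pz.
pose f d : {poly F} := map_poly intr 'Phi_d.
have fE d : pQ F (map_poly intr 'Phi_d) = f d.
  by rewrite -map_poly_comp; apply: eq_map_poly => x /=; rewrite ratr_int.
have fp m : (0 < m)%N -> \prod_(d <- divisors m) f d = 'X^m - 1.
  by move=> m0; rewrite -rmorph_prod /= prod_Cyclotomic // rmorphB rmorph1 /= map_polyXn.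
have xn m : root ('X^m - 1) z = (z ^+ m == 1).
  by rewrite /root hornerD hornerN hornerXn hornerE subr_eq0.
rewrite fE.
have : root (\prod_(d <- divisors n) f d) z by rewrite fp // xn prim_expr_order.
rewrite root_prodE => /hasP[d dn rd].
have := dn; rewrite -dvdn_divisors // => d_n.
have d0 : (0 < d)%N := dvdn_gt0 n0 d_n.
suff nd : (n %| d)%N by rewrite (_ : n = d) //; apply/eqP; rewrite eqn_dvd nd.
rewrite (prim_order_dvd pz) -xn -fp // root_prodE; apply/hasP; exists d => //.
by rewrite -dvdn_divisors.
Qed.

(** A polynomial that vanishes at [z] is not coprime to the cyclotomic
    polynomial, hence is a multiple of it. *)
Lemma prim_root_conj n k (z : F) (q : {poly rat}) : n.-primitive_root z ->
  coprime k n -> root (pQ F q) z -> root (pQ F q) (z ^+ k).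
Proof.
move=> pz kn rq; have n0 := prim_order_gt0 pz.
have [/Bezout_eq1_coprimepP[[u v] /= uv]|/dvdpP[h ->]] := Cyclotomic_rat_irreducible q n0.
  have := congr1 (fun p => (pQ F p).[z]) uv.
  rewrite /= rmorphD !rmorphM /= rmorph1 !hornerE (rootP rq) (rootP (root_Cyclotomic_prim pz)).
  by rewrite !mulr0 addr0 => /eqP; rewrite eq_sym oner_eq0.
rewrite rmorphM /= rootM root_Cyclotomic_prim ?orbT //.
by rewrite prim_root_exp_coprime.
Qed.

(** The values at an algebraic [c] form a field: if [m] and [p] are not coprime,
    their common factor does not vanish at [c] and can be divided out of [m]. *)
Lemma horner_inv (m p : {poly rat}) (c : F) : m != 0 -> root (pQ F m) c ->
  (pQ F p).[c] != 0 -> exists q : {poly rat}, (pQ F q).[c] * (pQ F p).[c] = 1.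
Proof.
have [n] := ubnP (size m); elim: n m => // n IH m sm m0 rm p0.
have [/Bezout_eq1_coprimepP[[u v] /= uv]|cp] := boolP (coprimep m p).
  exists v; have := congr1 (fun p => (pQ F p).[c]) uv.
  by rewrite /= rmorphD !rmorphM /= rmorph1 !hornerE (rootP rm) mulr0 add0r.
have /dvdpP[h Dh] := dvdp_gcdl m p.
have hg0 : h * gcdp m p != 0 by rewrite -Dh.
move: (hg0); rewrite mulf_eq0 negb_or => /andP[h0 g0].
have rg : ~~ root (pQ F (gcdp m p)) c.
  have /dvdpP[h' Dh'] := dvdp_gcdr m p; apply: contra p0 => rg.
  by rewrite Dh' rmorphM /= hornerM (rootP rg) mulr0.
apply: (IH h) => //.
  move: sm; rewrite {1}Dh size_mul //.
  have : (1 < size (gcdp m p))%N.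
    by rewrite ltn_neqAle eq_sym -coprimep_def cp size_poly_gt0.
  case: (size (gcdp m p)) => [|[|s]] // _; rewrite addnS /= addnS ltnS => hh.
  by apply: leq_ltn_trans hh; rewrite leq_addr.
move: rm; rewrite {1}Dh rmorphM /= rootM (negPf rg) orbF //.
Qed.

End Conjugate.

Section Cosine.
Variable R : realType.
Local Notation C := (complex R).
Notation pQ := (map_poly (ratr : rat -> R)).
Notation pQC := (map_poly (ratr : rat -> C)).
Import ComplexField.

Definition cis (x : R) : C := Complex (cos x) (sin x).

Lemma cisD x y : cis (x + y) = cis x * cis y.
Proof. by rewrite /cis cosD sinD; apply/eqP; rewrite eq_complex /= eqxx /= addrC. Qed.

Lemma cisX x n : cis x ^+ n = cis (n%:R * x).
Proof.
elim: n => [|n IH]; first by rewrite expr0 mul0r /cis cos0 sin0.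
by rewrite exprS IH -cisD -nat1r mulrDl mul1r.
Qed.

Lemma cos_lt1 (x : R) : 0 < x < 2 * pi -> cos x != 1.
Proof.
move=> /andP[x0 x1]; have -> : x = (x / 2) *+ 2 by rewrite mulr2n; field.
rewrite cos_mulr2n cos2sin2 -subr_eq0.
have -> : (1 - sin (x / 2) ^+ 2) *+ 2 - 1 - 1 = - (sin (x / 2) ^+ 2 *+ 2) by ring.
rewrite oppr_eq0 mulrn_eq0 /= sqrf_eq0 gt_eqF // sin_gt0_pi //.
by apply/andP; split; lra.
Qed.

Lemma cis_prim n : (0 < n)%N -> n.-primitive_root (cis (2 * pi / n%:R)).
Proof.
move=> n0; have nR : (n%:R : R) != 0 by rewrite pnatr_eq0 -lt0n.
apply/andP; split=> //; apply/forallP => i.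
rewrite unity_rootE cisX; have [->|ne] := eqVneq i.+1 n.
  have -> : n%:R * (2 * pi / n%:R) = (pi : R) *+ 2 by rewrite mulr2n; field.
  by rewrite /cis cos2pi sin2pi eqxx.
have lt : (i.+1 < n)%N by rewrite ltn_neqAle ne ltn_ord.
rewrite eqbF_neg eq_complex /= negb_and cos_lt1 //.
have pi0 := pi_gt0 R; have nR0 : 0 < (n%:R : R) by rewrite ltr0n.
apply/andP; split; first by rewrite !mulr_gt0 ?invr_gt0 // ltr0n.
by rewrite mulrA ltr_pdivrMr // mulrC ltr_pM2l ?ltr_nat // mulr_gt0.
Qed.

Lemma pQC_real (p : {poly rat}) (x : R) :
  (pQC p).[real_complex R x] = real_complex R (pQ p).[x].
Proof.
rewrite -horner_map -map_poly_comp; congr (_.[_]).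
by apply: eq_map_poly => a /=; rewrite fmorph_rat.
Qed.

(** [X^n p (X + 1/X)], where [n] is the size of [p]: it turns a relation for
    [2 cos x] into one for the unit complex number of argument [x]. *)
Definition homogenize (p : {poly rat}) : {poly rat} :=
  \sum_(i < size p) p`_i *: (('X^2 + 1) ^+ i * 'X^(size p - i)).

Lemma homogenizeE (p : {poly rat}) (w : C) : w != 0 ->
  (pQC (homogenize p)).[w] = w ^+ size p * (pQC p).[w + w^-1].
Proof.
move=> w0; rewrite /homogenize rmorph_sum /= horner_sum.
rewrite [in RHS]horner_coef size_map_poly mulr_sumr; apply: eq_bigr => i _.
rewrite map_polyZ /= rmorphM /= map_polyXn rmorphXn rmorphD rmorph1 /= map_polyXn.
rewrite hornerZ hornerM horner_exp hornerD !hornerXn hornerC coef_map /=.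
have -> : w ^+ 2 + 1 = w * (w + w^-1) by field.
have E : w ^+ size p = w ^+ (size p - i) * w ^+ i.
  by rewrite -exprD subnK // ltnW.
by rewrite exprMn E; ring.
Qed.

Lemma cis0 : cis 0 = 1.
Proof. by rewrite /cis cos0 sin0. Qed.

Lemma cisV x : (cis x)^-1 = cis (- x).
Proof. by apply: mulr1_eq; rewrite -cisD subrr cis0. Qed.

Lemma cis_neq0 x : cis x != 0.
Proof.
apply: contra_neq (oner_neq0 C) => e.
by rewrite -cis0 -(subrr x) cisD e mul0r.
Qed.

Lemma cis_addV x : cis x + (cis x)^-1 = real_complex R (2 * cos x).
Proof.
rewrite cisV /cis cosN sinN; apply/eqP; rewrite eq_complex /= subrr eqxx andbT.
by apply/eqP; ring.
Qed.

Lemma root_homogenize (p : {poly rat}) x :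
  root (pQC (homogenize p)) (cis x) = root (pQ p) (2 * cos x).
Proof.
rewrite /root homogenizeE ?cis_neq0 // mulf_eq0 expf_eq0 (negPf (cis_neq0 _)) andbF /=.
by rewrite cis_addV pQC_real fmorph_eq0.
Qed.

Lemma cos_conj M k (p : {poly rat}) : (0 < M)%N -> coprime k M.*2 ->
  root (pQ p) (2 * cos (pi / M%:R)) -> root (pQ p) (2 * cos (k%:R * (pi / M%:R))).
Proof.
move=> M0 kM; rewrite -!root_homogenize -cisX.
apply: prim_root_conj kM.
have -> : pi / M%:R = 2 * pi / M.*2%:R :> R.
  by rewrite -muln2 natrM; field; rewrite pnatr_eq0 -lt0n.
by apply: cis_prim; rewrite double_gt0.
Qed.

Lemma cos_algebraic M : (0 < M)%N ->
  exists2 m : {poly rat}, m != 0 & root (pQ m) (2 * cos (pi / M%:R)).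
Proof.
move=> M0; set x := pi / M%:R.
have az : algebraicOver (ratr : rat -> C) (cis x).
  exists ('X^(M.*2) - 1); first by rewrite -size_poly_gt0 size_XnsubC ?double_gt0.
  rewrite rmorphB /= map_polyXn rmorph1 rootE hornerD hornerN hornerXn hornerC.
  rewrite cisX /x -muln2 natrM.
  have -> : M%:R * 2 * (pi / M%:R) = (pi : R) *+ 2.
    by rewrite mulr2n; field; rewrite pnatr_eq0 -lt0n.
  by rewrite /cis cos2pi sin2pi subrr.
have [m m0] : algebraicOver (ratr : rat -> C) (cis x + (cis x)^-1).
  by apply: algebraic_add => //; apply: algebraic_inv.
by rewrite cis_addV rootE pQC_real fmorph_eq0 => ?; exists m.
Qed.

(** Substituting [c'] for [c] is a well defined field morphism on the values of
    rational polynomials at [c]: it is the restriction of the Galois automorphism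
    that raises the roots of unity to the power [k]. *)
Lemma cos_conj_pair M k : (0 < M)%N -> coprime k M.*2 ->
  let c := 2 * cos (pi / M%:R) in let c' := 2 * cos (k%:R * (pi / M%:R)) in
  (forall p : {poly rat}, (pQ p).[c] = 0 -> (pQ p).[c'] = 0) /\
  (forall p : {poly rat}, (pQ p).[c] != 0 ->
     exists q : {poly rat}, (pQ q).[c] * (pQ p).[c] = 1 /\ (pQ q).[c'] * (pQ p).[c'] = 1).
Proof.
move=> M0 kM c c'.
have H p : (pQ p).[c] = 0 -> (pQ p).[c'] = 0.
  by move=> /rootP/(cos_conj M0 kM)/rootP.
split=> // p p0; have [m m0 rm] := cos_algebraic M0.
have [q qp] := horner_inv m0 rm p0; exists q; split=> //.
have := H (q * p - 1); rewrite rmorphB rmorphM rmorph1 /= !hornerE qp subrr.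
by move=> /(_ erefl)/eqP; rewrite subr_eq0 => /eqP.
Qed.

End Cosine.

(** * Semilinear maps *)

Section Semilinear.
Variable R : realType.

Lemma countable_avoid (B : set R) : countable B -> exists y, ~ B y.
Proof.
move=> cB; apply/existsNP => BT.
have E : B = setT by apply/seteqP; split=> // y _; apply: BT.
have := countable_lebesgue_measure0 cB; rewrite E.
have := @lebesgue_measure_itv R `]-oo, +oo[.
rewrite set_itvE => -> /=.
by [].
Qed.

Definition ev (c : R) (p : {poly rat}) : R := (map_poly ratr p).[c].

Lemma evM c p q : ev c (p * q) = ev c p * ev c q.
Proof. by rewrite /ev rmorphM hornerM. Qed.
Lemma evD c p q : ev c (p + q) = ev c p + ev c q.
Proof. by rewrite /ev rmorphD hornerD. Qed.
Lemma evC c a : ev c a%:P = ratr a.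
Proof. by rewrite /ev map_polyC hornerC. Qed.
Lemma ev1 c : ev c 1 = 1.
Proof. by rewrite evC rmorph1. Qed.
Lemma evX c : ev c 'X = c.
Proof. by rewrite /ev map_polyX hornerX. Qed.

Variables c c' : R.
Hypothesis conj0 : forall p, ev c p = 0 -> ev c' p = 0.
Hypothesis conjV : forall p, ev c p != 0 ->
  exists q, ev c q * ev c p = 1 /\ ev c' q * ev c' p = 1.

(** Sending [ev c p] to [ev c' p] is a field morphism, and [G] is the graph of an
    injective map that is semilinear for it. Countability leaves room for
    extensions. *)
Record semilinear_graph (G : set (R * R)) : Prop := {
  graph_countable : countable G;
  graph1 : G (1, 1);
  graphZ : forall p z, G z -> G (ev c p * z.1, ev c' p * z.2);
  graphD : forall z t, G z -> G t -> G (z + t);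
  graph_eq0 : forall z, G z -> z.1 = 0 <-> z.2 = 0 }.

Lemma base_graph : semilinear_graph (range (fun p => (ev c p, ev c' p))).
Proof.
split.
- by apply: sub_countable (card_image_le _ _) (countableP _).
- by exists 1; rewrite // !ev1.
- by move=> p _ [q _ <-]; exists (p * q); rewrite // !evM.
- by move=> _ _ [p _ <-] [q _ <-]; exists (p + q); rewrite // !evD.
move=> _ [p _ <-] /=; split; first exact: conj0.
by have [/conj0//|/conjV[q [_]]] := eqVneq (ev c p) 0;
  move=> h h0; move: h; rewrite h0 mulr0 => /esym/eqP; rewrite oner_eq0.
Qed.

(** The value at the new point is chosen outside a countable set, which keeps
    the extended map injective. *)
Lemma extend_graph G x : semilinear_graph G ->
  exists G', [/\ semilinear_graph G', G `<=` G' & exists y, G' (x, y)].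
Proof.
move=> sG; have [[y Gy]|nx] := pselect (exists y, G (x, y)).
  by exists G; split=> //; exists y.
pose B := (fun u : (R * R) * {poly rat} => - u.1.2 / ev c' u.2) @` (G `*` setT).
have cB : countable B.
  apply: sub_countable (card_image_le _ _) _; apply: countableX.
    exact: graph_countable.
  exact: countableP.
have [y nB] := countable_avoid cB.
pose h (u : (R * R) * {poly rat}) : R * R := (u.1.1 + ev c u.2 * x, u.1.2 + ev c' u.2 * y).
have G0 : G (0, 0).
  by have := graphZ sG 0 (graph1 sG); rewrite /ev !rmorph0 !horner0 !mul0r.
exists (h @` (G `*` setT)); split; last first.
- by exists y, ((0, 0), 1) => //; rewrite /h /= !ev1 !mul1r !add0r.
- by move=> z Gz; exists (z, 0) => //; rewrite /h /= /ev !rmorph0 !horner0 !mul0r !addr0; case: z Gz.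
split.
- apply: sub_countable (card_image_le _ _) _; apply: countableX.
    exact: graph_countable.
  exact: countableP.
- exists ((1, 1), 0); first by split=> //; apply: graph1 sG.
  by rewrite /h /= /ev !rmorph0 !horner0 !mul0r !addr0.
- move=> p _ [[[u v] q] [/= Gu _] <-]; exists ((ev c p * u, ev c' p * v), p * q).
    by split=> //; apply: (graphZ sG p Gu).
  by rewrite /h /= !evM; congr (_, _); ring.
- move=> _ _ [[[u v] q] [/= Gu _] <-] [[[u' v'] q'] [/= Gu' _] <-].
  exists ((u + u', v + v'), q + q'); first by split=> //; apply: (graphD sG Gu Gu').
  by rewrite /h /= !evD; congr (_, _); rewrite /=; ring.
move=> _ [[[u v] q] [/= Gu _] <-]; rewrite /h /=.
have [q0|q0] := eqVneq (ev c q) 0.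
  rewrite q0 (conj0 q0) !mul0r !addr0; exact: (graph_eq0 sG Gu).
have [r [r1 r2]] := conjV q0.
have q'0 : ev c' q != 0 by apply: contra_eq_neq r2 => ->; rewrite mulr0 eq_sym oner_neq0.
split=> e.
  exfalso; apply: nx; exists (ev c' (- r) * v).
  have := graphZ sG (- r) Gu.
  have -> // : ev c (- r) * (u, v).1 = x.
  have -> : ev c (- r) = - ev c r by rewrite /ev rmorphN hornerN.
  have -> /= : u = - (ev c q * x) by apply/eqP; rewrite -addr_eq0 e.
  by rewrite mulrN mulNr opprK mulrA r1 mul1r.
exfalso; apply: nB; exists ((u, v), q) => //=.
have -> : v = - (ev c' q * y) by apply/eqP; rewrite -addr_eq0 e.
by rewrite opprK mulrC mulKf.
Qed.

Lemma extend_graph_seq (s : seq R) : exists G, semilinear_graph G /\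
  forall x, x \in s -> exists y, G (x, y).
Proof.
elim: s => [|x s [G [sG Gs]]]; first by eexists; split; first exact: base_graph.
have [G' [sG' GG' Gx]] := extend_graph x sG.
exists G'; split=> // z; rewrite inE => /predU1P[->//|/Gs[y /GG' ?]]; by exists y.
Qed.

(** A field morphism from the reals to themselves is the identity, so that a
    conjugation does not extend to one; it does extend to a semilinear map on a
    space that contains any given numbers. *)
Lemma semilinear_map (s : seq R) : exists (X : set R) (f : R -> R),
  [/\ forall x, x \in s -> X x, X 1 /\ f 1 = 1,
      forall x y, X x -> X y -> X (x + y) /\ f (x + y) = f x + f y,
      forall p x, X x -> X (ev c p * x) /\ f (ev c p * x) = ev c' p * f x
    & forall x, X x -> f x = 0 -> x = 0].
Proof.
have [G [sG Gs]] := extend_graph_seq s.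
pose X : set R := [set x | exists y, G (x, y)].
pose f x := get [set y | G (x, y)].
have Gf x : X x -> G (x, f x) by move=> Xx; have := getPex Xx.
have uG x y z : G (x, y) -> G (x, z) -> y = z.
  move=> Gy Gz; have := graphD sG Gy (graphZ sG (-1)%:P Gz).
  rewrite /= !evC rmorphN1 !mulN1r => /(graph_eq0 sG)[/= + _].
  by rewrite subrr => /(_ erefl)/eqP; rewrite subr_eq0 => /eqP.
have fE x y : G (x, y) -> f x = y by move=> Gy; apply: (uG x) => //; apply: Gf; exists y.
exists X, f; split.
- by move=> x /Gs.
- have G1 := graph1 sG; split; [by exists 1|exact: fE].
- by move=> x y /Gf Gx /Gf Gy; have Gxy := graphD sG Gx Gy; split; [eexists; apply: Gxy|apply: fE].
- by move=> p x /Gf Gx; have Gp := graphZ sG p Gx; split; [eexists; apply: Gp|apply: fE].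
- by move=> x /Gf Gx fx; apply/(graph_eq0 sG Gx).
Qed.

End Semilinear.

(** * Unit vectors *)

Section Unit.
Variable R : realType.
Local Notation plane := (plane R).
Implicit Types (p q O d : plane) (x y z : R).

Definition dir x : plane := (cos x, sin x).

Lemma dot_dir x y : dot (dir x) (dir y) = cos (x - y).
Proof. by rewrite /dot /= cosB. Qed.

Lemma cross_dir x y : cross (dir x) (dir y) = sin (y - x).
Proof. by rewrite /cross /= sinB; ring. Qed.

Lemma dir_neq0 x : dir x != 0.
Proof. by rewrite -dot_gt0 dot_dir subrr cos0. Qed.

Lemma polar (y : plane) : y != 0 -> exists r th : R, [/\ 0 < r, 0 <= th, th < 2 * pi & y = r *: dir th].
Proof.
move=> y0; pose r := Num.sqrt (dot y y).
have r0 : 0 < r by rewrite sqrtr_gt0 dot_gt0.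
have r2 : r ^+ 2 = y.1 ^+ 2 + y.2 ^+ 2 by rewrite sqr_sqrtr ?dot_ge0 // /dot -!expr2.
have cE : (y.1 / r) ^+ 2 + (y.2 / r) ^+ 2 = 1.
  by rewrite !expr_div_n -mulrDl -r2 divff // expf_eq0 gt_eqF.
have c1 : -1 <= y.1 / r <= 1.
  by rewrite -ler_norml -(@ler_pXn2r _ 2) ?nnegrE // expr1n real_normK ?num_real // -cE lerDl sqr_ge0.
have a0 := acos_ge0 c1; have a1 := acos_lepi c1.
have ca : cos (acos (y.1 / r)) = y.1 / r by rewrite acosK // in_itv.
have s2 : sin (acos (y.1 / r)) ^+ 2 = (y.2 / r) ^+ 2 by rewrite sin2cos2 ca -cE; ring.
have sp : 0 <= sin (acos (y.1 / r)) by apply: sin_ge0_pi; rewrite a0.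
have pi0 := pi_gt0 R.
have [yp|yn] := leP 0 y.2.
  exists r, (acos (y.1 / r)); split=> //; first by lra.
  have se : sin (acos (y.1 / r)) = y.2 / r.
    apply/eqP; rewrite -(@eqrXn2 _ 2) // ?s2 // divr_ge0 // ltW //.
  apply: plane_eq; rewrite /= /GRing.scale /= ?ca ?se.
    by field; rewrite gt_eqF.
  by field; rewrite gt_eqF.
have se : sin (acos (y.1 / r)) = - (y.2 / r).
  apply/eqP; rewrite -(@eqrXn2 _ 2) // ?s2 ?sqrrN // oppr_ge0.
  by rewrite pmulr_lle0 ?invr_gt0 // ltW.
exists r, (2 * pi - acos (y.1 / r)); split=> //; first by lra.
  rewrite gtrBl lt_def a0 andbT; apply/eqP => e0.
  move: se; rewrite e0 sin0 => /esym/eqP; rewrite oppr_eq0 mulf_eq0 invr_eq0.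
  by rewrite (gt_eqF r0) (lt_eqF yn).
have e : 2 * pi - acos (y.1 / r) = - acos (y.1 / r) + pi *+ 2 by rewrite mulr2n; ring.
rewrite /dir e cosD2pi sinD2pi cosN sinN ca se opprK.
apply: plane_eq; rewrite /= /GRing.scale /=; field; by rewrite gt_eqF.
Qed.

Lemma perp_dir x : perp (dir x) = dir (x + pi / 2).
Proof. by rewrite /perp /dir /= cosDpihalf sinDpihalf. Qed.

Lemma sin_le0 x : pi <= x <= 2 * pi \/ - pi <= x <= 0 -> sin x <= 0.
Proof.
case=> /andP[h1 h2].
  have -> : x = - (2 * pi - x) + pi *+ 2 by rewrite mulr2n; ring.
  rewrite sinD2pi sinN oppr_le0; apply: sin_ge0_pi; apply/andP; split; lra.
by rewrite -[x]opprK sinN oppr_le0; apply: sin_ge0_pi; apply/andP; split; lra.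
Qed.

Lemma sinDnpi x n : sin (x + n%:R * pi) = (-1) ^+ n * sin x.
Proof.
elim: n => [|n IH]; first by rewrite mul0r addr0 expr0 mul1r.
by rewrite -natr1 mulrDl mul1r addrA sinDpi IH exprS mulN1r mulNr.
Qed.

Lemma cosDnpi x n : cos (x + n%:R * pi) = (-1) ^+ n * cos x.
Proof.
elim: n => [|n IH]; first by rewrite mul0r addr0 expr0 mul1r.
by rewrite -natr1 mulrDl mul1r addrA cosDpi IH exprS mulN1r mulNr.
Qed.

Lemma frac_pi n N : (0 < N)%N ->
  n%:R * (pi / N%:R) = (n %% N)%:R * (pi / N%:R) + (n %/ N)%:R * pi :> R.
Proof.
move=> N0; rewrite {1}(divn_eq n N) natrD natrM mulrDl addrC; congr (_ + _).
by field; rewrite pnatr_eq0 -lt0n.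
Qed.

Lemma frac_pi_itv n N : (0 < n < N)%N -> 0 < n%:R * (pi / N%:R : R) < pi.
Proof.
move=> /andP[n0 nN]; have N0 : 0 < N%:R :> R by rewrite ltr0n (ltn_trans n0).
have pi0 := pi_gt0 R; apply/andP; split.
  by rewrite !mulr_gt0 ?invr_gt0 // ltr0n.
by rewrite mulrA ltr_pdivrMr // mulrC ltr_pM2l // ltr_nat.
Qed.

Lemma sin_frac_pi_eq0 n N : (0 < N)%N ->
  (sin (n%:R * (pi / N%:R) : R) == 0) = (N %| n)%N.
Proof.
move=> N0; rewrite frac_pi // sinDnpi mulf_eq0 signr_eq0 /= /dvdn.
have [->|n0] := eqVneq (n %% N)%N 0%N; first by rewrite mul0r sin0 eqxx.
apply/gt_eqF/sin_gt0_pi/frac_pi_itv.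
by rewrite lt0n n0 ltn_pmod.
Qed.

(** The sawtooth of period [pi] that is [pi / 2 - x] on the interval from [0]
    to [pi], and [0] at its jumps. *)
Definition saw x := atan (cos x / sin x).

Lemma sawE x : 0 < x < pi -> saw x = pi / 2 - x.
Proof.
move=> /andP[x0 x1]; have -> : saw x = atan (tan (pi / 2 - x)).
  by rewrite /saw /tan sinB cosB cos_pihalf sin_pihalf !mul0r !mul1r add0r subr0.
rewrite tanK // in_itv /=.
by apply/andP; split; lra.
Qed.

Lemma saw_eq0 x : sin x = 0 -> saw x = 0.
Proof. by rewrite /saw => ->; rewrite invr0 mulr0 atan0. Qed.

Lemma sawDnpi x n : saw (x + n%:R * pi) = saw x.
Proof.
rewrite /saw sinDnpi cosDnpi -mulf_div divff ?mul1r //.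
by rewrite signr_eq0.
Qed.

Lemma sawN x : saw (- x) = - saw x.
Proof. by rewrite /saw sinN cosN invrN mulrN atanN. Qed.

Lemma saw_frac n N : (0 < N)%N -> ~~ (N %| n)%N ->
  saw (n%:R * (pi / N%:R)) = pi / 2 - (n %% N)%:R * (pi / N%:R).
Proof.
move=> N0 nN; rewrite frac_pi // sawDnpi sawE // frac_pi_itv //.
by rewrite lt0n -/(dvdn _ _) nN ltn_pmod.
Qed.

Lemma cot_angle_dir z x y : z != 0 -> cot_angle (z *: dir x) (dir y) = saw (y - x).
Proof.
move=> z0; rewrite /cot_angle !vecE dot_dir cross_dir -mulf_div divff // mul1r.
by rewrite -[cos _]cosN opprB.
Qed.

Lemma cot_angle0 d : cot_angle 0 d = 0.
Proof. by rewrite /cot_angle /dot /cross /= !mul0r addr0 mul0r atan0. Qed.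

Lemma chord_dir x : dir (2 * x) - dir 0 = (2 * sin x) *: dir (x + pi / 2).
Proof.
apply: plane_eq; rewrite /= /GRing.scale /= ?cosDpihalf ?sinDpihalf ?cos0 ?sin0.
  by rewrite mulr_natl cos_mulr2n cos2sin2; ring.
by rewrite mulr_natl sin_mulr2n; ring.
Qed.

(** The chord from [dir 0] to [dir (2 * x)] has direction [x + pi / 2], half the
    speed of its end: this is the inscribed angle theorem. *)
Lemma cot_angle_chord x y :
  cot_angle (dir (2 * x) - dir 0) (dir y) = (sin x != 0)%:R * saw (y - x - pi / 2).
Proof.
rewrite chord_dir; have [->|s0] := eqVneq (sin x) 0.
  by rewrite mulr0 scale0r cot_angle0 mul0r.
by rewrite cot_angle_dir ?mul1r ?mulf_neq0 ?pnatr_eq0 // opprD addrA.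
Qed.

(** * The total weight of the standard dissection *)

(** The points [std_vertex N j] are alternately the vertices of the polygon
    ([j] even) and the midpoints of its sides ([j] odd). *)
Definition std_radius N j : R := if odd j then cos (pi / N%:R) else 1.
Definition std_vertex N j : plane := std_radius N j *: dir (j%:R * (pi / N%:R)).
Definition std_tile N j : triple R := (0, std_vertex N j, std_vertex N j.+1).

Lemma std_vertex_even N i : std_vertex N i.*2 = dir (2 * (i%:R * (pi / N%:R))).
Proof.
by rewrite /std_vertex /std_radius odd_double scale1r -muln2 natrM; congr dir; ring.
Qed.

Definition side_dir N i : plane := dir (i.*2.+1%:R * (pi / N%:R) + pi / 2).

Lemma std_side N i :
  (std_vertex N i.*2.+1 - std_vertex N i.*2 = sin (pi / N%:R) *: side_dir N i) /\
  (std_vertex N i.*2.+2 - std_vertex N i.*2.+1 = sin (pi / N%:R) *: side_dir N i).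
Proof.
rewrite /std_vertex /std_radius /= odd_double /= !scale1r /side_dir.
set t := pi / N%:R; set x := i.*2.+1%:R * t.
have -> : i.*2%:R * t = x - t by rewrite /x -addn1 natrD; ring.
have -> : i.*2.+2%:R * t = x + t by rewrite /x -addn1 natrD; ring.
have e1 := cos2Dsin2 t.
by split; apply: plane_eq; rewrite /= /GRing.scale /= ?cosB ?sinB ?cosD ?sinD
   ?cosDpihalf ?sinDpihalf ?cos_pihalf ?sin_pihalf; ring.
Qed.

Lemma std_vertex_period N : (0 < N)%N -> std_vertex N N.*2 = std_vertex N 0.
Proof.
move=> N0; rewrite -[in RHS]double0 !std_vertex_even mul0r mulr0.
have -> : 2 * (N%:R * (pi / N%:R)) = 0 + pi *+ 2 :> R.
  by rewrite mulr2n; field; rewrite pnatr_eq0 -lt0n.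
by rewrite /dir cosD2pi sinD2pi.
Qed.

Section StdWeight.
Variables (N : nat) (w : plane -> plane -> R).
Hypotheses (N2 : (1 < N)%N) (hw : homogeneous w).

Lemma edge_weightN p q : edge_weight w (q, p) = - edge_weight w (p, q).
Proof.
rewrite /edge_weight /=; have [->|pq] := eqVneq p q; first by rewrite !subrr oppr0.
have E r : w r (p - q) = w r (q - p).
  apply: hw; rewrite ?subr_eq0 //; first by rewrite eq_sym.
  by rewrite -opprB crossNl crossvv oppr0.
by rewrite !E opprB.
Qed.

Lemma edge_weight_dir p q x d : x != 0 -> d != 0 -> q - p = x *: d ->
  edge_weight w (p, q) = w q d - w p d.
Proof.
move=> x0 d0 E; rewrite /edge_weight /= E.
by congr (_ - _); apply: hw => //; rewrite ?scaler_eq0 ?negb_or ?x0 // crossZl crossvv mulr0.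
Qed.

Lemma sum_double (g : nat -> R) n :
  \sum_(j < n.*2) g j = \sum_(i < n) (g i.*2 + g i.*2.+1).
Proof.
elim: n => [|n IH]; first by rewrite !big_ord0.
by rewrite doubleS !big_ord_recr /= IH addrA.
Qed.

(** The radii are shared by consecutive tiles and their weights cancel; only the
    sides of the polygon remain. *)
Lemma std_weight : \sum_(j < N.*2) weight w (std_tile N j) =
  \sum_(i < N) (w (std_vertex N i.+1.*2) (side_dir N i) - w (std_vertex N i.*2) (side_dir N i)).
Proof.
have N0 : (0 < N)%N := ltnW N2.
pose g j := edge_weight w (std_vertex N j, std_vertex N j.+1).
pose h j := edge_weight w (0, std_vertex N j).
have -> : \sum_(j < N.*2) weight w (std_tile N j) =
    \sum_(j < N.*2) g j - \sum_(j < N.*2) (h j.+1 - h j).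
  rewrite -sumrB; apply: eq_bigr => j _.
  by rewrite /weight /= !big_cons big_nil (edge_weightN 0) /g /h; ring.
rewrite -(big_mkord xpredT (fun j => h j.+1 - h j)) telescope_sumr //.
rewrite {1}/h std_vertex_period // subrr subr0 sum_double; apply: eq_bigr => i _.
have [E1 E2] := std_side N i.
have s0 : sin (pi / N%:R) != 0 :> R.
  rewrite -[pi / _]mul1r; have := @sin_frac_pi_eq0 1 N N0 => ->.
  by rewrite dvdn1; case: N N2 => [|[]].
have d0 : side_dir N i != 0 by apply: dir_neq0.
by rewrite /g (edge_weight_dir s0 d0 E1) (edge_weight_dir s0 d0 E2) doubleS; ring.
Qed.

Variable k : nat.
Hypotheses (kodd : odd k) (kN : coprime k N).
(* On the sides of the polygon, [w] is the view from the vertex [dir 0] of the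
   star polygon in which all angles are multiplied by [k]. *)
Hypothesis wP : forall i, (i < N)%N ->
  w (std_vertex N i.*2) (side_dir N i) =
    cot_angle (dir (2 * ((k * i)%:R * (pi / N%:R))) - dir 0)
      (dir ((k * i.*2.+1)%:R * (pi / N%:R) + k%:R * (pi / 2))) /\
  w (std_vertex N i.+1.*2) (side_dir N i) =
    cot_angle (dir (2 * ((k * i.+1)%:R * (pi / N%:R))) - dir 0)
      (dir ((k * i.*2.+1)%:R * (pi / N%:R) + k%:R * (pi / 2))).

(** By the inscribed angle theorem all sides of the star polygon are seen from
    [dir 0] under angles that telescope, except the two sides that end at
    [dir 0]. *)
Lemma std_total : \sum_(j < N.*2) weight w (std_tile N j) =
  2 * saw (k%:R * (pi / N%:R)).
Proof.
have N0 : (0 < N)%N := ltnW N2.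
have [t tE] : exists t : R, t = pi / N%:R by eexists.
have wP' := wP; rewrite -tE in wP' *.
have tN : N%:R * t = pi by rewrite tE; field; rewrite pnatr_eq0 -lt0n.
pose s i := saw ((k * i)%:R * t).
pose A i : R := (~~ (N %| i)%N)%:R.
have kpi : k%:R * (pi / 2) - pi / 2 = k./2%:R * pi :> R.
  have -> : k%:R = 1 + k./2%:R * 2 :> R.
    by rewrite -{1}(odd_double_half k) kodd natrD -muln2 natrM.
  by field.
have term i : (i < N)%N -> w (std_vertex N i.+1.*2) (side_dir N i)
    - w (std_vertex N i.*2) (side_dir N i) = A i.+1 * s i - A i * s i.+1.
  move=> iN; have [-> ->] := wP' i iN; rewrite !cot_angle_chord.
  have sA j : (sin ((k * j)%:R * t) != 0)%:R = A j.
    by rewrite /A tE sin_frac_pi_eq0 // Gauss_dvdr // coprime_sym.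
  have E1 : (k * i.*2.+1)%:R = (k * i)%:R + (k * i.+1)%:R :> R.
    by rewrite -natrD -mulnDr addnS addnn.
  rewrite !sA E1 /s -(sawDnpi ((k * i)%:R * t) k./2) -(sawDnpi ((k * i.+1)%:R * t) k./2) -kpi.
  by congr (_ * saw _ - _ * saw _); ring.
rewrite std_weight; under eq_bigr do rewrite term //.
have s0 : s 0%N = 0 by rewrite /s muln0 mul0r saw_eq0 // sin0.
have sN : s N = 0.
  by rewrite /s saw_eq0 //; apply/eqP; rewrite tE sin_frac_pi_eq0 // dvdn_mull.
have A0 : A 0%N = 0 by rewrite /A dvdn0.
have AN : A N = 0 by rewrite /A dvdnn.
have A1 i : (0 < i < N)%N -> A i = 1.
  by move=> /andP[i0 iN]; rewrite /A gtnNdvd.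
have s1 : s N.-1 = - s 1%N.
  rewrite /s muln1 -sawN -(sawDnpi (- (k%:R * t)) k); congr saw.
  by rewrite -subn1 natrM natrB // -tN; ring.
have T n : \sum_(i < n) (s i.+1 - s i.+2) = s 1%N - s n.+1.
  by elim: n => [|n IH]; rewrite ?big_ord0 ?subrr // big_ord_recr /= IH; ring.
have -> : saw (k%:R * t) = s 1%N by rewrite /s muln1.
clear tN tE; case: N N2 s0 sN A A0 AN A1 s1 term {wP' N0} => [|[|m]] // _ s0 sN A A0 AN A1 s1 term.
rewrite big_ord_recl big_ord_recr /= /bump /= !add1n A0 AN s0 sN.
have -> : \sum_(i < m) (A (1 + i).+1 * s (1 + i)%N - A (1 + i)%N * s (1 + i).+1) =
    s 1%N - s m.+1.
  rewrite -T; apply: eq_bigr => i _; rewrite add1n !A1 ?mul1r //.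
    by rewrite /= ltnS ltnW // ltnS.
  by rewrite /= !ltnS.
by rewrite s1 /=; ring.
Qed.

End StdWeight.
End Unit.

(** * The angles of right triangles at a point *)

Section RightTiles.
Variable R : realType.
Local Notation plane := (plane R).
Implicit Types (p q u v O V C P d : plane) (x y z : R).

Definition leg_tile C P x : triple R := (C, P, C + x *: perp (P - C)).

Lemma cross_perpr u : cross u (perp u) = dot u u.
Proof. by rewrite cross_perp. Qed.

Lemma perp_neq0 u : (perp u == 0) = (u == 0).
Proof. by rewrite -!dot_eq0 /dot /perp /= mulrNN addrC. Qed.

Lemma leg_tile_ccw C P x : 0 < x -> C != P -> ccw (leg_tile C P x).
Proof.
move=> x0 CP; rewrite /ccw /= addrAC subrr add0r crossZr cross_perpr mulr_gt0 //.
by rewrite dot_gt0 subr_eq0 eq_sym.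
Qed.

Lemma vang_right u x : 0 < x -> u != 0 -> vang u (x *: perp u) = pi / 2.
Proof.
move=> x0 u0; have dd : 0 < dot u u by rewrite dot_gt0.
rewrite /vang !vecE cross_perpr gtr0_sg ?mulr_gt0 // mul1r.
have -> : dot u (perp u) = 0 by rewrite /dot /perp /=; ring.
by rewrite mulr0 mul0r atan0 subr0.
Qed.

Lemma atanV x : 0 < x -> atan x^-1 = pi / 2 - atan x.
Proof.
move=> x0; have [a1 a2 a3 a4] := atanP x.
have a0 : 0 < atan x by rewrite -atan0 lt_atan.
have -> : x^-1 = tan (pi / 2 - atan x).
  rewrite /tan sinB cosB cos_pihalf sin_pihalf a4.
  by field; rewrite !gt_eqF.
by rewrite tanK // in_itv /=; apply/andP; split; lra.
Qed.

Lemma leg_tile_view C P x : 0 < x -> C != P ->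
  let Y := C + x *: perp (P - C) in
  [/\ view C (leg_tile C P x) = pi / 2,
      view P (leg_tile C P x) = atan x,
      view Y (leg_tile C P x) = pi / 2 - atan x
    & forall O, 0 <= view O (leg_tile C P x) /\
       (view O (leg_tile C P x) < pi -> O != C -> O != P -> O != Y ->
        view O (leg_tile C P x) = 0)].
Proof.
move=> x0 CP Y; set u := P - C; have u0 : u != 0 by rewrite subr_eq0 eq_sym.
have dd : 0 < dot u u by rewrite dot_gt0.
have T := leg_tile_ccw x0 CP.
have YC : Y - C = x *: perp u by rewrite /Y addrAC subrr add0r.
have YP : Y - P = x *: perp u - u by rewrite -YC /u opprB addrA subrK.
have vP : vang (x *: perp u - u) (- u) = atan x.
  have E1 : cross (x *: perp u - u) (- u) = x * dot u u.
    by rewrite /cross /dot /perp /= /GRing.scale /=; ring.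
  have E2 : dot (x *: perp u - u) (- u) = dot u u.
    by rewrite /dot /perp /= /GRing.scale /=; ring.
  rewrite /vang E1 E2 gtr0_sg ?mulr_gt0 // mul1r.
  have -> : dot u u / (x * dot u u) = x^-1 by field; rewrite !gt_eqF.
  by rewrite atanV // opprB addrC subrK.
have vY : vang (- (x *: perp u)) (- (x *: perp u - u)) = pi / 2 - atan x.
  have E1 : cross (- (x *: perp u)) (- (x *: perp u - u)) = x * dot u u.
    by rewrite /cross /dot /perp /= /GRing.scale /=; ring.
  have E2 : dot (- (x *: perp u)) (- (x *: perp u - u)) = x ^+ 2 * dot u u.
    by rewrite /dot /perp /= /GRing.scale /=; ring.
  rewrite /vang E1 E2 gtr0_sg ?mulr_gt0 // mul1r.
  by have -> : x ^+ 2 * dot u u / (x * dot u u) = x by field; rewrite !gt_eqF.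
split.
- by rewrite viewE subrr vang0l vang0r add0r addr0 -/Y YC vang_right.
- by rewrite viewE subrr vang0l vang0r !add0r -/Y YP -(opprB P C) vP.
- by rewrite viewE -/Y subrr vang0l vang0r !addr0 -(opprB Y C) -(opprB Y P) YC YP vY.
move=> O; split; first exact: view_ge0 T.
move=> lt_pi OC OP OY; case: (view_cases O T) => //.
  by rewrite leNgt lt_pi.
by case=> -[e]; [rewrite e eqxx in OC|rewrite e eqxx in OP|rewrite e eqxx in OY].
Qed.

(** With a negative ratio the triangle is clockwise. *)
Lemma leg_tile_view_le0 O C P x : x < 0 -> C != P -> view O (leg_tile C P x) <= 0.
Proof.
move=> x0 CP; set Y := C + x *: perp (P - C).
have T : ccw (C, Y, P).
  rewrite /ccw /Y /= addrAC subrr add0r crossZl crossC cross_perpr mulrN -mulNr.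
  by rewrite mulr_gt0 ?oppr_gt0 // dot_gt0 subr_eq0 eq_sym.
have := view_ge0 O T; rewrite !viewE -/Y.
rewrite [vang (C - O) (Y - O)]vangC [vang (Y - O) (P - O)]vangC [vang (P - O) (C - O)]vangC.
lra.
Qed.

(** A tile is encoded by the vertex [C] of its right angle, the other end [P] of
    the leg from which a quarter turn counterclockwise leads to the second leg,
    and a boolean that tells whether the angle at [P] is [atan x] or its
    complement. This describes a reflected tile without a clockwise triangle. *)
Definition item := (plane * plane * bool)%type.
Definition slope (b : bool) x : R := if b then x else x^-1.
Definition tip x (i : item) : plane :=
  let: (C, P, b) := i in C + slope b x *: perp (P - C).
Definition tile x (i : item) : triple R :=
  let: (C, P, b) := i in leg_tile C P (slope b x).
Definition nondeg (i : item) := let: (C, P, _) := i in C != P.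
Definition map_item (F : plane -> plane) (i : item) : item :=
  let: (C, P, b) := i in (F C, F P, b).

Definition has_right V (i : item) := i.1.1 == V.
Definition has_angle x V (i : item) := (if i.2 then i.1.2 else tip x i) == V.
Definition has_coangle x V (i : item) := (if i.2 then tip x i else i.1.2) == V.

Lemma slope_gt0 b x : 0 < x -> 0 < slope b x.
Proof. by case: b; rewrite /= ?invr_gt0. Qed.

Lemma tile_view x i : 0 < x -> nondeg i ->
  [/\ view i.1.1 (tile x i) = pi / 2,
      view (if i.2 then i.1.2 else tip x i) (tile x i) = atan x,
      view (if i.2 then tip x i else i.1.2) (tile x i) = pi / 2 - atan x
    & forall O, 0 <= view O (tile x i) /\
       (view O (tile x i) < pi -> ~~ has_right O i -> ~~ has_angle x O i ->
        ~~ has_coangle x O i -> view O (tile x i) = 0)].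
Proof.
case: i => [[C P] []] x0 pr; rewrite /has_right /has_angle /has_coangle /=.
  have [h1 h2 h3 h4] := leg_tile_view x0 pr; split=> // O.
  by have [h5 h6] := h4 O; split=> // h7 h8 h9 h10; apply: h6 => //; rewrite eq_sym.
have x0' : 0 < x^-1 by rewrite invr_gt0.
have [h1 h2 h3 h4] := leg_tile_view x0' pr; split=> //.
- by rewrite h3 atanV //; ring.
- by rewrite h2 atanV.
move=> O; have [h5 h6] := h4 O; split=> // h7 h8 h9 h10; apply: h6 => //; by rewrite eq_sym.
Qed.

Lemma tip_neq x i : 0 < x -> nondeg i -> i.1.2 != tip x i.
Proof.
case: i => [[C P] b] x0 /= CP; apply: contra_eq_neq (crossvv (P - C)) => e.
rewrite {2}e addrAC subrr add0r crossZr cross_perpr mulf_neq0 ?gt_eqF ?slope_gt0 //.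
by rewrite dot_gt0 subr_eq0 eq_sym.
Qed.

Lemma tile_view_sum x i : 0 < x -> nondeg i -> forall O, view O (tile x i) < pi ->
  view O (tile x i) = (has_angle x O i)%:R * atan x
    + (has_coangle x O i)%:R * (pi / 2 - atan x) + (has_right O i)%:R * (pi / 2).
Proof.
move=> x0 pr O; have [h1 h2 h3 h4] := tile_view x0 pr; have [_ h5] := h4 O => lt_pi.
have a0 : 0 < atan x by rewrite -atan0 lt_atan.
have a1 := atan_ltpi2 x.
have [r|nr] := boolP (has_right O i).
  have [a|na] := boolP (has_angle x O i).
    by move: r a => /eqP e /eqP e'; move: h2; rewrite e' -{1}e h1; lra.
  have [c|nc] := boolP (has_coangle x O i).
    by move: r c => /eqP e /eqP e'; move: h3; rewrite e' -{1}e h1; lra.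
  by move/eqP: r => e; rewrite -e h1 /=; ring.
have [a|na] := boolP (has_angle x O i).
  have [c|nc] := boolP (has_coangle x O i); last by move/eqP: a => e; rewrite -e h2 /=; ring.
  have := tip_neq x0 pr; move: a c => /eqP + /eqP; case: ifP => _ e1 e2.
    by rewrite e1 e2 eqxx.
  by rewrite e1 e2 eqxx.
have [c|nc] := boolP (has_coangle x O i); last by rewrite h5 //=; ring.
by move/eqP: c => e; rewrite -e h3 /=; ring.
Qed.

(** A total angle less than [pi] leaves no room for a tile that contains the
    point without having it as a vertex. The counts are expressed by the tiles
    before they are moved by [F], so that they do not depend on [F]. *)
Lemma vertex_angles (s : seq item) (D : pred item) (F : plane -> plane) V x0 x T :
  0 < x -> T < pi ->
  (forall i, i \in s -> D i -> [/\ nondeg (map_item F i),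
     has_angle x (F V) (map_item F i) = has_angle x0 V i,
     has_coangle x (F V) (map_item F i) = has_coangle x0 V i
   & has_right (F V) (map_item F i) = has_right V i]) ->
  \sum_(i <- s | D i) view (F V) (tile x (map_item F i)) = T ->
  T = (count (fun i => D i && has_angle x0 V i) s)%:R * atan x
    + (count (fun i => D i && has_coangle x0 V i) s)%:R * (pi / 2 - atan x)
    + (count (fun i => D i && has_right V i) s)%:R * (pi / 2).
Proof.
move=> x_gt0 T_lt H sT; rewrite -{}sT in T_lt *.
elim: s H T_lt => [|i s IH] H; first by rewrite big_nil /= => _; ring.
have H' j : j \in s -> _ := fun js => H j (@mem_behead _ (i :: s) j js).
have {}IH := IH H'.
rewrite big_cons /=; have [Di|nDi] := boolP (D i); last first.
  by move=> /IH ->; rewrite /= !add0n.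
have [pr e1 e2 e3] := H i (mem_head _ _) Di.
have v0 := tile_view x_gt0 pr.
have vi : 0 <= view (F V) (tile x (map_item F i)) by have [_ _ _ h] := v0; case: (h (F V)).
have vs : 0 <= \sum_(i <- s | D i) view (F V) (tile x (map_item F i)).
  rewrite big_seq_cond sumr_ge0 // => j /andP[js Dj].
  have [pj _ _ _] := H' j js Dj.
  by have [_ _ _ h] := tile_view x_gt0 pj; case: (h (F V)).
move=> lt_pi; rewrite IH; last by lra.
rewrite tile_view_sum //; last by lra.
by rewrite e1 e2 e3 /= !natrD; ring.
Qed.

Lemma sum_view_le0 (s : seq item) (D : pred item) (F : plane -> plane) O x :
  x < 0 -> (forall i, i \in s -> D i -> nondeg (map_item F i)) ->
  \sum_(i <- s | D i) view O (tile x (map_item F i)) <= 0.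
Proof.
move=> x0 H; rewrite big_seq_cond sumr_le0 // => i /andP[si Di].
move: (H i si Di); case: i {si Di} => [[C P] b] /= pr; apply: leg_tile_view_le0 => //.
by case: b; rewrite /= ?invr_lt0.
Qed.

End RightTiles.

(** * The conjugate of a dissection *)

Section Conjugation.
Variable R : realType.
Local Notation plane := (plane R).
Implicit Types (p q u v O V C P d : plane) (x y z : R).

Lemma evN (x : R) (p : {poly rat}) : ev x (- p) = - ev x p.
Proof. by rewrite /ev rmorphN hornerN. Qed.

Lemma chebyshev n : exists p : {poly rat}, forall y : R, ev (2 * cos y) p = cos (n%:R * y).
Proof.
suff [p [_ [Hp _]]] : exists p q : {poly rat}, (forall y : R, ev (2 * cos y) p = cos (n%:R * y))
    /\ (forall y : R, ev (2 * cos y) q = cos (n.+1%:R * y)) by exists p.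
elim: n => [|n [p [q [Hp Hq]]]].
  exists 1, (2^-1 *: 'X); split=> y; first by rewrite ev1 mul0r cos0.
  rewrite /ev map_polyZ map_polyX hornerZ hornerX mul1r fmorphV rmorph_nat.
  by rewrite mulrA mulVf ?mul1r.
exists q, ('X * q - p); split=> // y.
rewrite evD evM evX Hq evN Hp.
have -> : n.+2%:R * y = n.+1%:R * y + y by rewrite -[n.+2]addn1 natrD; ring.
have -> : n%:R * y = n.+1%:R * y - y by rewrite -[n.+1]addn1 natrD; ring.
by rewrite cosB cosD; ring.
Qed.

(* The angles that matter are the multiples of [pi / (2 h)], and conjugation
   multiplies them by [k]. *)
Variables (h k : nat).
Hypotheses (h0 : (0 < h)%N) (kodd : odd k).
Local Notation M := h.*2.
Local Notation t := (@pi R / M%:R).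
Local Notation c := (2 * cos t).
Local Notation c' := (2 * cos (k%:R * t)).

(** The sign by which sines differ from cosines under conjugation: it is the sine
    of [k pi / 2]. *)
Definition chi : R := (-1) ^+ k./2.


Variables (X : set R) (f : R -> R).
Hypothesis X1 : X 1 /\ f 1 = 1.
Hypothesis XD : forall x y, X x -> X y -> X (x + y) /\ f (x + y) = f x + f y.
Hypothesis XZ : forall (p : {poly rat}) x, X x -> X (ev c p * x) /\ f (ev c p * x) = ev c' p * f x.
Hypothesis Xinj : forall x, X x -> f x = 0 -> x = 0.

Lemma XN x : X x -> X (- x) /\ f (- x) = - f x.
Proof. by move=> /(XZ (-1)%:P); rewrite !evC rmorphN1 !mulN1r. Qed.

Lemma XB x y : X x -> X y -> X (x - y) /\ f (x - y) = f x - f y.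
Proof. by move=> Xx /XN[Xy <-]; apply: XD. Qed.

Lemma Xcos j x : X x ->
  X (cos (j%:R * t) * x) /\ f (cos (j%:R * t) * x) = cos ((k * j)%:R * t) * f x.
Proof.
have [p Hp] := chebyshev j => /(XZ p); rewrite !Hp.
by have -> : (k * j)%:R * t = j%:R * (k%:R * t) by rewrite natrM; ring.
Qed.

Lemma half_turn : h%:R * t = pi / 2.
Proof. by rewrite -muln2 natrM; field; rewrite pnatr_eq0 -lt0n. Qed.

Lemma khalf : k%:R * (pi / 2) = pi / 2 + k./2%:R * pi :> R.
Proof.
have -> : k%:R = 1 + k./2%:R * 2 :> R.
  by rewrite -{1}(odd_double_half k) kodd natrD -muln2 natrM.
by field.
Qed.

Lemma chi2 : chi * chi = 1.
Proof. by rewrite /chi -expr2 sqrr_sign. Qed.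

(** Sines are cosines: the shift by [3 h] steps, three quarters of a turn of
    length [4 h], turns one into the other. *)
Lemma Xsin j x : X x ->
  X (sin (j%:R * t) * x) /\ f (sin (j%:R * t) * x) = chi * sin ((k * j)%:R * t) * f x.
Proof.
move=> /(Xcos (j + 3 * h)).
have -> : (j + 3 * h)%:R * t = j%:R * t + pi / 2 + 1%:R * pi.
  by rewrite natrD natrM mulrDl -mulrA half_turn; lra.
rewrite cosDnpi cosDpihalf expr1 mulN1r opprK.
have -> : (k * (j + 3 * h))%:R * t = (k * j)%:R * t + pi / 2 + (k + k./2)%:R * pi.
  have -> : (k * (j + 3 * h))%:R * t = (k * j)%:R * t + 3 * (k%:R * (h%:R * t)).
    by rewrite mulnDr !natrD !natrM; ring.
  by rewrite half_turn natrD mulrDl khalf; have := khalf; lra.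
rewrite cosDnpi cosDpihalf exprD -signr_odd kodd expr1 /chi.
by rewrite !mulN1r mulrNN.
Qed.

(** Applied coordinatewise, with the sign that makes [Phi] turn each direction of
    argument [j pi / (2 h)] into the one of argument [k j pi / (2 h)]. *)
Definition Phi p : plane := (f p.1, chi * f p.2).
Definition inX p := X p.1 /\ X p.2.

Lemma semilinear0 : f 0 = 0.
Proof.
have [X0 _] := XZ 0 (proj1 X1); have := XD X0 X0.
rewrite /ev !rmorph0 horner0 mul0r addr0 => -[_ /eqP].
by rewrite -subr_eq0 opprD addNKr oppr_eq0 => /eqP.
Qed.

Lemma PhiB p q : inX p -> inX q -> inX (q - p) /\ Phi (q - p) = Phi q - Phi p.
Proof.
move=> [p1 p2] [q1 q2]; have [h1 h2] := XB q1 p1; have [h3 h4] := XB q2 p2.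
split; first by [].
by apply: plane_eq; rewrite /= ?h2 ?h4 // mulrBr.
Qed.

Lemma Phi_inj p q : inX p -> inX q -> (Phi p == Phi q) = (p == q).
Proof.
move=> Xp Xq; apply/eqP/eqP => [|->//] e.
have [[Xd1 Xd2] ed] := PhiB Xq Xp.
move: ed; rewrite e subrr => -[/(Xinj Xd1) /= e1 /eqP].
rewrite mulf_eq0 signr_eq0 /= => /eqP/(Xinj Xd2)/= e2.
by apply: plane_eq; apply/eqP; rewrite -subr_eq0; apply/eqP.
Qed.

Definition grid j : plane := dir (j%:R * t).
Definition grid' j : plane := dir ((k * j)%:R * t).

Lemma Phi_dir j x : X x -> Phi (x *: grid j) = f x *: grid' j.
Proof.
move=> Xx; have [_ e1] := Xcos j Xx; have [_ e2] := Xsin j Xx.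
apply: plane_eq; rewrite /= /GRing.scale /= ![x * _]mulrC ?e1 ?e2.
  by rewrite mulrC.
by rewrite !mulrA chi2 mul1r mulrC.
Qed.

Lemma X_dot j p : inX p -> X (dot p (grid j)).
Proof.
move=> [p1 p2]; rewrite /dot /= ![_ * cos _]mulrC ![_ * sin _]mulrC.
by apply: (proj1 (XD _ _)); [exact: (proj1 (Xcos j p1))|exact: (proj1 (Xsin j p2))].
Qed.

Lemma gridP j p : cross p (grid j) = 0 -> p = dot p (grid j) *: grid j.
Proof.
move=> /(parallelP (dir_neq0 _)) {1}->.
by rewrite dot_dir subrr cos0 divr1.
Qed.

Lemma Phi_grid j p : inX p -> cross p (grid j) = 0 ->
  Phi p = f (dot p (grid j)) *: grid' j.
Proof. by move=> Xp /gridP {1}->; rewrite Phi_dir //; exact: X_dot. Qed.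

Lemma grid'_parallel i j : cross (grid i) (grid j) = 0 -> cross (grid' i) (grid' j) = 0.
Proof.
have [X1' f1] := X1.
rewrite /cross /= => e.
have [a1 a2] := Xsin j X1'; have [b1 b2] := Xcos i a1.
have [c1 c2] := Xcos j X1'; have [d1 d2] := Xsin i c1.
have := proj2 (XB b1 d1).
rewrite !mulr1 in a2 b2 c2 d2 *.
rewrite e semilinear0 b2 d2 a2 c2 f1 !mulr1 => /esym/eqP.
have -> : forall a b s u : R, a * (chi * b) - chi * s * u = chi * (a * b - s * u).
  by move=> *; ring.
by rewrite mulf_eq0 signr_eq0 /= => /eqP.
Qed.

Lemma grid_add j n : grid (j + n) =
  cos (n%:R * t) *: grid j + sin (n%:R * t) *: perp (grid j).
Proof.
apply: plane_eq; rewrite /= /GRing.scale /= natrD mulrDl ?cosD ?sinD; ring.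
Qed.

Lemma sin_khalf : sin (k%:R * (pi / 2)) = chi.
Proof. by rewrite khalf sinDnpi sin_pihalf mulr1. Qed.

Lemma cos_khalf : cos (k%:R * (pi / 2)) = 0 :> R.
Proof. by rewrite khalf cosDnpi cos_pihalf mulr0. Qed.

Lemma grid'_add j n : grid' (j + n) =
  cos ((k * n)%:R * t) *: grid' j + sin ((k * n)%:R * t) *: perp (grid' j).
Proof.
rewrite /grid' mulnDr natrD mulrDl.
apply: plane_eq; rewrite /= /GRing.scale /= ?cosD ?sinD; ring.
Qed.

Lemma grid'_half j : grid' (j + h) = chi *: perp (grid' j).
Proof.
by rewrite grid'_add natrM -mulrA half_turn sin_khalf cos_khalf scale0r add0r.
Qed.

Lemma grid_half j : grid (j + h) = perp (grid j).
Proof. by rewrite grid_add half_turn sin_pihalf cos_pihalf scale0r add0r scale1r. Qed.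

Lemma cos_conj_neq0 n : cos (n%:R * t) != 0 -> cos ((k * n)%:R * t) != 0.
Proof.
apply: contra_neq => e; have [Xc fc] := Xcos n (proj1 X1).
by apply: Xinj; rewrite -[cos _]mulr1 // fc e mul0r.
Qed.

Lemma sin_conj_neq0 n : sin (n%:R * t) != 0 -> sin ((k * n)%:R * t) != 0.
Proof.
apply: contra_neq => e; have [Xc fc] := Xsin n (proj1 X1).
by apply: Xinj; rewrite -[sin _]mulr1 // fc e mulr0 mul0r.
Qed.

Variable O : plane.

(** These are the directions that [Phi] respects: segments of direction [grid j]
    are mapped to segments of direction [grid' j]. *)
Definition on_grid d := exists j : nat, cross d (grid j) = 0.
(** The view from [O] of the image of a segment under [Phi]. The line
    of a segment off the grid need not be mapped into a line; such segments get
    weight [0], and so do the tiles formed by them. *)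
Definition conj_weight p d :=
  if `[< on_grid d >]
  then cot_angle (Phi p - O) (grid' (xget 0%N [set j | cross d (grid j) = 0])) else 0.

Lemma conj_weightE p d j : d != 0 -> cross d (grid j) = 0 ->
  conj_weight p d = cot_angle (Phi p - O) (grid' j).
Proof.
move=> d0 e; rewrite /conj_weight ifT; last by apply/asboolP; exists j.
case: xgetP => [i _ /= e'|/(_ j)//].
apply: (view_weight_homogeneous O); rewrite ?dir_neq0 //.
by apply: grid'_parallel; apply: (cross_trans d0); rewrite crossC ?e ?e' oppr0.
Qed.

Lemma conj_weight_homogeneous : homogeneous conj_weight.
Proof.
move=> p d d' d0 d'0 dd'; rewrite /conj_weight.
have E : [set j | cross d (grid j) = 0] = [set j | cross d' (grid j) = 0].
  apply/seteqP; split=> j /= e; apply: cross_trans.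
  - exact: d0.
  - by rewrite crossC dd' oppr0.
  - by rewrite crossC e oppr0.
  - exact: d'0.
  - exact: dd'.
  - by rewrite crossC e oppr0.
rewrite E; congr (if _ then _ else _); apply/asbool_equiv_eq.
have -> : on_grid d = ([set j | cross d (grid j) = 0] !=set0) by [].
by rewrite E.
Qed.

Lemma conj_edge p q j : inX p -> inX q -> p != q -> cross (q - p) (grid j) = 0 ->
  edge_weight conj_weight (p, q) = edge_weight (view_weight O) (Phi p, Phi q).
Proof.
move=> Xp Xq pq e; have qp0 : q - p != 0 by rewrite subr_eq0 eq_sym.
have [Xd Ed] := PhiB Xp Xq.
have r0 : f (dot (q - p) (grid j)) != 0.
  apply: contra_neq qp0 => /(Xinj (X_dot j Xd)) r0.
  by rewrite (gridP e) r0 scale0r.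
rewrite [RHS](edge_weight_dir (view_weight_homogeneous O) r0 (dir_neq0 ((k * j)%:R * t))).
  by rewrite /edge_weight /= !(conj_weightE _ qp0 e).
by rewrite -Ed (Phi_grid Xd e).
Qed.

Lemma conj_edge0 p q : p != q -> ~ on_grid (q - p) -> edge_weight conj_weight (p, q) = 0.
Proof.
move=> pq ng; rewrite /edge_weight /conj_weight /= asboolF // subrr //.
Qed.

Variable A : nat.
Hypothesis Ah : (0 < A < h)%N.
Local Notation x0 := (tan (A%:R * t)).
Local Notation xk := (tan ((k * A)%:R * t)).
(** The angle of a tile at the end of its first leg, in steps of the grid. *)
Definition sharp (b : bool) := if b then A else (h - A)%N.

Lemma sharp_itv b : (0 < sharp b < h)%N.
Proof.
by case/andP: Ah => A0 A1; case: b; rewrite /= ?A0 ?A1 // subn_gt0 A1 ltn_subrL A0 h0.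
Qed.

Lemma sharp_acute b : 0 < (sharp b)%:R * t < pi / 2.
Proof.
have /andP[b0 b1] := sharp_itv b; have pi0 := pi_gt0 R.
have t0 : 0 < t by rewrite divr_gt0 // ltr0n double_gt0.
by rewrite -half_turn mulr_gt0 ?ltr0n // ltr_pM2r // ltr_nat.
Qed.

Lemma sharp_cos b : 0 < cos ((sharp b)%:R * t).
Proof.
have /andP[a0 a1] := sharp_acute b; apply: cos_gt0_pihalf; apply/andP; split=> //.
by apply: lt_trans a0; rewrite oppr_lt0 divr_gt0 ?pi_gt0.
Qed.

Lemma sharp_sin b : 0 < sin ((sharp b)%:R * t).
Proof. by apply: sin_gt0_pihalf; exact: sharp_acute. Qed.

Lemma slope_sharp b : slope b x0 = tan ((sharp b)%:R * t).
Proof.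
case: b => //=; rewrite natrB; last by case/andP: Ah => _ /ltnW.
by rewrite mulrBl half_turn /tan sinB cosB cos_pihalf sin_pihalf !mul0r !mul1r subr0 add0r invfM invrK mulrC.
Qed.

Lemma slope_sharp' b : slope b xk = tan ((k * sharp b)%:R * t).
Proof.
case: b => //=; have /andP[A0 A1] := Ah.
rewrite mulnBr natrB ?leq_mul2l ?(ltnW A1) ?orbT // mulrBl [(k * h)%:R]natrM -mulrA half_turn.
rewrite /tan sinB cosB cos_khalf sin_khalf !mul0r subr0 add0r invfM invrK mulrC.
by rewrite -mulf_div divff ?mul1r // signr_eq0.
Qed.

Lemma slope0_gt0 : 0 < x0.
Proof. by rewrite divr_gt0 ?(sharp_sin true) ?(sharp_cos true). Qed.

Definition item_in (i : item R) := [/\ inX i.1.1, inX i.1.2 & inX (tip x0 i)].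

(** If one side of a tile is on the grid, so are all of them, because its angles
    are multiples of the step. The image is then a triangle with a right angle,
    whose other angles are multiplied by [k]. *)
Lemma item_image (i : item R) : nondeg i -> item_in i -> on_grid (i.1.2 - i.1.1) ->
  [/\ nondeg (map_item Phi i), Phi (tip x0 i) = tip xk (map_item Phi i)
   & weight conj_weight (tile x0 i) = view O (tile xk (map_item Phi i))].
Proof.
case: i => [[C P] b] /= CP [XC XP XY] [j e]; set Y := C + _ in XY *.
have [Xu Pu] := PhiB XC XP; have [Xv Pv] := PhiB XC XY.
have vE : Y - C = slope b x0 *: perp (P - C) by rewrite /Y addrAC subrr add0r.
have vg : cross (Y - C) (grid (j + h)) = 0.
  by rewrite vE grid_half (gridP e) /perp /cross /= /GRing.scale /=; ring.
pose r := dot (P - C) (grid j).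
have Xr : X r := X_dot j Xu.
have dE : dot (Y - C) (grid (j + h)) = slope b x0 * r.
  by rewrite vE grid_half /r /perp /dot /= /GRing.scale /=; ring.
have Xxr : X (slope b x0 * r) by rewrite -dE; exact: X_dot.
have cs := sharp_cos b; have cs' : cos ((k * sharp b)%:R * t) != 0.
  by apply: cos_conj_neq0; rewrite gt_eqF.
have fx : f (slope b x0 * r) = chi * slope b xk * f r.
  have [_ E1] := Xcos (sharp b) Xxr; have [_ E2] := Xsin (sharp b) Xr.
  apply: (mulfI cs'); rewrite -E1.
  have -> : cos ((sharp b)%:R * t) * (slope b x0 * r) = sin ((sharp b)%:R * t) * r.
    by rewrite slope_sharp /tan; field; rewrite gt_eqF.
  by rewrite E2 slope_sharp' /tan; field.
have tipE : Phi Y = Phi C + slope b xk *: perp (Phi P - Phi C).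
  apply/eqP; rewrite addrC -subr_eq; apply/eqP.
  rewrite -Pv -Pu (Phi_grid Xv vg) (Phi_grid Xu e) dE fx grid'_half -/r.
  have := chi2; move: chi (grid' j) => ch g c2.
  by apply: plane_eq; rewrite /= /GRing.scale /= -[RHS]mul1r -c2; ring.
split=> //; first by rewrite Phi_inj.
have sg0 : 0 < slope b x0 by apply: slope_gt0; exact: slope0_gt0.
have YC : Y != C.
  by rewrite -subr_eq0 vE scaler_eq0 negb_or gt_eqF //= perp_neq0 subr_eq0 eq_sym.
have PY : P != Y by apply: (tip_neq (i := (C, P, b)) slope0_gt0 CP).
have ew : cross (Y - P) (grid (j + (M - sharp b))) = 0.
  have -> : Y - P = slope b x0 *: perp (P - C) - (P - C).
    by rewrite -vE opprB addrA subrK.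
  rewrite (gridP e) grid_add natrB; last first.
    have /andP[_ /ltnW b1] := sharp_itv b; apply: leq_trans b1 _.
    by rewrite -addnn leq_addr.
  have -> : (M%:R - (sharp b)%:R) * t = - ((sharp b)%:R * t) + 1%:R * pi.
    by rewrite mulrBl; field; rewrite pnatr_eq0 -lt0n double_gt0.
  rewrite cosDnpi sinDnpi expr1 cosN sinN !mulN1r opprK slope_sharp /tan.
  have dd : dot (grid j) (grid j) = 1 by rewrite dot_dir subrr cos0.
  set g := grid j in dd *; set q := dot _ _; set cb := cos _; set sb := sin _.
  have cb0 : cb != 0 by rewrite gt_eqF.
  transitivity (q * (sb / cb * cb - sb) * dot g g).
    by rewrite /cross /dot /perp /= /GRing.scale /=; ring.
  by rewrite divfK // subrr mulr0 mul0r.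
rewrite /view /weight /= !big_cons !big_nil -/Y -tipE.
rewrite (conj_edge XC XP CP e) (conj_edge XP XY PY ew) (conj_edge (j := (j + h)%N) XY XC YC) //.
by rewrite -opprB crossNl vg oppr0.
Qed.

Lemma item_off_grid (i : item R) : nondeg i -> ~ on_grid (i.1.2 - i.1.1) ->
  weight conj_weight (tile x0 i) = 0.
Proof.
case: i => [[C P] b] /= CP ng; set Y := C + slope b x0 *: perp (P - C).
have sg0 : 0 < slope b x0 by apply: slope_gt0; exact: slope0_gt0.
have vE : Y - C = slope b x0 *: perp (P - C) by rewrite /Y addrAC subrr add0r.
have YC : Y != C.
  by rewrite -subr_eq0 vE scaler_eq0 negb_or gt_eqF //= perp_neq0 subr_eq0 eq_sym.
have PY : P != Y by apply: (tip_neq (i := (C, P, b)) slope0_gt0 CP).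
have perpE u d : cross (perp u) d = - dot u d by rewrite /cross /dot /perp /=; ring.
rewrite /weight /= !big_cons big_nil -/Y !conj_edge0 ?addr0 //.
  move=> [j e]; apply: ng; exists (j + h)%N; rewrite grid_half cross_perp.
  have /eqP : slope b x0 * dot (P - C) (grid j) = 0.
    by move: e; rewrite -opprB crossNl vE crossZl perpE mulrN opprK.
  by rewrite mulf_eq0 gt_eqF //= => /eqP.
move=> [j e]; apply: ng; exists (j + sharp b)%N.
move: e; have -> : Y - P = slope b x0 *: perp (P - C) - (P - C).
  by rewrite -vE opprB addrA subrK.
rewrite [cross (_ - (P - C)) _]crossDl crossZl perpE [cross (- (P - C)) _]crossNl.
rewrite grid_add [cross _ (_ + _)]crossDr !crossZr cross_perp.
rewrite slope_sharp /tan; have := sharp_cos b; set cb := cos _; set sb := sin _ => cb0.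
set p := dot _ _; set q := cross _ _ => e.
have -> : cb * q + sb * p = - cb * (sb / cb * - p - q) by field; rewrite gt_eqF.
by rewrite e mulr0.
Qed.

End Conjugation.

(** * The angles at a vertex of the polygon *)

Section VertexEquation.
Variable R : realType.
Local Notation plane := (plane R).

Definition std_tiles N : seq (triple R) := [seq std_tile R N j | j <- iota 0 N.*2].

Definition same_cover (T T' : seq (triple R)) :=
  forall y : plane, all (fun t => generic t y) (T ++ T') ->
     count (fun t => inside t y) T = count (fun t => inside t y) T'.

Lemma cos_pi_gt0 N : (2 < N)%N -> 0 < cos (pi / N%:R : R).
Proof.
move=> N2; have N0 : 0 < N%:R :> R by rewrite ltr0n (ltn_trans _ N2).
have pi0 := pi_gt0 R; apply: cos_gt0_pihalf; apply/andP; split.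
  by apply: (@lt_trans _ _ 0); rewrite ?oppr_lt0 divr_gt0.
rewrite ltr_pM2l // ltf_pV2 ?posrE // ?ltr_nat //.
Qed.

Lemma std_radius_gt0 N j : (2 < N)%N -> 0 < std_radius R N j.
Proof. by move=> N2; rewrite /std_radius; case: ifP => // _; exact: cos_pi_gt0. Qed.

Lemma std_tile_ccw N j : (2 < N)%N -> ccw (std_tile R N j).
Proof.
move=> N2; rewrite /std_tile /ccw !subr0 /std_vertex crossZl crossZr cross_dir.
have -> : j.+1%:R * (pi / N%:R) - j%:R * (pi / N%:R) = 1%:R * (pi / N%:R) :> R.
  by rewrite -addn1 natrD; ring.
rewrite !mulr_gt0 ?std_radius_gt0 // sin_gt0_pi // frac_pi_itv //.
by rewrite (ltn_trans _ N2).
Qed.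

Lemma std_tiles_ccw N : (2 < N)%N -> all (@ccw R) (std_tiles N).
Proof. by move=> N2; apply/allP => _ /mapP[j _ ->]; exact: std_tile_ccw. Qed.

Lemma sum_std N (w : plane -> plane -> R) :
  \sum_(t <- std_tiles N) weight w t = \sum_(j < N.*2) weight w (std_tile R N j).
Proof. by rewrite big_map -{1}[N.*2]subn0 -/(index_iota _ _) big_mkord. Qed.

Lemma tiles_ccw x (s : seq (item R)) : 0 < x -> all (@nondeg R) s ->
  all (@ccw R) (map (tile x) s).
Proof.
move=> x0 /allP sn; apply/allP => _ /mapP[[[C P] b] /sn CP ->].
by apply: leg_tile_ccw => //; exact: slope_gt0.
Qed.

Section Plain.
Variables (N : nat) (x : R) (s : seq (item R)).
Hypotheses (N2 : (2 < N)%N) (x_gt0 : 0 < x) (sn : all (@nondeg R) s).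
Hypothesis cover : same_cover (map (tile x) s) (std_tiles N).

(** The view from the vertex [dir 0], computed with the given tiles and with the
    standard ones. The numbers count the angles of tiles that meet at it. *)
Lemma plain_vertex_angles : exists a b r : nat,
  pi - 2 * (pi / N%:R) = a%:R * atan x + b%:R * (pi / 2 - atan x) + r%:R * (pi / 2).
Proof.
have N0 : (0 < N)%N := ltn_trans (isT : 0 < 2)%N N2.
have pi0 := pi_gt0 R.
have := weight_sum (view_weight_homogeneous (dir 0)) (tiles_ccw x_gt0 sn)
  (std_tiles_ccw N2) cover.
rewrite sum_std (std_total (ltnW N2) (@view_weight_homogeneous _ (dir 0)) (k := 1)) //;
  last first.
- move=> i iN; rewrite !mul1n mul1r /view_weight -!std_vertex_even.
  by split.
- by rewrite coprime1n.
rewrite big_map saw_frac //; last by rewrite dvdn1; case: N N2 => [|[]].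
rewrite modn_small ?(ltn_trans _ N2) // mul1r.
have -> : 2 * (pi / 2 - pi / N%:R) = pi - 2 * (pi / N%:R) :> R by field; rewrite pnatr_eq0 -lt0n.
move=> H.
have {}H : \sum_(i <- s | xpredT i) view (dir 0) (tile x (map_item id i)) =
    pi - 2 * (pi / N%:R).
  by rewrite -H; apply: eq_bigr => -[[C P] b] _.
have := @vertex_angles R s xpredT id (dir 0) x x _ x_gt0 _ _ H.
move=> -> //; first by do 3 eexists.
  by rewrite gtrBl mulr_gt0 // divr_gt0 // ltr0n.
by move=> [[C P] b] si _; split=> //; apply: (allP sn).
Qed.
End Plain.

Section Conj.
Variables (N L A : nat) (s : seq (item R)).
Hypotheses (N2 : (2 < N)%N) (Ah : (0 < A < N * L)%N) (sn : all (@nondeg R) s).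
Local Notation t := (@pi R / (N * L).*2%:R).
Local Notation x0 := (tan (A%:R * t)).
Hypothesis cover : same_cover (map (tile x0) s) (std_tiles N).

(** The same computation after conjugation. The numbers [a], [b], [r] do not
    depend on [k]: they count the angles, at the vertex, of the tiles that are on
    the grid. The standard dissection becomes one of a star polygon, with an
    angle of [pi - 2 pi k / N] at its vertices when [k] is reduced modulo [N] to
    less than [N / 2]. *)
Lemma conj_vertex_angles : exists a b r : nat, forall k, odd k ->
  coprime k (N * L).*2.*2 -> (0 < k %% N)%N -> (2 * (k %% N) < N)%N ->
  0 < tan ((k * A)%:R * t) /\
  pi - 2 * ((k %% N)%:R * (pi / N%:R)) = a%:R * atan (tan ((k * A)%:R * t))
    + b%:R * (pi / 2 - atan (tan ((k * A)%:R * t))) + r%:R * (pi / 2).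
Proof.
have N0 : (0 < N)%N := ltn_trans (isT : 0 < 2)%N N2.
have pi0 := pi_gt0 R.
have h0 : (0 < N * L)%N by case/andP: Ah => A0 A1; exact: leq_ltn_trans A1.
have L0 : (0 < L)%N by move: h0; rewrite muln_gt0 => /andP[].
have M0 : (0 < (N * L).*2)%N by rewrite double_gt0.
pose D (i : item R) := `[< exists j : nat, cross (i.1.2 - i.1.1) (dir (j%:R * t)) = 0 >].
exists (count (fun i => D i && has_angle x0 (dir 0) i) s).
exists (count (fun i => D i && has_coangle x0 (dir 0) i) s).
exists (count (fun i => D i && has_right (dir 0) i) s).
move=> k kodd kM k0 kN.
have kcN : coprime k N.
  by apply: coprime_dvdr kM; rewrite -!muln2 -!mulnA dvdn_mulr.
pose coords := flatten [seq [:: i.1.1.1; i.1.1.2; i.1.2.1; i.1.2.2;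
  (tip x0 i).1; (tip x0 i).2] | i <- s].
have [conj0 conjV] := cos_conj_pair R M0 kM.
have [X [f [Xs X1 XD XZ Xinj]]] := semilinear_map conj0 conjV coords.
have Xi i : i \in s -> item_in (N * L) X A i.
  move=> si; have cX z : z \in [:: i.1.1.1; i.1.1.2; i.1.2.1; i.1.2.2;
      (tip x0 i).1; (tip x0 i).2] -> X z.
    move=> zi; apply: Xs; apply/flattenP; eexists; last exact: zi.
    by apply/mapP; exists i.
  by split; split; apply: cX; rewrite !inE eqxx ?orbT.
pose O : plane := dir 0.
pose w := @conj_weight R (N * L) k f O.
have hw : homogeneous w by apply: conj_weight_homogeneous.
pose F := Phi k f.
have [X1' f1] := X1.
have wE p d j : d != 0 -> cross d (grid R (N * L) j) = 0 ->
    w p d = cot_angle (F p - O) (grid' R (N * L) k j).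
  exact: (conj_weightE h0 kodd X1 XD XZ).
have NR : N%:R != 0 :> R by rewrite pnatr_eq0 -lt0n.
have LR : L%:R != 0 :> R by rewrite pnatr_eq0 -lt0n.
have vE i : F (std_vertex R N i.*2) = dir (2 * ((k * i)%:R * (pi / N%:R))).
  have -> : std_vertex R N i.*2 = 1 *: grid R (N * L) (i * (4 * L)).
    rewrite std_vertex_even scale1r /grid -muln2 !natrM; congr dir; field.
    by rewrite NR LR.
  rewrite /F (Phi_dir h0 kodd XZ) // f1 scale1r /grid' -muln2 !natrM.
  by congr dir; field; rewrite NR LR.
have gE i : side_dir R N i = grid R (N * L) (i.*2.+1 * (2 * L) + N * L).
  by rewrite /side_dir /grid -[(N * L).*2]muln2 natrD !natrM; congr dir; field; rewrite NR LR.
have gE' i : grid' R (N * L) k (i.*2.+1 * (2 * L) + N * L) =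
    dir ((k * i.*2.+1)%:R * (pi / N%:R) + k%:R * (pi / 2)).
  rewrite /grid' -[(N * L).*2]muln2 mulnDr natrD !natrM; congr dir; field; by rewrite NR LR.
have FO : F (dir 0) = O.
  have := vE 0%N; rewrite std_vertex_even muln0 !mul0r !mulr0; exact.
have inXV : inX X (dir 0).
  rewrite /inX /= cos0 sin0; split; first exact: (proj1 X1).
  by have := proj1 (XZ 0 _ (proj1 X1)); rewrite /ev rmorph0 horner0 mul0r.
have x0_gt0 : 0 < x0 := slope0_gt0 R h0 Ah.
have := weight_sum hw (tiles_ccw x0_gt0 sn) (std_tiles_ccw N2) cover.
rewrite sum_std (std_total (ltnW N2) hw kodd kcN); last first.
  move=> i iN; rewrite !(wE _ _ (i.*2.+1 * (2 * L) + N * L)%N) ?gE' ?vE //.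
  - exact: dir_neq0.
  - by rewrite -gE crossvv.
  - exact: dir_neq0.
  - by rewrite -gE crossvv.
rewrite saw_frac // ?/dvdn -?lt0n // big_map.
set T := 2 * _; have TE : T = pi - 2 * ((k %% N)%:R * (pi / N%:R)) by rewrite /T; field.
have Tpos : 0 < T.
  have -> : T = pi / N%:R * (N%:R - (2 * (k %% N))%:R) by rewrite TE natrM; field.
  by rewrite mulr_gt0 ?divr_gt0 ?ltr0n // subr_gt0 ltr_nat.
have Tlt : T < pi.
  by rewrite TE gtrBl !mulr_gt0 ?divr_gt0 ?invr_gt0 ?ltr0n.
move=> H; set xk := tan ((k * A)%:R * t).
have im i : i \in s -> D i -> [/\ nondeg (map_item F i), F (tip x0 i) = tip xk (map_item F i)
     & weight w (tile x0 i) = view O (tile xk (map_item F i))].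
  move=> si /asboolP Di; apply: (item_image h0 kodd X1 XD XZ Xinj O Ah) => //.
    exact: (allP sn).
  exact: Xi.
have {}H : \sum_(i <- s | D i) view (F (dir 0)) (tile xk (map_item F i)) = T.
  rewrite -H big_mkcond FO; apply: eq_big_seq => i si.
  case: ifPn => [Di|/asboolP nD]; first by have [_ _ ->] := im i si Di.
  by rewrite (item_off_grid k h0 f O Ah) //; apply: (allP sn).
have xk0 : xk != 0.
  rewrite mulf_neq0 ?invr_eq0 //.
    by rewrite (sin_conj_neq0 h0 kodd X1 XZ Xinj) // gt_eqF // (sharp_sin R h0 Ah true).
  by rewrite (cos_conj_neq0 X1 XZ Xinj) // gt_eqF // (sharp_cos R h0 Ah true).
(* All images of tiles have the same orientation, that of the sign of [xk]; were
   they clockwise, their total would not be positive. *)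
have xk_gt0 : 0 < xk.
  rewrite lt_def xk0 leNgt; apply/negP => xk_lt0.
  have : T <= 0 by rewrite -H; apply: sum_view_le0 => // i si Di; case: (im i si Di).
  by rewrite leNgt Tpos.
split=> //; rewrite -TE; apply: (vertex_angles (F := F) xk_gt0 Tlt) H => i si Di.
have [nd tE _] := im i si Di; have [XC XP XY] := Xi i si.
have FE p : inX X p -> (F p == F (dir 0)) = (p == dir 0).
  by move=> Xp; apply: (Phi_inj XD XZ Xinj).
split=> //.
- by move: tE XP XY; rewrite /has_angle; case: (i) => [[C P] []] /= tE XP XY; rewrite ?FE // -FE // tE.
- by move: tE XP XY; rewrite /has_coangle; case: (i) => [[C P] []] /= tE XP XY; rewrite ?FE // -FE // tE.
- by move: XC; rewrite /has_right; case: (i) => [[C P] b] /= XC; rewrite FE.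
Qed.
End Conj.

End VertexEquation.

(** * Arithmetic of the vertex equation *)

Section Arithmetic.
Local Open Scope nat_scope.

Lemma coprime_primes m n : (forall p, prime p -> p %| m -> p %| n -> False) -> coprime m n.
Proof.
move=> H; rewrite /coprime; apply: contraT => g1.
have [g0|g_gt0] := posnP (gcdn m n).
  by case: (H 2); rewrite // (dvdn_trans _ (dvdn_gcdl m n), dvdn_trans _ (dvdn_gcdr m n)) // g0.
have g2 : 1 < gcdn m n by rewrite ltn_neqAle eq_sym g1.
have pr := pdiv_prime g2; have pd := pdiv_dvd (gcdn m n).
by case: (H _ pr); [exact: dvdn_trans pd (dvdn_gcdl _ _)|exact: dvdn_trans pd (dvdn_gcdr _ _)].
Qed.

(** Every residue prime to [N] comes from a unit modulo [h], and on the part of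
    [h] that is prime to [N] the unit can be prescribed as well. *)
Lemma coprime_lift N h u v : 0 < N -> 0 < h -> N %| h -> coprime u N ->
  coprime v h`_(\pi(N)^') ->
  exists k, [/\ coprime k h, k = u %[mod h`_(\pi(N))] & k = v %[mod h`_(\pi(N)^')]].
Proof.
move=> N0 h0 Nh uN vh; set P := h`_(\pi(N)); set Q := h`_(\pi(N)^').
have cPQ : coprime P Q by apply: coprime_partC.
have [e1 e2] := (chinese_modl cPQ u v, chinese_modr cPQ u v).
exists (chinese P Q u v); split=> //.
rewrite -(partnC (\pi(N)) h0) -/P -/Q coprimeMr -coprime_modl e1 coprime_modl.
rewrite -[coprime _ Q]coprime_modl e2 coprime_modl vh andbT.
apply: coprime_primes => p pr pu pP.
have /pnatP/(_ p pr pP) : \pi(N).-nat P by exact: part_pnat.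
rewrite part_gt0 mem_primes pr N0 => /(_ isT)/= pN.
have : p %| gcdn u N by rewrite dvdn_gcd pu.
by rewrite (eqP uN) dvdn1 => /eqP p1; rewrite p1 in pr.
Qed.

Lemma dvdn_part_pi N h : 0 < N -> 0 < h -> N %| h -> N %| h`_(\pi(N)).
Proof.
move=> N0 h0 Nh; rewrite -{1}(part_pnat_id (pnat_pi N0)).
by apply: partn_dvd.
Qed.

Section Vertex.
Variables N L A : nat.
Hypotheses (N3 : 2 < N) (L0 : 0 < L) (A0 : 0 < A) (AN : A < N * L).
(* Angles are measured in units of [pi / (2 N L)], so that [h] is a right angle.
   [A] is an acute angle of the tile; [m] is the excess of the number of these
   angles over the number of complementary ones at the vertex, and [s] counts
   the right angles that the other angles form there. *)
Variables m s : nat.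
Hypothesis m0 : 0 < m.
Local Notation h := (N * L).
Local Notation res k := ((k * A) %% h.*2).
Hypothesis eqn : forall k, odd k -> coprime k h.*2 -> 0 < k %% N -> 2 * (k %% N) < N ->
  0 < res k /\ m * res k + s * h + 4 * L * (k %% N) = 2 * h.

Let N0 : 0 < N. Proof. exact: ltn_trans N3. Qed.
Let h0 : 0 < h.*2. Proof. by rewrite double_gt0 muln_gt0 N0. Qed.
Let Nh : N %| h.*2. Proof. by rewrite -muln2 -mulnA dvdn_mulr. Qed.

Lemma odd_coprime k : coprime k h.*2 -> odd k.
Proof. by move=> kh; rewrite -coprimen2; apply: coprime_dvdr kh; rewrite -muln2 dvdn_mull. Qed.

Lemma A_small : A < h.*2.
Proof. by apply: leq_trans AN _; rewrite -addnn leq_addr. Qed.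

Lemma equation_at1 : m * A + s * h + 4 * L = 2 * h.
Proof.
have E1 : 1 %% N = 1 by rewrite modn_small // ltnW.
have := @eqn 1 isT (coprime1n _); rewrite E1 mul1n (modn_small A_small) muln1.
by move=> /(_ isT N3)[_]; rewrite muln1.
Qed.

Lemma res_unit k u : coprime k h.*2 -> k = u %[mod N] -> 0 < u -> 2 * u < N ->
  m * res k + s * h + 4 * L * u = 2 * h /\ 0 < res k.
Proof.
move=> kh ku u0 uN; have uN' : u < N by apply: leq_ltn_trans uN; rewrite leq_pmull.
rewrite (modn_small uN') in ku.
by have := @eqn k (odd_coprime kh) kh; rewrite ku => /(_ u0 uN) [? ?].
Qed.

Lemma lift_unit u : coprime u N -> 0 < u -> 2 * u < N ->
  exists k, k = u %[mod N] /\ m * res k + s * h + 4 * L * u = 2 * h /\ 0 < res k.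
Proof.
move=> uN u0 u2; have [k [kh k1 _]] := coprime_lift N0 h0 Nh uN (coprime1n _).
exists k; have kN : k = u %[mod N].
  have NP := dvdn_part_pi N0 h0 Nh.
  by rewrite -(modn_dvdm k NP) k1 modn_dvdm.
by split=> //; apply: res_unit.
Qed.

(** Units congruent to [1] modulo [N] give the same equation and hence fix the
    angle, so that it is a multiple of [pi / (2 N)], and of [pi / N] for even [N]. The
    unit used here is as far from [1] as possible: it is [-1] on the part of
    [2 h] that is prime to [N]. *)
Lemma A_dvd : (if odd N then L else 2 * L) %| A.
Proof.
set P := (h.*2)`_(\pi(N)); set Q := (h.*2)`_(\pi(N)^').
have PQ : P * Q = h.*2 by apply: partnC.
have cPQ : coprime P Q by apply: coprime_partC.
have Q0 : 0 < Q by apply: part_gt0.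
have NP : N %| P := dvdn_part_pi N0 h0 Nh.
have uN : coprime N.+1 N by exact: coprimeSn.
have vQ : coprime (Q - 1) Q.
  by rewrite subn1; case: (Q) Q0 => // q _; rewrite /= coprimenS.
have [k [kh k1 k2]] := coprime_lift N0 h0 Nh uN vQ.
rewrite -/P -/Q in k1 k2.
have kN : k = 1 %[mod N].
  by rewrite -(modn_dvdm k NP) k1 modn_dvdm // -[N.+1]addn1 modnDl.
have [|e _] := @res_unit k 1 kh kN isT; first by lia.
have resA : res k = A.
  have := equation_at1; rewrite muln1 in e => e1.
  have : m * res k = m * A.
    by apply: (@addIn (s * h + 4 * L)); rewrite !(addnA _ (s * h)) e e1.
  move/eqP; by rewrite eqn_pmul2l // => /eqP.
have kA : k * A = A %[mod h.*2] by rewrite resA (modn_small A_small).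
have dP : P %| N * A.
  have : k * A = A %[mod P] by rewrite -(modn_dvdm (k * A) (dvdn_mulr Q (dvdnn P))) PQ kA -PQ modn_dvdm // dvdn_mulr.
  rewrite -modnMml k1 modnMml mulSn => /eqP.
  by rewrite -[X in _ == X %[mod _]]addn0 eqn_modDl mod0n.
have dQ : Q %| 2 * A.
  have e1 : k * A = A %[mod Q].
    by rewrite -(modn_dvdm (k * A) (dvdn_mull P (dvdnn Q))) PQ kA -PQ modn_dvdm // dvdn_mull.
  have : (Q - 1) * A = A %[mod Q] by rewrite -modnMml -k2 modnMml.
  move=> /eqP; rewrite -(eqn_modDr A) -{2}[A]mul1n -mulnDl subnK // modnMr eq_sym addnn -mul2n.
  by [].
have hN : 2 * h %| 2 * (N * A).
  rewrite mul2n -PQ Gauss_dvd // dvdn_mull //= mulnCA dvdn_mull //.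
have LA : L %| A.
  by move: hN; rewrite dvdn_pmul2l // dvdn_pmul2l.
case: ifP => // /negbT evN.
have oQ : odd Q.
  have : \pi(N)^'.-nat Q by apply: part_pnat.
  move=> /pnatP => /(_ Q0) H.
  apply: contraT => evQ; have := H 2 isT; rewrite dvdn2 evQ => /(_ isT).
  by rewrite inE /= mem_primes N0 dvdn2 evN.
have dQ' : Q %| A by move: dQ; rewrite Gauss_dvdr // coprime_sym coprime2n.
have : 2 * h %| N * A by rewrite mul2n -PQ Gauss_dvd // dP dvdn_mull.
by rewrite mulnCA dvdn_pmul2l.
Qed.

Lemma dvd_res k : (if odd N then L else 2 * L) %| res k.
Proof.
have dh : (if odd N then L else 2 * L) %| h.*2.
  by rewrite -mul2n; case: ifP => _; [rewrite mulnA dvdn_mull|rewrite mulnCA dvdn_mull].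
by rewrite /dvdn modn_dvdm // -/(dvdn _ _) dvdn_mull // A_dvd.
Qed.

End Vertex.

Lemma cancel_L L N m s j u : 0 < L ->
  m * (j * L) + s * (N * L) + 4 * L * u = 2 * (N * L) -> m * j + s * N + 4 * u = 2 * N.
Proof.
move=> L0 e; apply/eqP; rewrite -(eqn_pmul2r L0); apply/eqP.
by rewrite -[RHS]mulnA -e !mulnDl; lia.
Qed.

Lemma mul_eq2 m j : m * j = 2 -> m = 1 \/ m = 2.
Proof.
case: m => [|[|[|m]]] //; [by left|by right|].
by case: j => [|j]; rewrite ?muln0 // mulnS; lia.
Qed.

Lemma mul_eq4 m j : m * j = 4 -> [\/ m = 1, m = 2 | m = 4 /\ j = 1].
Proof.
case: m => [|[|[|[|[|m]]]]] //; [by constructor 1|by constructor 2|lia| |].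
  by constructor 3; split=> //; lia.
by case: j => [|j]; rewrite ?muln0 // mulnS; lia.
Qed.

Lemma coprime_half n : coprime n n.*2.+1.
Proof. by rewrite -addnn -addSn /coprime gcdnDr -/(coprime _ _) coprimenS. Qed.

(** The equation is used for the unit [u] modulo [N] that is nearest to [N / 2].
    The angle left at the vertex, [2 L], [4 L] or [8 L], is then so small that the
    divisibility of [A_dvd] leaves hardly any choice for [m] and [s]: [m = 2]
    gives the complement of [pi / N], and the other solutions occur for [N = 3]
    and [N = 6] and give [pi / N] itself. *)
Lemma vertex_equation N L A m s : 2 < N -> N <> 4 -> 0 < L -> 0 < A -> A < N * L -> 0 < m ->
  (forall k, odd k -> coprime k (N * L).*2 -> 0 < k %% N -> 2 * (k %% N) < N ->
    0 < (k * A) %% (N * L).*2 /\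
    m * ((k * A) %% (N * L).*2) + s * (N * L) + 4 * L * (k %% N) = 2 * (N * L)) ->
  A = 2 * L \/ A + 2 * L = N * L.
Proof.
move=> N3 N4 L0 A0 AN m0 eqn.
have e1 := equation_at1 N3 AN eqn; have dA := A_dvd N3 L0 A0 AN m0 eqn.
have dres := dvd_res N3 L0 A0 AN m0 eqn; have lift := lift_unit N3 L0 eqn.
have [oN|eN] := boolP (odd N).
  rewrite oN in dA dres; have NE : N = N./2.*2.+1 by rewrite -{1}(odd_double_half N) oN.
  (* [N / 2 - 1 / 2] is a unit. *)
  have [|||k [_ [ek rk]]] := lift N./2; first by rewrite {2}NE coprime_half.
  - by move: N3 NE; clear; lia.
  - by move: NE; clear; lia.
  have /dvdnP[j ej] := dres k; rewrite ej in ek rk.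
  have := cancel_L L0 ek => e.
  have j0 : 0 < j by move: rk; rewrite muln_gt0 => /andP[].
  have s0 : s = 0 by move: m0 j0 e N3 NE; clear; nia.
  have [m1|m2] : m = 1 \/ m = 2 by apply: (@mul_eq2 m j); move: e s0 NE; clear; nia.
    have N4' : N < 4 by rewrite -(ltn_pmul2r L0); move: e1 AN s0 m1; clear; nia.
    have NE3 : N = 3 by move: N3 N4'; clear; lia.
    by left; move: e1; rewrite s0 m1 NE3; clear; lia.
  by right; move: e1 s0 m2; clear; nia.
rewrite (negPf eN) in dA dres.
have [q Nq] : exists q, N = q.*2 by exists N./2; rewrite -{1}(odd_double_half N) (negPf eN).
have N4' : 3 < N by case: (q) Nq N3 => [|[|q']] -> // _; rewrite doubleS.
have m1F : s = 0 -> m = 1 -> False.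
  have : 4 * L <= N * L by rewrite leq_mul2r N4' orbT.
  by move=> h s0 m1; move: e1 AN h; rewrite s0 m1; clear; lia.
have step u : coprime u N -> 0 < u -> 2 * u < N -> exists k j,
    [/\ k = u %[mod N], 0 < j, (k * A) %% (N * L).*2 = j * (2 * L)
      & m * (j * 2) + s * N + 4 * u = 2 * N].
  move=> cu u0 uN; have [k [kN [ek rk]]] := lift u cu u0 uN.
  have /dvdnP[j ej] := dres k; exists k, j; rewrite ej in ek rk *.
  split=> //; first by move: rk; rewrite muln_gt0 => /andP[].
  by apply: (cancel_L L0); rewrite -mulnA.
have [oq|eq] := boolP (odd q); last first.
  (* [N] is divisible by [4] and [N / 2 - 1] is a unit. *)
  have [u qu] : exists u, q = u.+1 by case: (q) Nq N3 => [->//|u]; exists u.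
  have ou : odd u by move: eq; rewrite qu /= negbK.
  have [|||k [j [_ j0 _ e]]] := step u; rewrite ?Nq ?qu.
  - by rewrite -muln2 coprimeMr coprimenS coprimen2.
  - by case: (u) ou.
  - by clear; lia.
  rewrite Nq qu in e.
  have u2 : 2 < u by move: N3 N4 ou; rewrite Nq qu; case: (u) => [|[|[|]]].
  have s0 : s = 0 by move: m0 j0 e u2; clear; nia.
  have [/(m1F s0)//|m2] : m = 1 \/ m = 2 by apply: (@mul_eq2 m j); move: e s0; clear; nia.
  by right; move: e1; rewrite Nq qu s0 m2; clear; lia.
(* [N] is [2] modulo [4] and [N / 2 - 2] is a unit. *)
have [u qu] : exists u, q = u.+2 by case: (q) Nq N3 oq => [->//|[|u]]//; [move=> ->|exists u].
have ou : odd u by move: oq; rewrite qu /= negbK.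
have cop v : odd v -> coprime v v.+2.*2.
  move=> ov; rewrite -muln2 coprimeMr coprimen2 ov andbT -addn2 /coprime gcdnDl.
  by rewrite -/(coprime _ _) coprimen2.
have [|||k [j [kN j_gt0 kA e]]] := step u; rewrite ?Nq ?qu.
- exact: cop.
- by case: (u) ou.
- by clear; lia.
rewrite Nq qu in e.
have {}e : 2 * (m * j) + s * u.+2.*2 = 8 by move: e; clear; nia.
have [s0|s_gt0] := posnP s; last first.
  have u1 : u = 1 by move: e s_gt0 m0 j_gt0 ou; case: (u) => [|[|[|v]]] //; clear; nia.
  have s1 : s = 1 by move: e s_gt0 m0 j_gt0; rewrite u1; clear; nia.
  have m1 : m = 1 by move: e m0 j_gt0; rewrite u1 s1; case: (m) (j) => [|[|m']] // [|j'] //; clear; nia.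
  by left; move: e1; rewrite Nq qu s1 m1 u1; clear; lia.
have [/(m1F s0)//|m2|[m4 j1]] : [\/ m = 1, m = 2 | m = 4 /\ j = 1].
- by apply: mul_eq4; move: e; rewrite s0; clear; lia.
- by right; move: e1; rewrite Nq qu s0 m2; clear; lia.
have A4 : A = u.+1 * L by move: e1; rewrite Nq qu s0 m4; clear; lia.
have [u1|u1] := eqVneq u 1; first by left; rewrite A4 u1.
(* For [m = 4] and [N > 6] the next unit [N / 2 - 4] contradicts [N / 2 - 2]: their
   multiples of [A] would be one and two steps of [2 L], while the difference of
   these multiples is twice [A]. *)
exfalso.
have [v uv] : exists v, u = v.+2 by case: (u) ou u1 => [|[|v]] // _ _; exists v.
have ov : odd v by move: ou; rewrite uv /= negbK.
have vN : coprime v v.+4.*2.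
  rewrite -muln2 coprimeMr coprimen2 ov andbT -addn4 /coprime gcdnDl.
  by rewrite -/(coprime _ _) (@coprimeXr 2 v 2) // coprimen2.
have [|||k' [j' [kN' j_gt0' kA' e']]] := step v; rewrite ?Nq ?qu ?uv.
- exact: vN.
- by case: (v) ov.
- by clear; lia.
rewrite Nq qu uv s0 m4 in e'.
have {e'} j2 : j' = 2 by move: e'; clear; lia.
have odd_half : v.+3 = 2 * v.+3./2 by rewrite mul2n -{1}(odd_double_half v.+3) /= negbK ov.
set w := v.+3./2 in odd_half.
have AE : A = w * (2 * L) by rewrite A4 uv odd_half; clear; lia.
have red x : (x * A) %% (N * L).*2 = (x * w) %% N * (2 * L).
  by rewrite AE mulnA muln_modl; congr (_ %% _); clear; lia.
have L20 : 0 < 2 * L by rewrite muln_gt0.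
move: kA kA'; rewrite !red j1 j2 => /eqP; rewrite eqn_pmul2r // => /eqP r1 /eqP.
rewrite eqn_pmul2r // => /eqP r2.
have NE : N = v.+4.*2 by rewrite Nq qu uv.
have r1' : (v.+2 * w) %% N = 1 by rewrite -r1 -modnMml -[RHS]modnMml kN uv.
have r2' : (v * w) %% N = 2 by rewrite -r2 -modnMml -[RHS]modnMml kN'.
have : (v.+2 * w) %% N = v.+3 + 2.
  have -> : v.+2 * w = v.+3 + v * w by rewrite odd_half; clear; lia.
  by rewrite -modnDmr r2' modn_small // NE; clear; lia.
by rewrite r1' addn2.
Qed.

End Arithmetic.

(** * The angle of the tile *)

Section UniqueSlope.
Variable R : realType.

Lemma tanDnpi (x : R) n : tan (x + n%:R * pi) = tan x.
Proof. by rewrite /tan sinDnpi cosDnpi -mulf_div divff ?mul1r // signr_eq0. Qed.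

Lemma atan_frac_pi k h : (0 < h)%N -> 0 < tan (k%:R * (pi / h.*2%:R) : R) ->
  (0 < k %% h.*2 < h)%N /\
  atan (tan (k%:R * (pi / h.*2%:R))) = (k %% h.*2)%:R * (pi / h.*2%:R) :> R.
Proof.
move=> h0; have M0 : (0 < h.*2)%N by rewrite double_gt0.
rewrite frac_pi // tanDnpi; set n := (k %% h.*2)%N; set t := pi / _ => tp.
have pi0 := pi_gt0 R.
have t0 : 0 < t by rewrite divr_gt0 // ltr0n.
have nM : (n < h.*2)%N by rewrite ltn_pmod.
have hE : h%:R * t = pi / 2 by rewrite /t -muln2 natrM; field; rewrite pnatr_eq0 -lt0n.
have n0 : (0 < n)%N.
  by rewrite lt0n; apply: contraTneq tp => ->; rewrite mul0r tan0 ltxx.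
have nh : (n < h)%N.
  rewrite ltnNge; apply/negP => hn; move: tp; apply/negP; rewrite -leNgt.
  have y1 : pi / 2 <= n%:R * t by rewrite -hE ler_pM2r // ler_nat.
  have y2 : n%:R * t < pi.
    have -> : pi = (h.*2)%:R * t by rewrite -muln2 natrM; lra.
    by rewrite ltr_pM2r // ltr_nat.
  have s0 : 0 <= sin (n%:R * t) by apply: sin_ge0_pi; apply/andP; split; lra.
  have c0 : cos (n%:R * t) <= 0.
    have -> : cos (n%:R * t) = - sin (n%:R * t - pi / 2) by rewrite sinBpihalf opprK.
    by rewrite oppr_le0; apply: sin_ge0_pi; apply/andP; split; lra.
  by rewrite /tan mulr_ge0_le0 // invr_le0.
split; first by rewrite n0 nh.
rewrite tanK // in_itv /= -hE ltr_pM2r // ltr_nat nh andbT.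
by apply: (@lt_trans _ _ 0); rewrite ?oppr_lt0 mulr_gt0 // ltr0n.
Qed.

(** If both acute angles were equally frequent at a vertex of the polygon, they
    would form right angles there, and [pi - 2 pi / N] would be a multiple of
    [pi / 2]: this happens for [N = 4] only. Otherwise the angle sum at the vertex
    determines the angle. *)
Lemma slope_rational N x (s : seq (item R)) : (2 < N)%N -> N <> 4%N -> 0 < x ->
  all (@nondeg R) s -> same_cover (map (tile x) s) (std_tiles R N) ->
  exists L A : nat, [/\ (0 < L)%N, (0 < A < N * L)%N & x = tan (A%:R * (pi / (N * L).*2%:R))].
Proof.
move=> N2 N4 x0 sn cov.
have [a [b [r E]]] := plain_vertex_angles N2 x0 sn cov.
have [a1 a2 _ _] := atanP x; have a0 : 0 < atan x by rewrite -atan0 lt_atan.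
set al := atan x in E a1 a2 a0.
have pi0 := pi_gt0 R.
have N0 : (0 < N)%N := ltn_trans (isT : 0 < 2)%N N2.
have NR : 0 < N%:R :> R by rewrite ltr0n.
pose u : R := pi / (2 * N%:R).
have u0 : 0 < u by rewrite divr_gt0 // mulr_gt0.
have E1 : pi - 2 * (pi / N%:R) = (2 * N%:R - 4) * u :> R.
  by rewrite /u; field; rewrite gt_eqF.
have E2 : pi / 2 = N%:R * u by rewrite /u; field; rewrite gt_eqF.
have fin (L A : nat) : (0 < L)%N -> L%:R * al = A%:R * u -> 
    exists L A : nat, [/\ (0 < L)%N, (0 < A < N * L)%N & x = tan (A%:R * (pi / (N * L).*2%:R))].
  move=> L0 LA; exists L, A; have LR : 0 < L%:R :> R by rewrite ltr0n.
  have alE : al = A%:R * (pi / (N * L).*2%:R).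
    apply: (mulfI (lt0r_neq0 LR)); rewrite LA /u -muln2 !natrM; field.
    by rewrite !gt_eqF.
  split=> //; last by rewrite -alE atanK.
  apply/andP; split.
    by rewrite -(@ltr0n R) -(pmulr_lgt0 _ u0) -LA mulr_gt0.
  rewrite -(@ltr_nat R) -(ltr_pM2r u0) -LA natrM mulrAC -E2 mulrC ltr_pM2r //.
rewrite E1 E2 in E.
have [ab|ab|ab] := ltngtP a b.
- apply: (fin (b - a)%N ((b + r) * N + 4 - 2 * N)%N); rewrite ?subn_gt0 //.
  rewrite natrB ?(ltnW ab) //.
  have E3 : (b%:R - a%:R) * al = ((b%:R + r%:R) * N%:R + 4 - 2 * N%:R) * u.
    by move: E; set bb := b%:R; set aa := a%:R; nra.
  have cE : ((b + r) * N + 4)%:R = (b%:R + r%:R) * N%:R + 4 :> R.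
    by rewrite natrD natrM (natrD _ b).
  have c2 : (2 * N)%:R = 2 * N%:R :> R by rewrite natrM.
  rewrite E3 natrB ?cE ?c2 //.
  rewrite -(@ler_nat R) cE c2 -subr_ge0 ltW //.
  rewrite -(pmulr_lgt0 _ u0) -E3 mulr_gt0 // subr_gt0 ltr_nat //.
- apply: (fin (a - b)%N (2 * N - ((b + r) * N + 4))%N); rewrite ?subn_gt0 //.
  rewrite natrB ?(ltnW ab) //.
  have E3 : (a%:R - b%:R) * al = (2 * N%:R - ((b%:R + r%:R) * N%:R + 4)) * u.
    by move: E; nra.
  have cE : ((b + r) * N + 4)%:R = (b%:R + r%:R) * N%:R + 4 :> R.
    by rewrite natrD natrM (natrD _ b).
  have c2 : (2 * N)%:R = 2 * N%:R :> R by rewrite natrM.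
  rewrite E3 natrB ?cE ?c2 //.
  rewrite -(@ler_nat R) cE c2 -subr_ge0 ltW //.
  rewrite -(pmulr_lgt0 _ u0) -E3 mulr_gt0 // subr_gt0 ltr_nat //.
exfalso; have E3 : (2 * N)%:R = (((b + r) * N + 4)%N)%:R :> R.
  apply: (mulIf (lt0r_neq0 u0)); rewrite natrD (natrM _ 2) (natrM _ (b + r)) (natrD _ b).
  by move: E; rewrite ab; nra.
move/eqP: E3; rewrite eqr_nat => /eqP; move: N2 N4; clear.
case: (b + r)%N => [|[|c]]; lia.
Qed.

(** The angle sums of all conjugates are turned into equations between natural
    numbers by measuring angles in units of [pi / (2 N L)]. Exchanging the two
    acute angles, one may assume that the first one is the more frequent. *)
Lemma unique_slope N x (s : seq (item R)) : (2 < N)%N -> N <> 4%N -> 0 < x ->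
  all (@nondeg R) s -> same_cover (map (tile x) s) (std_tiles R N) ->
  x = tan (pi / N%:R) \/ x^-1 = tan (pi / N%:R).
Proof.
move=> N2 N4 x0 sn cov.
have [L [A [L0 Ah xE]]] := slope_rational N2 N4 x0 sn cov.
rewrite xE in cov.
have [a [b [r H]]] := conj_vertex_angles N2 Ah sn cov.
have pi0 := pi_gt0 R.
have N0 : (0 < N)%N := ltn_trans (isT : 0 < 2)%N N2.
have h0 : (0 < N * L)%N by rewrite muln_gt0 N0.
have M0 : (0 < (N * L).*2)%N by rewrite double_gt0.
set h := (N * L)%N in Ah H h0 M0 xE *; set t := pi / _ in H xE *.
have t0 : 0 < t by rewrite divr_gt0 // ltr0n.
have hE : pi / 2 = h%:R * t :> R by rewrite /t -muln2 natrM; field; rewrite pnatr_eq0 -lt0n.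
have NE : pi / N%:R = (2 * L)%:R * t :> R.
  rewrite /t /h -muln2 !natrM; field; by rewrite !pnatr_eq0 -!lt0n N0 L0.
have eqn k : odd k -> coprime k h.*2 -> (0 < k %% N)%N -> (2 * (k %% N) < N)%N ->
    (0 < (k * A) %% h.*2 < h)%N /\
    (a * ((k * A) %% h.*2) + b * (h - (k * A) %% h.*2) + r * h + 4 * L * (k %% N) = 2 * h)%N.
  move=> ok kh k0 k2.
  have kh' : coprime k h.*2.*2 by rewrite -muln2 coprimeMr kh coprimen2.
  have [tp E] := H k ok kh' k0 k2.
  have [rh aE] := atan_frac_pi h0 tp; split=> //.
  rewrite -/t in aE; rewrite aE NE hE in E.
  apply/eqP; rewrite -(eqr_nat R); apply/eqP; apply: (mulIf (lt0r_neq0 t0)).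
  move: rh E; set w := (_ %% h.*2)%N; set v := (k %% N)%N => /andP[_ wh] E.
  have -> : (2 * h)%:R * t = pi by rewrite natrM; lra.
  have -> : (a * w + b * (h - w) + r * h + 4 * L * v)%:R =
     a%:R * w%:R + b%:R * (h%:R - w%:R) + r%:R * h%:R + 4 * L%:R * v%:R :> R.
    by rewrite 3!natrD (natrM _ (4 * L)) (natrM _ 4) (natrM _ a) (natrM _ b) (natrM _ r) natrB // ltnW.
  have piE : pi = 2 * (h%:R * t) :> R by rewrite -hE; field.
  by move: E; rewrite (natrM _ 2) piE; nra.
have rot k : odd k -> ((k * A) %% h.*2 < h)%N ->
    ((k * (h - A)) %% h.*2)%N = (h - (k * A) %% h.*2)%N.
  have /andP[_ /ltnW A1] := Ah => ok.
  move: (divn_eq (k * A) h.*2); set q := (_ %/ _)%N; set w := (_ %% _)%N => kA wh.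
  have hw : (h - w < h.*2)%N by move: h0; clear; lia.
  rewrite -[RHS](modn_small hw) -(modnMDl k./2 (h - w)) -[LHS](modnMDl q); congr (_ %% _)%N.
  have kE : (k * h = k./2 * h.*2 + h)%N.
    by rewrite -{1}(odd_double_half k) ok; clear; lia.
  have kAh : (k * A <= k * h)%N by rewrite leq_mul2l A1 orbT.
  by rewrite mulnBr; move: kA kAh kE wh; clear; lia.
have [A0 A1] := andP Ah.
have A2 : (A < h.*2)%N by apply: leq_trans A1 _; rewrite -addnn leq_addr.
have ab : a <> b.
  move=> ab; have := eqn 1%N isT (coprime1n _); rewrite modn_small ?(ltnW N2) // mul1n.
  rewrite modn_small // ab => /(_ isT)[|_]; first by rewrite muln1.
  have -> : (b * A + b * (h - A) = b * h)%N by rewrite -mulnDr subnKC // ltnW.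
  rewrite muln1 -mulnDl => e.
  have : ((b + r) * N + 4 = 2 * N)%N.
    apply/eqP; rewrite -(eqn_pmul2r L0) mulnDl -!mulnA -/h; apply/eqP; exact: e.
  by move: N2 N4; clear; case: (b + r)%N => [|[|c]]; lia.
have concl : A = (2 * L)%N \/ (A + 2 * L)%N = h.
  case: (ltngtP a b) => // {}ab.
    have [||||e|e] := @vertex_equation N L (h - A) (b - a) (a + r) N2 N4 L0.
    - by rewrite subn_gt0.
    - by rewrite ltn_subrL A0.
    - by rewrite subn_gt0.
    - move=> k ok kh k0 k2; have [/andP[w0 wh] e] := eqn k ok kh k0 k2.
      rewrite -/h rot //; split; first by rewrite subn_gt0.
      rewrite -e -(subnK (ltnW ab)); move: wh; clear; set w := (_ %% _)%N; set c := (b - a)%N.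
      by move=> wh; rewrite -(subnK (ltnW wh)) addnK; lia.
    - by right; rewrite -e subnKC // ltnW.
    - by left; move: e A1; rewrite -/h; clear; lia.
  apply: (@vertex_equation N L A (a - b) (b + r)) => //; first by rewrite subn_gt0.
  move=> k ok kh k0 k2; have [/andP[w0 wh] e] := eqn k ok kh k0 k2.
  split=> //; rewrite -e -/h -(subnK (ltnW ab)); move: wh; clear.
  set w := (_ %% _)%N; set c := (a - b)%N.
  by move=> wh; rewrite -(subnK (ltnW wh)) addnK; lia.
rewrite xE; case: concl => AE; first by left; rewrite NE -AE.
right; rewrite NE.
have -> : (2 * L)%:R * t = pi / 2 - A%:R * t by rewrite hE -AE natrD; ring.
by rewrite /tan sinB cosB cos_pihalf sin_pihalf !mul0r !mul1r subr0 add0r invfM invrK mulrC.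
Qed.

End UniqueSlope.

(** * Right-angled regions and their similarity classes *)

Section Regions.
Variable R : realType.
Local Notation plane := (plane R).
Implicit Types (p q u v a b c d y : plane) (x z : R) (S : set plane).

Lemma convexP S : @convex_set R plane S <->
  (forall p q x, 0 <= x -> x <= 1 -> S p -> S q -> S (x *: p + (1 - x) *: q)).
Proof.
split=> [cS p q x x0 x1 Sp Sq|H p q l].
  by have := cS p q (Itv01 x0 x1); rewrite !inE => /(_ Sp Sq).
by rewrite !inE => Sp Sq; apply: H.
Qed.

Definition hull a b c : set plane := convex_hull [set a; b; c].

Lemma hull_sub S a b c : @convex_set R plane S -> S a -> S b -> S c -> hull a b c `<=` S.
Proof. by move=> cS Sa Sb Sc; apply: smallest_sub => // y [[->|->]|->]. Qed.

Lemma convex3 S a b c x1 x2 x3 : @convex_set R plane S -> S a -> S b -> S c ->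
  0 <= x1 -> 0 <= x2 -> 0 <= x3 -> x1 + x2 + x3 = 1 ->
  S (x1 *: a + x2 *: b + x3 *: c).
Proof.
move=> /convexP cS Sa Sb Sc h1 h2 h3 e.
have [e1|n1] := eqVneq x1 1.
  have -> : x2 = 0 by lra.
  have -> : x3 = 0 by lra.
  by rewrite e1 scale1r !scale0r !addr0.
have p1 : 0 < 1 - x1 by rewrite subr_gt0 lt_def eq_sym n1; lra.
have -> : x1 *: a + x2 *: b + x3 *: c = x1 *: a + (1 - x1) *:
    ((x2 / (1 - x1)) *: b + (1 - x2 / (1 - x1)) *: c).
  have -> : x3 = 1 - x1 - x2 by lra.
  by apply: plane_eq; rewrite /= /GRing.scale /=; field; rewrite gt_eqF.
apply: (cS) => //; first lra.
apply: (cS) => //; first by apply: divr_ge0 => //; exact: ltW.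
by rewrite ler_pdivrMr //; lra.
Qed.

Lemma hullP a b c y : hull a b c y <-> exists x1 x2 x3,
  [/\ 0 <= x1, 0 <= x2, 0 <= x3, x1 + x2 + x3 = 1 & y = x1 *: a + x2 *: b + x3 *: c].
Proof.
split=> [|[x1 [x2 [x3 [h1 h2 h3 e ->]]]]]; last first.
  by move=> S [cS sS]; apply: convex3 => //; apply: sS; [left; left|left; right|right].
pose S : set plane := [set y | exists x1 x2 x3,
  [/\ 0 <= x1, 0 <= x2, 0 <= x3, x1 + x2 + x3 = 1 & y = x1 *: a + x2 *: b + x3 *: c]].
apply: (@hull_sub S).
- apply/convexP => _ _ x x0 x1 [a1 [a2 [a3 [h1 h2 h3 e ->]]]] [b1 [b2 [b3 [k1 k2 k3 e' ->]]]].
  have x1' : 0 <= 1 - x by lra.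
  exists (x * a1 + (1 - x) * b1), (x * a2 + (1 - x) * b2), (x * a3 + (1 - x) * b3).
  split; try by rewrite addr_ge0 ?mulr_ge0.
    transitivity (x * (a1 + a2 + a3) + (1 - x) * (b1 + b2 + b3)); first by ring.
    by rewrite e e'; ring.
  by apply: plane_eq; rewrite /= /GRing.scale /=; ring.
- exists 1, 0, 0; rewrite scale1r !scale0r !addr0; by split=> //; ring.
- exists 0, 1, 0; rewrite scale1r !scale0r addr0 add0r; by split=> //; ring.
- exists 0, 0, 1; rewrite scale1r !scale0r !add0r; by split=> //; ring.
Qed.

Lemma set3_rot a b c : [set b; c; a] = [set a; b; c].
Proof. by apply/seteqP; split=> y [[]|]; rewrite /=; tauto. Qed.

Lemma set3_swap a b c : [set a; c; b] = [set a; b; c].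
Proof. by apply/seteqP; split=> y [[]|]; rewrite /=; tauto. Qed.

Lemma hull_perm a b c a' b' c' : [set a; b; c] = [set a'; b'; c'] :> set plane ->
  hull a b c = hull a' b' c'.
Proof. by rewrite /hull => ->. Qed.

Lemma insideE a b c y : inside (a, b, c) y =
  [&& 0 <= side (a, b) y, 0 <= side (b, c) y & 0 <= side (c, a) y].
Proof. by rewrite /inside /= andbT. Qed.

Lemma inside_hull a b c : ccw (a, b, c) -> hull a b c = [set y | inside (a, b, c) y].
Proof.
move=> T; apply/seteqP; split=> y /=.
  move=> /hullP[x1 [x2 [x3 [h1 h2 h3 e ->]]]].
  rewrite insideE /side /=.
  have x1E : x1 = 1 - x2 - x3 by lra.
  apply/and3P; split.
  - have -> : cross (b - a) (x1 *: a + x2 *: b + x3 *: c - a) = x3 * cross (b - a) (c - a).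
      by rewrite x1E /cross /= /GRing.scale /=; ring.
    by rewrite mulr_ge0 // ltW.
  - have -> : cross (c - b) (x1 *: a + x2 *: b + x3 *: c - b) = x1 * cross (b - a) (c - a).
      have -> : x2 = 1 - x1 - x3 by lra.
      by rewrite /cross /= /GRing.scale /=; ring.
    by rewrite mulr_ge0 // ltW.
  have -> : cross (a - c) (x1 *: a + x2 *: b + x3 *: c - c) = x2 * cross (b - a) (c - a).
    by rewrite x1E /cross /= /GRing.scale /=; ring.
  by rewrite mulr_ge0 // ltW.
rewrite insideE /side /= => /and3P[s1 s2 s3].
apply/hullP; set D := cross (b - a) (c - a) in T.
have D0 : 0 < D by [].
exists (cross (c - b) (y - b) / D), (cross (a - c) (y - c) / D), (cross (b - a) (y - a) / D).
split; try by rewrite divr_ge0 // ltW.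
  rewrite -!mulrDl; apply: (mulIf (lt0r_neq0 D0)); rewrite divfK ?gt_eqF // mul1r.
  by rewrite /D /cross /=; ring.
apply: (scalerI (lt0r_neq0 D0)); rewrite !scalerDr !scalerA ![D * (_ / D)]mulrC !divfK ?gt_eqF //.
by apply: plane_eq; rewrite /D /cross /= /GRing.scale /=; ring.
Qed.

Definition sqdist p q := dot (p - q) (p - q).

(** Not being the midpoint of two other points of [S] is expressed by distances
    alone, so that it is visibly preserved by similarities. It recovers the
    vertices of a triangle from its region. *)
Definition extreme S p := S p /\
  forall q r, S q -> S r -> sqdist q p = sqdist p r -> sqdist q r = 4 * sqdist q p -> q = p.

Lemma midpoint_eq p q r : sqdist q p = sqdist p r -> sqdist q r = 4 * sqdist q p ->
  r = p + (p - q).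
Proof.
rewrite /sqdist => e1 e2; apply/eqP; rewrite -subr_eq0 -dot_eq0; apply/eqP.
have -> : dot (r - (p + (p - q))) (r - (p + (p - q))) =
   2 * dot (p - r) (p - r) + 2 * dot (q - p) (q - p) - dot (q - r) (q - r).
  by rewrite /dot /=; ring.
by rewrite e2 -e1; ring.
Qed.

Lemma extreme_hull a b c : ccw (a, b, c) -> extreme (hull a b c) = [set a; b; c].
Proof.
have ext a' b' c' : ccw (a', b', c') -> extreme (hull a' b' c') a'.
  move=> T; rewrite /extreme inside_hull //; split.
    rewrite /= insideE /side; apply/and3P; split; move: T; rewrite /ccw /cross /=; lra.
  move=> q r Sq Sr e1 e2; have rE := midpoint_eq e1 e2.
  move: Sq Sr; rewrite rE /= !insideE => /and3P[q1 q2 q3] /and3P[r1 r2 r3].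
  apply/esym/eqP; rewrite -(vertexE q T).
  have z1 : side (a', b') q = 0.
    by move: q1 r1; rewrite /side /cross /=; lra.
  have z3 : side (c', a') q = 0.
    by move: q3 r3; rewrite /side /cross /=; lra.
  rewrite z1 z3 eqxx !andbT /=; move: T z1 z3; rewrite /ccw /side /cross /=; lra.
move=> T.
have T2 : ccw (b, c, a) by move: T; rewrite /= /cross /=; lra.
have T3 : ccw (c, a, b) by move: T; rewrite /= /cross /=; lra.
apply/seteqP; split=> p; last first.
  case=> [[->|->]|->]; first exact: ext.
    by rewrite -(hull_perm (set3_rot a b c)); exact: ext.
  by rewrite (hull_perm (set3_rot c a b)); exact: ext.
have move_ext a' b' c' x1 x2 x3 : 0 < x1 -> 0 < x2 -> 0 <= x3 -> x1 + x2 + x3 = 1 ->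
    extreme (hull a' b' c') (x1 *: a' + x2 *: b' + x3 *: c') -> a' = b'.
  move=> h1 h2 h3 e [_ H]; pose z := Num.min x1 x2.
  have z0 : 0 < z by rewrite /z lt_min h1.
  have z1 : z <= x1 by rewrite /z ge_min lexx.
  have z2 : z <= x2 by rewrite /z ge_min lexx orbT.
  set y := _ + _ in H.
  have S1 : hull a' b' c' (y + z *: (a' - b')).
    apply/hullP; exists (x1 + z), (x2 - z), x3; split; [lra|lra|lra|lra|].
    by apply: plane_eq; rewrite /y /= /GRing.scale /=; ring.
  have S2 : hull a' b' c' (y - z *: (a' - b')).
    apply/hullP; exists (x1 - z), (x2 + z), x3; split; [lra|lra|lra|lra|].
    by apply: plane_eq; rewrite /y /= /GRing.scale /=; ring.
  have /eqP : y + z *: (a' - b') = y.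
    by apply: (H _ _ S1 S2); rewrite /sqdist /dot /= /GRing.scale /=; ring.
  rewrite -subr_eq0 addrC addrA addNr add0r scaler_eq0 gt_eqF //= subr_eq0.
  by move/eqP.
have ab : a <> b by move=> e; move: T; rewrite e /ccw /cross /=; lra.
have bc : b <> c by move=> e; move: T; rewrite e /ccw /cross /=; lra.
have ca : c <> a by move=> e; move: T; rewrite e /ccw /cross /=; lra.
move=> Ep; have [/hullP[x1 [x2 [x3 [h1 h2 h3 e pE]]]] _] := Ep.
have E2 : extreme (hull b c a) p.
  by rewrite (hull_perm (set3_rot a b c)).
have E3 : extreme (hull c a b) p.
  by rewrite -(hull_perm (set3_rot c a b)).
have [z1|n1] := eqVneq x1 0.
  have [z2|n2] := eqVneq x2 0.
    have z3 : x3 = 1 by lra.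
    by right; rewrite pE z1 z2 z3 !scale0r scale1r !add0r.
  have [z3|n3] := eqVneq x3 0.
    have z2 : x2 = 1 by lra.
    by left; right; rewrite pE z1 z2 z3 !scale0r scale1r add0r addr0.
  case: bc; apply: (move_ext b c a x2 x3 x1); rewrite ?lt_def ?n2 ?n3 //; first by lra.
  by have -> : x2 *: b + x3 *: c + x1 *: a = p by rewrite pE addrC addrA.
have [z2|n2] := eqVneq x2 0.
  have [z3|n3] := eqVneq x3 0.
    have z1 : x1 = 1 by lra.
    by left; left; rewrite pE z1 z2 z3 !scale0r scale1r !addr0.
  case: ca; apply: (move_ext c a b x3 x1 x2); rewrite ?lt_def ?n1 ?n3 //; first by lra.
  by have -> : x3 *: c + x1 *: a + x2 *: b = p by rewrite pE -addrA addrC.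
by case: ab; apply: (move_ext a b c x1 x2 x3); rewrite ?lt_def ?n1 ?n2 // -pE.
Qed.

Lemma similarity_sqdist (f : plane -> plane) : similarity f -> exists2 k : R, 0 < k &
  forall p q, sqdist (f p) (f q) = k ^+ 2 * sqdist p q.
Proof.
case=> k k0 H; exists k => // p q; have := congr1 (fun x => x ^+ 2) (H p q).
by rewrite /= exprMn /euclid_dist !sqr_sqrtr ?dot_ge0.
Qed.

Lemma sqdist_similarity (f : plane -> plane) (k : R) : 0 < k ->
  (forall p q, sqdist (f p) (f q) = k ^+ 2 * sqdist p q) -> similarity f.
Proof.
move=> k0 H; exists k => // p q; rewrite /euclid_dist -/(sqdist _ _) H.
by rewrite sqrtrM ?sqr_ge0 // sqrtr_sqr gtr0_norm.
Qed.

Lemma sqdist_eq0 p q : (sqdist p q == 0) = (p == q).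
Proof. by rewrite /sqdist dot_eq0 subr_eq0. Qed.

Lemma similarity_inj (f : plane -> plane) : similarity f -> injective f.
Proof.
move=> /similarity_sqdist[k k0 H] p q e; apply/eqP; rewrite -sqdist_eq0.
have := H p q; rewrite e /sqdist subrr => /esym/eqP.
have -> : dot 0 0 = 0 :> R by rewrite /dot /=; ring.
by rewrite mulf_eq0 expf_eq0 gt_eqF.
Qed.

Lemma extreme_similarity (f : plane -> plane) S : similarity f -> extreme (f @` S) = f @` extreme S.
Proof.
move=> sf; have inj := similarity_inj sf; have [k k0 H] := similarity_sqdist sf.
have k2 : k ^+ 2 != 0 by rewrite expf_eq0 gt_eqF.
apply/seteqP; split=> y.
  case=> -[p Sp <-] E; exists p => //; split=> // q r Sq Sr e1 e2; apply: inj; apply: (E _ (f r)).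
  - by exists q.
  - by exists r.
  - by rewrite !H e1.
  - by rewrite !H e2; ring.
case=> p [Sp E] <-; split; first by exists p.
move=> _ _ [q Sq <-] [r Sr <-]; rewrite !H => e1 e2; congr f; apply: (E _ r) => //.
  exact: (mulfI k2).
by apply: (mulfI k2); rewrite e2; ring.
Qed.

(** One of the acute angles is [atan x]; which one is left open. *)
Definition right_region x S := exists2 i : item R, nondeg i & S = [set y | inside (tile x i) y].

Lemma right_regionV x S : right_region x S -> right_region x^-1 S.
Proof.
move=> [[[C P] b] nd ->]; exists (C, P, ~~ b) => //=.
by case: (b); rewrite /= ?invrK.
Qed.

Lemma right_region_hull x (C P : plane) (b : bool) : 0 < x -> C != P ->
  [set y | inside (tile x (C, P, b)) y] = hull C P (C + slope b x *: perp (P - C)).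
Proof.
by move=> x0 CP; rewrite inside_hull //; apply: leg_tile_ccw; rewrite ?slope_gt0.
Qed.

Lemma perp_parallel u v : u != 0 -> dot v u = 0 -> v = (cross u v / dot u u) *: perp u.
Proof.
move=> u0 e; have d0 : dot u u != 0 by rewrite dot_eq0.
apply: (scalerI d0); rewrite scalerA [dot u u * _]mulrC divfK //.
apply: plane_eq; rewrite /= /GRing.scale /=.
  have -> : dot u u * v.1 = cross u v * - u.2 + u.1 * dot v u by rewrite /dot /cross; ring.
  by rewrite e mulr0 addr0.
have -> : dot u u * v.2 = cross u v * u.1 + u.2 * dot v u by rewrite /dot /cross; ring.
by rewrite e mulr0 addr0.
Qed.

(** The two orientations of the triangle correspond to the two values of the
    boolean of an item. *)
Lemma right_region_legs x (C P Q : plane) : 0 < x -> C != P -> dot (Q - C) (P - C) = 0 ->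
  sqdist Q C = x ^+ 2 * sqdist P C -> right_region x (hull C P Q).
Proof.
move=> x0 CP e1; rewrite /sqdist; set v := Q - C in e1 *; set u := P - C in e1 *.
have u0 : u != 0 by rewrite subr_eq0 eq_sym.
have dd : 0 < dot u u by rewrite dot_gt0.
have vE := perp_parallel u0 e1; set z := _ / _ in vE => e2.
have z2 : z ^+ 2 = x ^+ 2.
  apply: (mulIf (lt0r_neq0 dd)); rewrite -e2 vE /dot /perp /= /GRing.scale /=; ring.
have : (z == x) || (z == - x) by rewrite -eqf_sqr z2.
have QE : Q = C + v by rewrite /v addrC subrK.
case/orP=> /eqP zE; rewrite zE in vE.
  by exists (C, P, true) => //; rewrite right_region_hull // QE vE.
exists (C, Q, false).
  by rewrite /= eq_sym -subr_eq0 -/v vE scaler_eq0 negb_or oppr_eq0 gt_eqF //= perp_neq0.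
rewrite right_region_hull //; last first.
  by rewrite eq_sym -subr_eq0 -/v vE scaler_eq0 negb_or oppr_eq0 gt_eqF //= perp_neq0.
rewrite /= -/v (_ : C + x^-1 *: perp v = P).
  exact: hull_perm (set3_swap _ _ _).
rewrite vE (_ : x^-1 *: perp (- x *: perp u) = u); first by rewrite /u addrC subrK.
by apply: plane_eq; rewrite /perp /= /GRing.scale /=; field; rewrite gt_eqF.
Qed.

Lemma right_angle_region (C P Q : plane) : cross (P - C) (Q - C) != 0 ->
  dot (Q - C) (P - C) = 0 -> exists2 x, 0 < x & right_region x (hull C P Q).
Proof.
move=> c0 d0.
have u0 : P - C != 0 by apply: contra_neq c0 => ->; rewrite /cross /=; ring.
have v0 : Q - C != 0 by apply: contra_neq c0 => ->; rewrite /cross /=; ring.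
have dd : 0 < sqdist P C by rewrite dot_gt0.
exists (Num.sqrt (sqdist Q C / sqdist P C)).
  by rewrite sqrtr_gt0 divr_gt0 // dot_gt0.
apply: right_region_legs => //; first by rewrite sqrtr_gt0 divr_gt0 // dot_gt0.
  by rewrite eq_sym -subr_eq0.
by rewrite sqr_sqrtr ?divr_ge0 ?dot_ge0 // divfK // gt_eqF.
Qed.

Lemma region_hull (T : triangle R) : region T = hull (vA T) (vB T) (vC T).
Proof. by []. Qed.

Lemma right_triangle_region (T : triangle R) : right_triangle T ->
  exists2 x, 0 < x & right_region x (region T).
Proof.
case: T => a b c T; rewrite /right_triangle region_hull /=; case=> e.
- by apply: right_angle_region => //; rewrite dotC.
- rewrite (hull_perm (esym (set3_rot a b c))).
  apply: right_angle_region => //.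
  by have -> : cross (c - b) (a - b) = cross (b - a) (c - a) by rewrite /cross /=; ring.
rewrite (hull_perm (set3_rot c a b)).
apply: right_angle_region; last by rewrite dotC.
by have -> : cross (a - c) (b - c) = cross (b - a) (c - a) by rewrite /cross /=; ring.
Qed.

Lemma extreme_region (T : triangle R) : extreme (region T) = [set vA T; vB T; vC T].
Proof.
case: T => a b c T; rewrite region_hull /=.
have [t|t|t] := ltrgtP 0 (cross (b - a) (c - a)); first exact: extreme_hull.
  rewrite -(hull_perm (set3_swap a b c)) extreme_hull; first exact: set3_swap.
  by rewrite /ccw crossC oppr_gt0.
by rewrite -t eqxx in T.
Qed.

(** A similarity maps extreme points to extreme points, hence vertices to
    vertices, and it preserves right angles and ratios of lengths. *)
Lemma right_region_similar x (T T' : triangle R) : 0 < x ->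
  right_region x (region T) -> similar_triangle T T' -> right_region x (region T').
Proof.
move=> x0 [[[C P] b] CP rE] [f sf fE].
rewrite right_region_hull // in rE; set Y := C + _ in rE.
have s0 : 0 < slope b x by rewrite slope_gt0.
have [k k0 H] := similarity_sqdist sf.
have E : [set f C; f P; f Y] = [set vA T'; vB T'; vC T'].
  rewrite -extreme_region -fE extreme_similarity // rE extreme_hull; last exact: leg_tile_ccw.
  apply/seteqP; split=> y /=.
    by case=> [[->|->]|->]; [exists C|exists P|exists Y] => //=; tauto.
  by case=> p [[->|->]|->] <-; tauto.
rewrite region_hull (hull_perm (esym E)).
have k2 : k ^+ 2 != 0 by rewrite expf_eq0 gt_eqF.
have vE : Y - C = slope b x *: perp (P - C) by rewrite /Y addrAC subrr add0r.
have : right_region (slope b x) (hull (f C) (f P) (f Y)).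
  apply: right_region_legs => //.
  - by apply: contra_neq CP; apply: similarity_inj.
  - have pol p q r : 2 * dot (q - r) (p - r) = sqdist q r + sqdist p r - sqdist q p :> R.
      by rewrite /sqdist /dot /=; ring.
    apply: (mulfI (x := 2)); first by rewrite pnatr_eq0.
    rewrite mulr0 pol !H -mulrDr -mulrBr -pol vE.
    by rewrite /dot /perp /= /GRing.scale /=; ring.
  rewrite !H /sqdist vE /dot /perp /= /GRing.scale /=; ring.
by case: (b) => //= /right_regionV; rewrite invrK.
Qed.

Section Frame.
Variables (C u C' v w : plane) (k : R).
Hypotheses (u0 : u != 0) (k0 : 0 < k) (vw : dot v w = 0).
Hypotheses (vv : dot v v = k ^+ 2 * dot u u) (ww : dot w w = k ^+ 2 * dot u u).

(** The map that sends [C], [C + u] and [C + perp u] to [C'], [C' + v] and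
    [C' + w]; it is a similarity when [v] and [w] are orthogonal and equally
    long. *)
Definition frame_map y : plane :=
  C' + (dot (y - C) u / dot u u) *: v + (cross u (y - C) / dot u u) *: w.

Lemma frame_similarity : similarity frame_map.
Proof.
have d0 : dot u u != 0 by rewrite dot_eq0.
apply: (sqdist_similarity k0) => p q.
set x := dot (p - q) u / dot u u; set z := cross u (p - q) / dot u u.
have dE : frame_map p - frame_map q = x *: v + z *: w.
  by apply: plane_eq; rewrite /frame_map /x /z /dot /cross /= /GRing.scale /=; ring.
rewrite /sqdist dE.
have -> : dot (x *: v + z *: w) (x *: v + z *: w) =
    x ^+ 2 * dot v v + 2 * x * z * dot v w + z ^+ 2 * dot w w.
  by rewrite /dot /= /GRing.scale /=; ring.
rewrite vw vv ww.
transitivity (k ^+ 2 * ((z * dot u u) ^+ 2 + (x * dot u u) ^+ 2) / dot u u); first by field.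
rewrite /x /z !divfK // [dot (p - q) u]dotC cross2_dot2.
by rewrite mulrA mulrAC mulfK // mulrC mulrA mulfK.
Qed.

Lemma frame_hull a b c : frame_map @` hull a b c =
  hull (frame_map a) (frame_map b) (frame_map c).
Proof.
have aff x1 x2 x3 : x1 + x2 + x3 = 1 -> frame_map (x1 *: a + x2 *: b + x3 *: c) =
    x1 *: frame_map a + x2 *: frame_map b + x3 *: frame_map c.
  move=> e; have -> : x1 = 1 - x2 - x3 by lra.
  by apply: plane_eq; rewrite /frame_map /dot /cross /= /GRing.scale /=; ring.
apply/seteqP; split=> y.
  case=> p /hullP[x1 [x2 [x3 [h1 h2 h3 e ->]]]] <-; apply/hullP.
  by exists x1, x2, x3; rewrite aff.
move=> /hullP[x1 [x2 [x3 [h1 h2 h3 e ->]]]].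
by exists (x1 *: a + x2 *: b + x3 *: c); [apply/hullP; exists x1, x2, x3|rewrite aff].
Qed.

Lemma frame_map0 : frame_map C = C'.
Proof. by apply: plane_eq; rewrite /frame_map /dot /cross /= /GRing.scale /=; ring. Qed.

Lemma frame_map1 : frame_map (C + u) = C' + v.
Proof.
have d0 : dot u u != 0 by rewrite dot_eq0.
have e : C + u - C = u by rewrite addrAC subrr add0r.
by rewrite /frame_map e divff // scale1r crossvv mul0r scale0r addr0.
Qed.

Lemma frame_map2 x : frame_map (C + x *: perp u) = C' + x *: w.
Proof.
have d0 : dot u u != 0 by rewrite dot_eq0.
have e : C + x *: perp u - C = x *: perp u by rewrite addrAC subrr add0r.
rewrite /frame_map e dotZl crossZr cross_perpr mulfK //.
have -> : dot (perp u) u = 0 by rewrite /dot /perp /=; ring.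
by rewrite mulr0 mul0r scale0r addr0.
Qed.
End Frame.

Lemma right_region_to_similar x (T T' : triangle R) : 0 < x ->
  right_region x (region T) -> right_region x (region T') -> similar_triangle T T'.
Proof.
move=> x0 [[[C P] b] CP rE] [[[C' P'] b'] CP' rE'].
rewrite !right_region_hull // in rE rE'.
set u := P - C in rE; set u' := P' - C' in rE'.
have u0 : u != 0 by rewrite subr_eq0 eq_sym.
have u'0 : u' != 0 by rewrite subr_eq0 eq_sym.
have PE : P = C + u by rewrite /u addrC subrK.
have PE' : P' = C' + u' by rewrite /u' addrC subrK.
have dd : 0 < dot u u by rewrite dot_gt0.
have dd' : 0 < dot u' u' by rewrite dot_gt0.
have p0 q : dot q (perp q) = 0 :> R by rewrite /dot /perp /=; ring.
have pp q : dot (perp q) (perp q) = dot q q by rewrite /dot /perp /=; ring.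
have s0 : 0 < slope b x by rewrite slope_gt0.
have [bb|bb] := eqVneq b' b.
  have k2 : Num.sqrt (dot u' u' / dot u u) ^+ 2 * dot u u = dot u' u'.
    by rewrite sqr_sqrtr ?divr_ge0 ?dot_ge0 // divfK // gt_eqF.
  exists (frame_map C u C' u' (perp u')).
    apply: (@frame_similarity _ _ _ _ _ (Num.sqrt (dot u' u' / dot u u))) => //; rewrite ?pp ?k2 //.
    by rewrite sqrtr_gt0 divr_gt0.
  by rewrite rE rE' frame_hull PE frame_map0 frame_map1 // frame_map2 // PE' bb.
pose z := (slope b x)^-1.
have z0 : 0 < z by rewrite invr_gt0.
have zE : slope b' x = z.
  by move: bb; rewrite /z; case: (b); case: (b') => //=; rewrite invrK.
have k2 : Num.sqrt (z ^+ 2 * dot u' u' / dot u u) ^+ 2 * dot u u = z ^+ 2 * dot u' u'.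
  rewrite sqr_sqrtr; last by rewrite divr_ge0 ?dot_ge0 // mulr_ge0 ?sqr_ge0 ?dot_ge0.
  by rewrite divfK // gt_eqF.
exists (frame_map C u C' (z *: perp u') (z *: u')).
  apply: (@frame_similarity _ _ _ _ _ (Num.sqrt (z ^+ 2 * dot u' u' / dot u u))) => //.
  - by rewrite sqrtr_gt0 divr_gt0 // mulr_gt0 // exprn_gt0.
  - by rewrite dotZl dotZr dotC p0 !mulr0.
  - by rewrite k2 dotZl dotZr pp; ring.
  - by rewrite k2 dotZl dotZr; ring.
rewrite rE rE' frame_hull PE frame_map0 frame_map1 // frame_map2 // PE' zE.
rewrite scalerA /z mulfV ?gt_eqF // scale1r.
exact: (hull_perm (set3_swap _ _ _)).
Qed.

Lemma side_continuous g y : {for y, continuous (side g)}.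
Proof.
rewrite /side /cross /=; apply: cvgB; apply: cvgMr => /=.
  by apply: cvgB; [apply: cvg_snd|apply: cvg_cst].
by apply: cvgB; [apply: cvg_fst|apply: cvg_cst].
Qed.

End Regions.

(** * Dissections of the regular polygon *)

Section Dissections.
Variable R : realType.
Local Notation plane := (plane R).
Implicit Types (p q u v a b c d y : plane) (x z : R) (S : set plane).

Lemma strict_interior (t : triple R) y :
  generic t y -> inside t y -> [set y | inside t y]° y.
Proof.
move=> gt it; rewrite /interior /=.
have pos g : g \in edges t -> \forall p \near y, 0 < side g p.
  move=> ge; have /cvgr_gt : side g @ y --> side g y by exact: side_continuous.
  by apply; rewrite lt_def (allP gt g ge) (allP it g ge).
case: t gt it pos => [[a b] c] gt it pos.
have h1 := pos (a, b) (mem_head _ _).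
have h2 : \forall p \near y, 0 < side (b, c) p by apply: pos; rewrite !inE eqxx orbT.
have h3 : \forall p \near y, 0 < side (c, a) p by apply: pos; rewrite !inE eqxx !orbT.
near=> p; rewrite /= insideE; apply/and3P; split; apply: ltW; near: p.
- exact: h1.
- exact: h2.
exact: h3.
Unshelve. all: by end_near. Qed.

(** A point off the boundaries that lies in a tile lies in its interior, hence in
    no other tile. *)
Lemma count_tiles n (t : 'I_n -> triangle R) (r : 'I_n -> triple R) (A : set plane) y :
  (forall i, region (t i) = [set y | inside (r i) y]) ->
  \bigcup_i region (t i) = A -> trivIset setT (fun i => (region (t i))°) ->
  all (fun t => generic t y) (map r (enum 'I_n)) ->
  count (fun t => inside t y) (map r (enum 'I_n)) = `[< A y >].
Proof.
move=> rE AE tI gen; rewrite count_map.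
have int i : inside (r i) y -> (region (t i))° y.
  rewrite rE; apply: strict_interior; apply: (allP gen).
  by apply: map_f; rewrite mem_enum.
have [Ay|nAy] := asboolP (A y).
  move: Ay; rewrite -AE => -[i _]; rewrite rE /= => ii.
  rewrite (eq_in_count (a2 := pred1 i)); last first.
    move=> j _ /=; apply/idP/eqP => [ij|->//].
    apply: tI => //; exists y; split; exact: int.
  by rewrite count_uniq_mem ?enum_uniq // mem_enum.
rewrite (eq_in_count (a2 := pred0)) ?count_pred0 // => j _ /=; apply/negbTE/negP => ij.
by apply: nAy; rewrite -AE; exists j => //; rewrite rE.
Qed.

(** An interior point on the boundary line could be moved across it. *)
Lemma halfplane_interior S d y : d != 0 -> (forall p, S p -> 0 <= cross d p) ->
  S° y -> 0 < cross d y.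
Proof.
move=> d0 HS Sy; rewrite lt_def HS ?andbT; last exact: interior_subset Sy.
apply/negP => /eqP e.
have dd : 0 < dot d d by rewrite dot_gt0.
have K0 : 0 < `|d.1| + `|d.2| + 1 by rewrite ltr_wpDl ?addr_ge0.
have /nbhs_ballP[r /= r0 H] : nbhs y S by exact: Sy.
pose z := r / (`|d.1| + `|d.2| + 1); have z0 : 0 < z by rewrite divr_gt0.
have zr x : `|x| <= `|d.1| + `|d.2| -> `|z * x| < r.
  move=> h; rewrite normrM gtr0_norm // /z mulrAC ltr_pdivrMr // ltr_pM2l //.
  by apply: le_lt_trans h _; rewrite ltrDl.
have /HS : S (y - z *: perp d).
  apply: H; split; rewrite /ball /= opprB addrC subrK.
    by rewrite /GRing.scale /= zr // normrN lerDr.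
  by rewrite /GRing.scale /= zr // lerDl.
rewrite crossDr crossNr crossZr cross_perpr e sub0r oppr_ge0 leNgt.
by rewrite mulr_gt0.
Qed.

Section Standard.
Variable N : nat.
Hypothesis N2 : (2 < N)%N.
Local Notation t := (@pi R / N%:R).
Local Notation X := (std_vertex R N).

Let N0 : (0 < N)%N. Proof. exact: ltn_trans N2. Qed.
Let NR : N%:R != 0 :> R. Proof. by rewrite pnatr_eq0 -lt0n. Qed.
Let t0 : 0 < t. Proof. by rewrite divr_gt0 ?pi_gt0 // ltr0n. Qed.
Let tN : N%:R * t = pi. Proof. by field. Qed.

Definition std_triangle j : triangle R :=
  Triangle (lt0r_neq0 (std_tile_ccw R j N2)).

Lemma std_region j : region (std_triangle j) = [set y | inside (std_tile R N j) y].
Proof. by rewrite region_hull inside_hull //; exact: std_tile_ccw. Qed.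

Lemma std_right_region j : right_region (tan t) (region (std_triangle j)).
Proof.
have c0 := cos_pi_gt0 R N2.
have s0 : 0 < sin t by apply: sin_gt0_pi; have := @frac_pi_itv R 1 N; rewrite mul1r; apply; rewrite (ltnW N2).
have x0 : 0 < tan t by rewrite divr_gt0.
rewrite region_hull /=.
pose m i : plane := dir (i.*2.+1%:R * t).
have Xm i : X i.*2.+1 = cos t *: m i by rewrite /std_vertex /std_radius /= odd_double.
have mm i : dot (m i) (m i) = 1 by rewrite dot_dir subrr cos0.
have sE i : side_dir R N i = perp (m i) by rewrite perp_dir.
have leg i Q z : z ^+ 2 = 1 -> Q - X i.*2.+1 = (z * sin t) *: perp (m i) ->
    right_region (tan t) (hull (X i.*2.+1) 0 Q).
  move=> z1 QE; apply: right_region_legs => //.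
  - by rewrite Xm scaler_eq0 negb_or dir_neq0 gt_eqF.
  - by rewrite QE sub0r Xm /dot /perp /= /GRing.scale /=; ring.
  rewrite /sqdist QE sub0r Xm.
  transitivity (z ^+ 2 * sin t ^+ 2 * dot (m i) (m i)).
    by rewrite /dot /perp /= /GRing.scale /=; ring.
  rewrite z1 mm.
  transitivity (tan t ^+ 2 * cos t ^+ 2 * dot (m i) (m i)); last first.
    by rewrite /dot /= /GRing.scale /=; ring.
  by rewrite mm /tan; field; rewrite gt_eqF.
rewrite -(odd_double_half j); set i := j./2; case: (odd j) => /=; rewrite ?add0n ?add1n.
  have -> : hull 0 (X i.*2.+1) (X i.*2.+2) = hull (X i.*2.+1) 0 (X i.*2.+2).
    by apply: hull_perm; apply/seteqP; split=> y [[]|]; rewrite /=; tauto.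
  apply: (leg i _ 1); first by ring.
  by have [_ ->] := std_side R N i; rewrite mul1r sE.
have -> : hull 0 (X i.*2) (X i.*2.+1) = hull (X i.*2.+1) 0 (X i.*2).
  by apply: hull_perm; apply/seteqP; split=> y [[]|]; rewrite /=; tauto.
apply: (leg i _ (-1)); first by ring.
have [h _] := std_side R N i.
by rewrite -opprB h sE -scaleNr mulN1r.
Qed.

Lemma sector th : 0 <= th -> th < 2 * pi ->
  exists2 j, (j < N.*2)%N & j%:R * t <= th /\ th < j.+1%:R * t.
Proof.
move=> th0 th1; pose z := th / t.
have z0 : 0 <= z by rewrite divr_ge0 // ltW.
have /andP[h1 h2] := truncn_itv z0.
exists (Num.truncn z).
  rewrite -(ltr_nat R); apply: le_lt_trans h1 _.
  by rewrite ltr_pdivrMr // -muln2 natrM mulrAC tN mulrC.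
by rewrite -ler_pdivlMr // -ltr_pdivrMr.
Qed.

Lemma side_std j y : [/\ side (0, X j) y = cross (X j) y,
   side (X j.+1, 0) y = cross y (X j.+1) &
   side (X j, X j.+1) y = sin t * (cos t - dot y (dir (j./2.*2.+1%:R * t)))].
Proof.
split.
- by rewrite /side /= !subr0.
- by rewrite /side /cross /=; ring.
rewrite /side /=; set i := j./2.
have [h1 h2] := std_side R N i.
have sE : side_dir R N i = perp (dir (i.*2.+1%:R * t)) by rewrite perp_dir.
have Xm : X i.*2.+1 = cos t *: dir (i.*2.+1%:R * t).
  by rewrite /std_vertex /std_radius /= odd_double.
have mm : dot (dir (i.*2.+1%:R * t)) (dir (i.*2.+1%:R * t)) = 1 by rewrite dot_dir subrr cos0.
move: sE Xm mm; set m := dir _ => sE Xm mm.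
have key z : cross (sin t *: perp m) (y - (cos t *: m + z *: perp m)) =
    sin t * (cos t * dot m m - dot y m).
  by rewrite /cross /dot /perp /= /GRing.scale /=; ring.
rewrite mm mulr1 in key.
rewrite -(odd_double_half j) -/i; case: (odd j); rewrite ?add1n ?add0n.
  by rewrite h2 sE -(key 0) Xm scale0r addr0.
rewrite h1 sE -(key (- sin t)) -Xm; congr (cross _ (y - _)).
by rewrite scaleNr -sE -h1 opprB addrC subrK.
Qed.

Lemma step_lt_pi : t < pi.
Proof. by rewrite -[ltRHS]tN -[ltLHS]mul1r ltr_pM2r // ltr1n ltnW. Qed.

Lemma sector_unique (th : R) j : 0 <= th -> th < 2 * pi -> (j < N.*2)%N ->
  0 < sin (th - j%:R * t) -> 0 < sin (j.+1%:R * t - th) ->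
  j%:R * t < th /\ th < j.+1%:R * t.
Proof.
move=> th0 th1 jN; have jE : j.+1%:R * t = j%:R * t + t by rewrite -addn1 natrD; ring.
have j0 : 0 <= j%:R * t by rewrite mulr_ge0 // ltW.
have j1 : j%:R * t + t <= 2 * pi.
  have -> : 2 * pi = (N.*2)%:R * t by rewrite -muln2 natrM mulrAC tN mulrC.
  by rewrite -jE ler_pM2r // ler_nat.
have tpi := step_lt_pi.
have -> : j.+1%:R * t - th = t - (th - j%:R * t) by rewrite jE; ring.
rewrite jE; move: tpi t0; move: t (j%:R * t) j0 j1 {jE} => u z z0 z1 upi u0 s1 s2.
have [p|n] := ltP 0 (th - z).
  have [q|q] := ltP (th - z) u; first by split; lra.
  have [r|r] := ltP (th - z) pi.
    by move: s2; rewrite ltNge sin_le0 //; right; apply/andP; split; lra.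
  by move: s1; rewrite ltNge sin_le0 //; left; apply/andP; split; lra.
have [q|q] := ltP (th - z) (- pi).
  by move: s2; rewrite ltNge sin_le0 //; left; apply/andP; split; lra.
by move: s1; rewrite ltNge sin_le0 //; right; apply/andP; split; lra.
Qed.

(** The odd multiples of [pi / N] stay away from [0] by at least [pi / N], modulo
    [2 pi]: the midpoints of the sides of the polygon are as far out in their
    direction as any vertex. *)
Lemma cos_odd_le m : odd m -> cos (m%:R * t) <= cos t.
Proof.
move=> om; have M0 : (0 < N.*2)%N by rewrite double_gt0.
set n := (m %% N.*2)%N.
have on : odd n by move: om; rewrite {1}(divn_eq m N.*2) oddD oddM odd_double andbF.
have -> : cos (m%:R * t) = cos (n%:R * t).
  rewrite {1}(divn_eq m N.*2) -/n natrD mulrDl natrM addrC.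
  have -> : (m %/ N.*2)%:R * (N.*2)%:R * t = (m %/ N.*2 * 2)%:R * pi.
    by rewrite -muln2 !natrM; field.
  by rewrite cosDnpi exprM sqrr_sign mul1r.
have nN : (n < N.*2)%N by rewrite ltn_pmod.
have main k : (0 < k <= N)%N -> cos (k%:R * t) <= cos t.
  case/andP=> k0 kN; have [->|k1] := eqVneq k 1%N; first by rewrite mul1r.
  have tk : t < k%:R * t by rewrite -{1}[t]mul1r ltr_pM2r // ltr1n ltn_neqAle eq_sym k1.
  have kp : k%:R * t <= pi by rewrite -[leRHS]tN ler_pM2r // ler_nat.
  by apply/ltW; rewrite ltr_cos // in_itv /= ?kp ?(ltW (lt_trans t0 tk)) ?(ltW t0) ?(ltW step_lt_pi).
have [h|h] := leqP n N; first by apply: main; rewrite h andbT; case: (n) on.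
have -> : cos (n%:R * t) = cos ((N.*2 - n)%:R * t).
  rewrite natrB ?(ltnW nN) // mulrBl -muln2 natrM mulrAC tN.
  have -> : pi * 2 - n%:R * t = - (n%:R * t) + pi *+ 2 by rewrite mulr2n; ring.
  by rewrite cosD2pi cosN.
by apply: main; rewrite subn_gt0 nN leq_subLR -addnn leq_add2r ltnW.
Qed.

Lemma polygonE : regular_polygon R N =
  convex_hull [set X k.*2 | k in `I_N].
Proof.
congr convex_hull; apply/seteqP.
by split=> _ [k kN <-]; exists k => //; rewrite std_vertex_even /dir;
  have -> : 2 * (k%:R * t) = 2 * pi * k%:R / N%:R by field.
Qed.

Lemma hull_convex S : @convex_set R plane (convex_hull S).
Proof.
apply/convexP => p q x x0 x1 Sp Sq A [cA SA].
by apply: (proj1 (convexP A) cA) => //; [apply: Sp|apply: Sq].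
Qed.

Lemma std_vertex_in j : (j <= N.*2)%N -> regular_polygon R N (X j).
Proof.
have ev i : (i <= N)%N -> regular_polygon R N (X i.*2).
  rewrite polygonE leq_eqVlt => /predU1P[->|iN].
    rewrite std_vertex_period // -double0; apply: sub_gen_smallest; by exists 0%N.
  by apply: sub_gen_smallest; exists i.
rewrite -(odd_double_half j); case: (odd j); rewrite ?add1n ?add0n; last first.
  by rewrite leq_double; apply: ev.
set i := j./2 => ij; have iN : (i < N)%N by rewrite -ltn_double.
have [h1 h2] := std_side R N i.
have -> : X i.*2.+1 = 2^-1 *: X i.*2 + (1 - 2^-1) *: X i.+1.*2.
  rewrite doubleS -[X i.*2.+2](subrK (X i.*2.+1)) h2 -h1.
  by apply: plane_eq; rewrite /= /GRing.scale /=; field.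
apply: (proj1 (convexP _) (@hull_convex _)); [lra|lra|by apply: ev; exact: ltnW|by apply: ev].
Qed.

Lemma zero_in : regular_polygon R N 0.
Proof.
have := @std_vertex_in N; rewrite -addnn leq_addr => /(_ isT) XN.
have := @std_vertex_in 0 isT => X0.
have r0 := std_radius_gt0 R N N2.
have XNE : X N = - std_radius R N N *: X 0.
  rewrite /std_vertex tN mul0r /dir cospi sinpi cos0 sin0 /std_radius /= scale1r.
  by apply: plane_eq; rewrite /= /GRing.scale /=; ring.
set r := std_radius _ _ _ in XNE r0.
have -> : 0 = (1 + r)^-1 *: X N + (1 - (1 + r)^-1) *: X 0.
  by rewrite XNE; apply: plane_eq; rewrite /= /GRing.scale /=; field; rewrite gt_eqF //; lra.
have r1 : 0 < 1 + r by lra.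
apply: (proj1 (convexP _) (@hull_convex _)) => //; first by rewrite invr_ge0 ltW.
by rewrite invf_le1 //; lra.
Qed.

(** The tiles are in the polygon because their vertices are. Conversely, a point
    of the polygon is in the sector of one of the tiles, and it satisfies the
    inequality of the outer side because the vertices of the polygon do. *)
Lemma std_cover : \bigcup_(j : 'I_(N.*2)) region (std_triangle j) = regular_polygon R N.
Proof.
have c0 := cos_pi_gt0 R N2.
have tpi := step_lt_pi.
have s0 : 0 < sin t by apply: sin_gt0_pi; rewrite t0.
have rho j := std_radius_gt0 R j N2.
apply/seteqP; split=> y.
  case=> j _; rewrite region_hull; apply: hull_sub.
  - exact: hull_convex.
  - exact: zero_in.
  - by apply: std_vertex_in; rewrite ltnW.
  - by apply: std_vertex_in.
move=> Py.
have half i : dot y (dir (i.*2.+1%:R * t)) <= cos t.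
  move: y Py; rewrite polygonE.
  apply: (@smallest_sub _ _ _ [set y | dot y (dir (i.*2.+1%:R * t)) <= cos t]).
    apply/convexP => p q x x0 x1 /= h1 h2; rewrite dotDl !dotZl.
    by have := @ler_wpM2l _ x x0 _ _ h1; have := @ler_wpM2l _ (1 - x) _ _ _ h2; lra.
  move=> _ [k kN <-] /=; rewrite std_vertex_even dot_dir.
  have [le|lt] := leqP i.*2.+1 k.*2.
    have -> : 2 * (k%:R * t) - i.*2.+1%:R * t = (k.*2 - i.*2.+1)%:R * t.
      by rewrite natrB // -[k.*2]muln2 natrM; ring.
    by apply: cos_odd_le; rewrite oddB // odd_double /= odd_double.
  rewrite -cosN.
  have -> : - (2 * (k%:R * t) - i.*2.+1%:R * t) = (i.*2.+1 - k.*2)%:R * t.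
    by rewrite natrB ?(ltnW lt) // -[k.*2]muln2 natrM; ring.
  by apply: cos_odd_le; rewrite oddB ?(ltnW lt) //= !odd_double.
suff [j jN ij] : exists2 j, (j < N.*2)%N & inside (std_tile R N j) y.
  by exists (Ordinal jN) => //; rewrite std_region.
have [y0|/polar[r [th [r0 th0 th1 yE]]]] := eqVneq y 0.
  exists 0%N; first by rewrite double_gt0.
  have [h1 h2 h3] := side_std 0 y.
  rewrite insideE h1 h2 h3 y0 /dot /cross /= !mul0r !mulr0 !subr0 !addr0 lexx /=.
  by rewrite andbT subr0 mulr_ge0 ?(ltW s0) ?(ltW c0).
have [j jN [j1 j2]] := sector th0 th1; exists j => //.
have [h1 h2 h3] := side_std j y.
have jE : j.+1%:R * t = j%:R * t + t by rewrite -addn1 natrD; ring.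
rewrite insideE h1 h2 h3; apply/and3P; split.
- rewrite yE /std_vertex crossZl crossZr cross_dir !mulr_ge0 ?(ltW r0) ?(ltW (rho j)) //.
  by apply: sin_ge0_pi; move: tpi t0; rewrite jE in j2; move: t (j%:R * t) j1 j2 => u z *; apply/andP; split; lra.
- by rewrite mulr_ge0 ?(ltW s0) // subr_ge0.
rewrite yE /std_vertex crossZl crossZr cross_dir !mulr_ge0 ?(ltW r0) ?(ltW (rho j.+1)) //.
by apply: sin_ge0_pi; move: tpi t0; rewrite jE in j2 *; move: t (j%:R * t) j1 j2 => u z *; apply/andP; split; lra.
Qed.

(** The interiors of the tiles are in the open sectors, which are disjoint. *)
Lemma std_disjoint : trivIset setT (fun j : 'I_(N.*2) => (region (std_triangle j))°).
Proof.
have rho j := std_radius_gt0 R j N2.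
have cone (j : nat) y : (region (std_triangle j))° y ->
    0 < cross (dir (j%:R * t)) y /\ 0 < cross y (dir (j.+1%:R * t)).
  move=> Sy; split.
    apply: (halfplane_interior _ _ Sy); first exact: dir_neq0.
    move=> p; rewrite std_region /= insideE => /and3P[+ _ _].
    by have [-> _ _] := side_std j p; rewrite /std_vertex crossZl pmulr_rge0.
  rewrite -[cross y _]opprK -crossC -crossNl.
  apply: (halfplane_interior _ _ Sy); first by rewrite oppr_eq0 dir_neq0.
  move=> p; rewrite std_region /= insideE => /and3P[_ _].
  by have [_ -> _] := side_std j p; rewrite /std_vertex crossZr pmulr_rge0 // crossNl -crossC.
move=> i j _ _ [y [/cone[i1 i2] /cone[j1 j2]]].
have y0 : y != 0 by apply: contraTneq i1 => ->; rewrite /cross /= !mulr0 subrr ltxx.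
have [r [th [r0 th0 th1 yE]]] := polar y0.
move: i1 i2 j1 j2; rewrite yE !crossZl !crossZr !cross_dir !pmulr_rgt0 // => i1 i2 j1 j2.
have [a1 a2] := sector_unique th0 th1 (ltn_ord i) i1 i2.
have [b1 b2] := sector_unique th0 th1 (ltn_ord j) j1 j2.
have ij : (i < j.+1)%N by rewrite -(ltr_nat R) -(ltr_pM2r t0); apply: lt_trans a1 b2.
have ji : (j < i.+1)%N by rewrite -(ltr_nat R) -(ltr_pM2r t0); apply: lt_trans b1 a2.
by apply/val_inj/eqP; rewrite eqn_leq -ltnS ij -ltnS ji.
Qed.

Lemma std_right_triangle : right_triangle (std_triangle 0).
Proof.
constructor 3; rewrite /=; have [h _] := std_side R N 0; rewrite double0 in h.
rewrite -[X 0 - X 1]opprB h /side_dir double0 -perp_dir /std_vertex /std_radius /=.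
by rewrite /dot /perp /= /GRing.scale /=; ring.
Qed.

Lemma tan_gt0 : 0 < tan t.
Proof.
by rewrite divr_gt0 ?cos_pi_gt0 ?sin_gt0_pi ?t0 ?step_lt_pi.
Qed.

Lemma std_tiles_polygon : tiles (std_triangle 0) (regular_polygon R N).
Proof.
exists N.*2, (fun j => std_triangle j); split; [|exact: std_cover|exact: std_disjoint].
move=> j; apply: (right_region_to_similar tan_gt0); exact: std_right_region.
Qed.

(** Both dissections cover exactly the points of the polygon off the boundaries,
    so that [unique_slope] applies. *)
Lemma tiles_unique (T : triangle R) : N <> 4%N -> right_triangle T ->
  tiles T (regular_polygon R N) -> right_region (tan t) (region T).
Proof.
move=> N4 /right_triangle_region[x x0 rT] [n [tt [sim cov tI]]].
have /choice[it itP] : forall i, exists i' : item R,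
    nondeg i' /\ region (tt i) = [set y | inside (tile x i') y].
  by move=> i; have [i' nd rE] := right_region_similar x0 rT (sim i); exists i'.
pose s := map it (enum 'I_n).
have sn : all (@nondeg R) s by apply/allP => _ /mapP[i _ ->]; case: (itP i).
have sE : map (tile x) s = map (fun i => tile x (it i)) (enum 'I_n) by rewrite -map_comp.
have stdE : std_tiles R N = map (fun j : 'I_(N.*2) => std_tile R N j) (enum 'I_(N.*2)).
  by rewrite /std_tiles -val_enum_ord -map_comp.
have sc : same_cover (map (tile x) s) (std_tiles R N).
  move=> y; rewrite all_cat sE stdE => /andP[g1 g2].
  rewrite (count_tiles (t := tt) (A := regular_polygon R N)) //; last first.
    by move=> i; case: (itP i).
  rewrite (count_tiles (t := fun j : 'I_(N.*2) => std_triangle j) (A := regular_polygon R N)) //.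
  - by move=> j; exact: std_region.
  - exact: std_cover.
  - exact: std_disjoint.
have [<-//|<-] := unique_slope N2 N4 x0 sn sc.
exact: right_regionV.
Qed.

End Standard.

End Dissections.

Theorem theorem1 (R : realType) (N : nat) (hN : (3 <= N)%N) (hN4 : N <> 4%N) :
  exists T : triangle R,
    [/\ right_triangle T,
        tiles T (regular_polygon R N)
      & forall T' : triangle R,
          right_triangle T' -> tiles T' (regular_polygon R N) -> similar_triangle T' T].
Proof.
exists (std_triangle R hN 0); split.
- exact: std_right_triangle.
- exact: std_tiles_polygon.
move=> T' rT' tT'.
apply: (right_region_to_similar (tan_gt0 R hN)); first exact: tiles_unique.
exact: std_right_region.
Qed.
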